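(* Let $G$ be a connected graph with no false-twin vertices. If $G$ has at least $13$ vertices, then $G$ has at least $7$ bicliques.
   Context: All graphs are finite, simple, undirected and connected. Two distinct vertices $u,w$ are false twins if their open neighborhoods coincide, $N(u)=N(w)$; a graph is false-twin-free if it has no such pair. A biclique of $G$ is a maximal (under inclusion of vertex sets) induced complete bipartite subgraph of $G$ with both sides nonempty. *)

(* Defs.v *)
From mathcomp Require Import all_boot.
Set Implicit Arguments. Unset Strict Implicit. Unset Printing Implicit Defensive.

Section Graphs.
Variable T : finType.
Variable e : rel T.

Definition simple_graph : Prop := symmetric e /\ irreflexive e.

Definition connected_graph : Prop := forall x y : T, connect e x y.

Definition nbhd (v : T) : {set T} := [set w | e v w].

Definition false_twins (u w : T) : bool := (u != w) && (nbhd u == nbhd w).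

Definition false_twin_free : Prop := forall u w : T, ~~ false_twins u w.

Definition induces_cbip (S : {set T}) : bool :=
  [exists X : {set T}, exists Y : {set T},
    [&& X :|: Y == S, [disjoint X & Y], X != set0, Y != set0,
        [forall x in X, forall y in X, ~~ e x y],
        [forall x in Y, forall y in Y, ~~ e x y] &
        [forall x in X, forall y in Y, e x y]]].

Definition is_biclique (S : {set T}) : bool :=
  induces_cbip S && [forall S' : {set T}, (S \proper S') ==> ~~ induces_cbip S'].

Definition bicliques : {set {set T}} := [set S | is_biclique S].

End Graphs.

(* Main.v *)
Require Import Defs.
From mathcomp Require Import all_boot.

(* Call two vertex sets conflicting when no complete bipartite induced subgraph
   contains both; pairwise conflicting sets, each spanning a complete bipartite
   graph with an edge, extend to distinct bicliques, so it suffices to find seven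
   of them.

   If the graph is triangle-free, (C(v), N(v)), where C(v) is the set of common
   neighbours of N(v), is a biclique for every v.  By false-twin-freeness at most
   two vertices give the same biclique, so the graph has at most twice as many
   vertices as bicliques.

   Otherwise start from the three edges of a triangle and enlarge the conflicting
   family F as long as possible.  A vertex v is labelled, for each member of F it
   can be added to, by the side it would take.  If two vertices can be added to the
   same member but are wrongly adjacent for their sides, that member splits into
   two; if an edge or an induced path on three vertices is compatible with no
   member, it is a new member.  When neither applies, the labels determine
   adjacency, so by false-twin-freeness distinct vertices have distinct labels, and
   it remains to see that at most 12 labels can occur.  This is checked by
   computation on a table of small induced subgraphs: each entry either carries
   seven conflicting sets, or allows at most 12 labels while each way of enlarging
   F produces a seventh set or a copy of a later entry. *)

(** A vertex set is complete bipartite or edgeless exactly when its adjacency is [c u (+) c v] for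
    some two-colouring [c]. Once the set contains an edge, [c] is unique up to swapping the colours,
    so a vertex can join the set on at most one side; this makes labels well defined. If [v] and [z]
    can both join a set, any complete bipartite graph containing all of them forces their adjacency
    to be the xor of their labels. A wrong adjacency therefore turns the set with [v] and the set
    with [z] into a conflicting pair.

    The search is finite because a conflict depends only on the subgraph induced on the sets
    concerned, and only growths with at most two vertices outside a core graph are tested. Two
    suffice: whether the labels determine an adjacency is a question about one pair of vertices.

    The obstacle is the count. More than 12 labels may be admissible one at a time. Some pairs of
    them, however, cannot occur together, whichever way the two vertices are joined; labels are then
    collected into groups that admit one vertex each. The number 12 is twice six, the bound that the
    triangle-free case gives for six bicliques. *)

Set Implicit Arguments.
Unset Strict Implicit.
Unset Printing Implicit Defensive.

(** * Two-colourings, labels and growth of conflicting families *)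

Section Families.
Variables (V : eqType) (a : rel V).

(* Complete bipartiteness (possibly edgeless): the two sides are read off from the
   adjacency to the first element. *)
Definition bip (s : seq V) : bool :=
  if s is x :: _ then
    all (fun u => all (fun v => a u v == a u x (+) a v x) s) s
  else true.

(** The list [s ++ t] stands for the union: repetitions do not affect [bip]. The edge in each member
    is what lets it extend to a biclique. *)
Definition family (F : seq (seq V)) : bool :=
  all (fun s => bip s && has (fun u => has (a u) s) s) F
  && pairwise (fun s t => ~~ bip (s ++ t)) F.

(* The side that a vertex with adjacency [r] takes when added to [s], relative to
   the first element of [s]; [None] if it cannot be added. *)
Definition label (r : pred V) (s : seq V) : option bool :=
  if s is x :: _ then
    if all (fun u => r u == r x (+) a u x) s then Some (r x) else None
  else None.

Arguments bip : simpl never.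
Arguments label : simpl never.

(** Any colouring may be shifted by the colour of the head [x]; the shifted colouring is the
    adjacency to [x], so testing this single colouring loses nothing. *)
Lemma bipP s :
  reflect (exists c : pred V, {in s &, forall u v, a u v = c u (+) c v}) (bip s).
Proof.
case: s => [|x s]; first by left; exists pred0.
apply: (iffP allP) => [Hb|[c Hc] u us].
  by exists (a^~ x) => u v us vs; apply/eqP; move/allP: (Hb u us); apply.
apply/allP => v vs; rewrite !Hc ?mem_head //.
by case: (c u); case: (c v); case: (c x).
Qed.

Lemma sub_bip s t : {subset s <= t} -> bip t -> bip s.
Proof.
move=> st /bipP[c Hc]; apply/bipP; exists c => u v us vs.
by apply: Hc; apply: st.
Qed.

(** The colour of [v] relative to the head is the same for every colouring. Here [c] may colour a
    larger set [t], so that the labels of several vertices can be read from one common colouring. *)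
Lemma label_bip (c : pred V) x (s t : seq V) v :
    {subset v :: x :: s <= t} -> {in t &, forall u w, a u w = c u (+) c w} ->
  label (a v) (x :: s) = Some (c v (+) c x).
Proof.
move=> st Hc; have vt : v \in t by apply: st; rewrite mem_head.
have {}st u : u \in x :: s -> u \in t by move=> us; apply: st; rewrite inE us orbT.
have xt : x \in t by apply: st; rewrite mem_head.
rewrite /label ifT ?Hc //; apply/allP => u /st ut.
by rewrite !Hc //; case: (c u); case: (c v); case: (c x).
Qed.

Hypotheses (a_sym : symmetric a) (a_irr : irreflexive a).

(** The converse direction: a label certifies that [v] can be added, since the adjacency to the head
    then colours the enlarged set. *)
Lemma label_Some v x s p :
    bip (x :: s) -> label (a v) (x :: s) = Some p ->
  p = a v x /\ {in v :: x :: s &, forall u w, a u w = a u x (+) a w x}.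
Proof.
move=> /allP Hb; rewrite /label; case: ifP => // /allP Hl [<-]; split=> // u w.
have Hv t : t \in x :: s -> a v t = a v x (+) a t x by move/Hl/eqP.
have Hs t r : t \in x :: s -> r \in x :: s -> a t r = a t x (+) a r x.
  by move=> ts rs; apply/eqP; move/allP: (Hb t ts); apply.
rewrite inE => /predU1P[->|us]; rewrite inE => /predU1P[->|ws].
- by rewrite a_irr addbb.
- exact: Hv.
- by rewrite a_sym Hv // addbC.
- exact: Hs.
Qed.

(** A colouring [c] of both enlarged copies of [s] would make the labels [c v (+) c x] and
    [c z (+) c x], whose xor is [a v z], against the hypothesis. Conflicts with the other members
    persist because supersets of conflicting sets conflict. *)
Lemma family_clash F s v z p q :
    family F -> s \in F -> label (a v) s = Some p -> label (a z) s = Some q ->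
    p (+) q != a v z ->
  exists F1 F2, F = F1 ++ s :: F2 /\ family (F1 ++ [:: v :: s, z :: s & F2]).
Proof.
move=> /andP[Ha Hp] sF Lv Lz ne; case/splitPr: sF Ha Hp => F1 F2 Ha Hp.
exists F1, F2; split=> //; move: Ha; rewrite all_cat /= => /and3P[HF1 /andP[Hb He] HF2].
case: s Lv Lz Hb He Hp => [//|x s] Lv Lz Hb He Hp.
have [pE Hv] := label_Some Hb Lv; have [qE Hz] := label_Some Hb Lz.
have edge w : has (fun u => has (a u) (w :: x :: s)) (w :: x :: s).
  case/hasP: He => u us /hasP[t ts aut]; apply/hasP; exists u; first by rewrite inE us orbT.
  by apply/hasP; exists t => //; rewrite inE ts orbT.
have bip_s w : {in w :: x :: s &, forall u t, a u t = a u x (+) a t x} -> bip (w :: x :: s).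
  by move=> Hw; apply/bipP; exists (a^~ x).
move: Hp; rewrite !pairwise_cat /= => /and3P[].
rewrite allrel_consr => /andP[H1s H12] P1 /andP[Hs2 P2].
apply/andP; split.
  rewrite all_cat HF1; apply/and4P; split=> //.
    by rewrite (bip_s _ Hv) edge.
  by rewrite (bip_s _ Hz) edge.
rewrite pairwise_cat !allrel_consr /= P1 P2 H12 !andbT /=.
have catl w t : ~~ bip (t ++ x :: s) -> ~~ bip (t ++ w :: x :: s).
  apply: contra; apply: sub_bip => u; rewrite !mem_cat => /orP[->//|us].
  by rewrite [_ \in _ :: _]inE us !orbT.
have catr w t : ~~ bip ((x :: s) ++ t) -> ~~ bip ((w :: x :: s) ++ t).
  by apply: contra; apply: sub_bip => u us; rewrite inE us orbT.
have all1 w : all (fun t => ~~ bip (t ++ w :: x :: s)) F1.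
  by apply/allP => t tF; apply: catl; move/allP: H1s; apply.
have all2 w : all (fun t => ~~ bip ((w :: x :: s) ++ t)) F2.
  by apply/allP => t tF; apply: catr; move/allP: Hs2; apply.
rewrite !all1 !all2 !andbT /=; apply: contra ne => /bipP[c Hc].
have sub w : w \in [:: v; z] -> {subset w :: x :: s <= (v :: x :: s) ++ z :: x :: s}.
  move=> wvz u; rewrite inE => /predU1P[->|us]; last by rewrite mem_cat [_ \in v :: _]inE us orbT.
  by move: wvz; rewrite !inE mem_cat !inE => /orP[]->; rewrite ?orbT.
have vs : v \in (v :: x :: s) ++ z :: x :: s by apply: (sub v); rewrite mem_head.
have zs : z \in (v :: x :: s) ++ z :: x :: s by apply: (sub z); rewrite ?mem_head // !inE eqxx orbT.
move: Lv Lz; rewrite !(label_bip (c := c) (sub _ _) Hc) ?inE ?eqxx ?orbT // => -[<-] [<-].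
by rewrite (Hc v z) //; case: (c v); case: (c z); case: (c x).
Qed.

(** A colouring of the path together with a member [s] would give [y] and [z] labels in [s] that
    both differ from the label of [v], which the last hypothesis excludes. The case [y = z] is
    included and adds a single edge. *)
Lemma family_path F v y z :
    family F -> a v y -> a v z -> ~~ a y z ->
    (forall s p q r, s \in F -> label (a v) s = Some p -> label (a y) s = Some q ->
       label (a z) s = Some r -> ~~ ((p (+) q) && (p (+) r))) ->
  family ([:: v; y; z] :: F).
Proof.
move=> /andP[Ha Hp] avy avz /negbTE nyz HF; have bvyz : bip [:: v; y; z].
  by rewrite /bip /= !a_irr avy avz (a_sym y v) (a_sym z v) avy avz (a_sym z y) nyz.
rewrite /family /= Hp Ha bvyz avy orbT !andbT /=.
apply/allP => s sF; apply/negP => /bipP[c Hc].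
(* The empty list contains no edge, so it is not a member. *)
case: s => [|x s] in sF Hc *; first by move/allP: Ha => /(_ _ sF).
set t := [:: v, y, z, x & s]; have st w : w \in [:: v; y; z] -> {subset w :: x :: s <= t}.
  move=> wt u; rewrite inE => /predU1P[->|us]; rewrite -[t]/([:: v; y; z] ++ x :: s) mem_cat.
    by rewrite wt.
  by rewrite us orbT.
have Hl w : w \in [:: v; y; z] -> label (a w) (x :: s) = Some (c w (+) c x).
  by move=> wt; apply: label_bip (st w wt) Hc.
have := HF _ _ _ _ sF (Hl v _) (Hl y _) (Hl z _); rewrite !inE !eqxx ?orbT => /(_ isT isT isT).
move: avy avz; rewrite !Hc ?inE ?eqxx ?orbT //.
by case: (c v); case: (c y); case: (c z); case: (c x).
Qed.

End Families.

(** * Conflicting families give bicliques; the triangle-free case *)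

Section Bicliques.
Variables (T : finType) (e : rel T).
Hypothesis (e_sym : symmetric e).

(** Membership in the side [X] is a colouring; conversely, the colour classes of the two ends of an
    edge serve as sides, and the edge makes both nonempty. *)
Lemma induces_cbipP (S : {set T}) :
  reflect ((exists c : pred T, {in S &, forall u v, e u v = c u (+) c v}) /\
           exists u v, [/\ u \in S, v \in S & e u v])
          (induces_cbip e S).
Proof.
apply: (iffP existsP) => [[X /existsP[Y]]|[[c Hc] [x [y [xS yS xy]]]]].
  case/and5P=> /eqP <- /pred0P XY /set0Pn[x xX] /set0Pn[y yY] /and3P[HX HY HXY].
  have HXY' u v : u \in X -> v \in Y -> e u v.
    by move=> uX; move/forall_inP: HXY => /(_ u uX) /forall_inP; apply.
  have Hsame (Z : {set T}) u v : [forall x in Z, forall y in Z, ~~ e x y] ->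
      u \in Z -> v \in Z -> e u v = false.
    by move=> /forall_inP HZ uZ vZ; apply/negbTE; move/forall_inP: (HZ u uZ); apply.
  split; last by exists x, y; rewrite !inE xX yY orbT HXY'.
  have notX u : u \in Y -> u \in X = false.
    by move=> uY; move: (XY u); rewrite /= uY andbT.
  exists (mem X) => u v; rewrite !inE.
  case/orP=> Hu /orP[] Hv; rewrite ?Hu ?Hv ?notX //=.
  - exact: Hsame HX Hu Hv.
  - exact: HXY'.
  - by rewrite e_sym HXY'.
  - exact: Hsame HY Hu Hv.
have cxy : c x != c y by move: xy; rewrite Hc //; case: (c x); case: (c y).
exists [set u in S | c u == c x]; apply/existsP; exists [set u in S | c u == c y].
apply/and5P; split.
- apply/eqP/setP => u; rewrite !inE; case: (u \in S) => //=.
  by move: cxy; case: (c u); case: (c x); case: (c y).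
- apply/pred0P => u; rewrite /= !inE; apply/negbTE/negP.
  by case/andP=> /andP[_ /eqP ->] /andP[_ /eqP E]; move: cxy; rewrite E eqxx.
- by apply/set0Pn; exists x; rewrite !inE xS eqxx.
- by apply/set0Pn; exists y; rewrite !inE yS eqxx.
by apply/and3P; split; apply/forall_inP => u; rewrite inE => /andP[uS /eqP Eu];
  apply/forall_inP => v; rewrite inE => /andP[vS /eqP Ev]; rewrite Hc // Eu Ev ?addbb;
  move: cxy; case: (c x); case: (c y).
Qed.

Lemma sub_biclique S : induces_cbip e S -> exists2 B, B \in bicliques e & S \subset B.
Proof.
case/(@maxset_exists _ (induces_cbip e)) => B /maxsetP[HB maxB] SB.
exists B => //; rewrite inE /is_biclique HB; apply/forallP => S'; apply/implyP.
by rewrite properE => /andP[BS' nS]; apply: contra nS => HS'; rewrite (maxB S').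
Qed.

(** Choosing a biclique around each member is injective: two members inside one biclique would be
    coloured together by its colouring and would not conflict. *)
Lemma family_bicliques F : family e F -> size F <= #|bicliques e|.
Proof.
case/andP=> /allP HF Hp.
(* The default [set0] is never reached on [F], since each member spans a complete bipartite graph
   with an edge and hence lies in a biclique. *)
pose g (s : seq T) := odflt set0 [pick B in bicliques e | [set x in s] \subset B].
have gP s : s \in F -> (g s \in bicliques e) && ([set x in s] \subset g s).
  move=> sF; rewrite /g; case: pickP => [//|none] /=.
  have /andP[/bipP[c Hc] /hasP[u us /hasP[v vs uv]]] := HF s sF.
  have [|B HB sB] := @sub_biclique [set x in s]; last by have := none B; rewrite HB sB.
  apply/induces_cbipP; split; last by exists u, v; rewrite !inE.
  by exists c => x y; rewrite !inE; apply: Hc.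
have uniq_gF : uniq [seq g s | s <- F].
  rewrite uniq_pairwise pairwise_map.
  apply: (sub_in_pairwise (P := mem F)) Hp; last exact/allP.
  move=> s t /gP/andP[gs sgs] /gP/andP[_ tgt]; apply: contra => /eqP Egs.
  move: gs; rewrite inE => /andP[/induces_cbipP[[c Hc] _] _].
  apply/bipP; exists c => u v; rewrite !mem_cat => Hu Hv.
  have sub w : (w \in s) || (w \in t) -> w \in g s.
    by case/orP=> Hw; [apply: (subsetP sgs) | rewrite Egs; apply: (subsetP tgt)]; rewrite inE.
  by apply: Hc; apply: sub.
rewrite -(size_map g) -(card_uniqP uniq_gF).
by apply/subset_leq_card/subsetP => B /mapP[s sF ->]; case/andP: (gP s sF).
Qed.

(** The factor two arises as follows. Two distinct vertices with the same biclique are adjacent: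
    otherwise each lies in the set [C] of the other, their neighbourhoods coincide, and they are
    false twins. Three vertices sharing a biclique would thus form a triangle. *)
Lemma triangle_free_bicliques :
    (forall x y z, e x y -> e x z -> ~~ e y z) -> false_twin_free e ->
    (forall x, exists y, e x y) ->
  #|T| <= #|bicliques e|.*2.
Proof.
move=> tfree ftf nbr.
pose C v := [set w | [forall z, e v z ==> e w z]].
have CP v w : reflect (forall z, e v z -> e w z) (w \in C v).
  by rewrite inE; apply: (iffP forallP) => H z; [apply/implyP/H | apply/implyP/H].
pose B v := C v :|: nbhd e v.
have BC v : {in B v &, forall u w, e u w = e v u (+) e v w}.
  have [z vz] := nbr v.
  (* Both vertices are adjacent to the neighbour [z] of [v], so an edge between them would close a
     triangle. *)
  have CC u w : u \in C v -> w \in C v -> e u w = false.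
    move=> /CP/(_ z vz) uz /CP/(_ z vz) wz; apply/negbTE.
    by apply: (tfree z); rewrite e_sym.
  have vC u : u \in C v -> e v u = false by apply: CC; apply/CP.
  have Nv u : (u \in nbhd e v) = e v u by rewrite inE.
  move=> u w; rewrite !in_setU !Nv => /orP[uC|vu] /orP[wC|vw].
  - by rewrite !vC // CC.
  - by rewrite vC // vw; move/CP: uC; apply.
  - by rewrite vu vC // e_sym; move/CP: wC; apply.
  - by rewrite vu vw (negbTE (tfree v _ _ vu vw)).
have vB v : v \in B v by rewrite in_setU; apply/orP; left; apply/CP.
have Bbic v : B v \in bicliques e.
  have [z vz] := nbr v; have NB u : e v u -> u \in B v by rewrite !inE orbC => ->.
  have Bind : induces_cbip e (B v).
    by apply/induces_cbipP; split; [exists (e v); apply: BC | exists v, z; rewrite vB NB].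
  rewrite inE /is_biclique Bind; apply/forallP => S'; apply/implyP.
  case/properP=> BS' [x xS' /negP xB].
  apply/negP => /induces_cbipP[[c Hc] _]; apply: xB.
  have vS' : v \in S' by apply: (subsetP BS').
  have [vx|nvx] := boolP (e v x); first exact: NB.
  (* A vertex [x] of the larger set that is not adjacent to [v] has the colour of [v], hence is
     adjacent to every neighbour of [v]. *)
  rewrite in_setU; apply/orP; left; apply/CP => y vy.
  have yS' : y \in S' by apply: (subsetP BS'); apply: NB.
  by move: nvx vy; rewrite !Hc //; case: (c v); case: (c x); case: (c y).
have sameB v w : B v = B w -> v != w -> e v w.
  move=> Evw; apply: contraR => nvw; apply: contraT => neq.
  have wC : w \in C v by move: (vB w); rewrite -Evw in_setU [_ \in nbhd _ _]inE (negbTE nvw) orbF.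
  have vC : v \in C w.
    by move: (vB v); rewrite Evw in_setU [_ \in nbhd _ _]inE e_sym (negbTE nvw) orbF.
  have := ftf v w; rewrite /false_twins neq /= => /eqP[]; apply/setP => z; rewrite !inE.
  by apply/idP/idP; [apply/CP: z | apply/CP: z].
(* Vertices are counted by their biclique [B v]; each fibre is shown to have at most two
   elements. *)
rewrite -[#|T|]sum1_card (partition_big B (mem (bicliques e))) //= -muln2 -sum_nat_const.
apply: leq_sum => S _; rewrite sum1_card leqNgt; apply/negP => /card_gt2P[x [y [z []]]].
case=> Hx Hy Hz [xy yz zx].
have [Bx By Bz] : [/\ B x = S, B y = S & B z = S] by split; apply/eqP.
have exy : e x y by apply: sameB => //; rewrite Bx By.
have exz : e x z by apply: sameB; rewrite 1?eq_sym // Bx Bz.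
by move: (tfree x y z exy exz); rewrite sameB // By Bz.
Qed.

End Bicliques.

(** * Finite patterns and the boolean check of a table *)

(** Both this test and [alike] fail when a label is [None]: a member to which one of the two
    vertices cannot be added says nothing about the pair. *)
Definition opposite (p : option bool * option bool) : bool :=
  if p is (Some b, Some c) then b (+) c else false.

Definition alike (p : option bool * option bool) : bool :=
  if p is (Some b, Some c) then b == c else false.

(* A graph on [0, ..., n-1]: the i-th row is the adjacency of i to 0, ..., i-1. *)
Definition pattern := seq bitseq.

Definition adj (H : pattern) (i j : nat) : bool :=
  nth false (nth [::] H j) i || nth false (nth [::] H i) j.

Definition triangular (H : pattern) : bool :=
  all (fun i => size (nth [::] H i) == i) (iota 0 (size H)).

Section Growth.
(* [L] gives the labels of the vertices of [H] for a conflicting family. *)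
Variables (H : pattern) (L : seq (seq (option bool))).

Definition clash (u v : nat) : bool :=
  has (if adj H u v then alike else opposite) (zip (nth [::] L u) (nth [::] L v)).

(* For [y = z] the path degenerates to the edge [v y]. *)
Definition new_path (v y z : nat) : bool :=
  [&& adj H v y, adj H v z, ~~ adj H y z &
      ~~ has (fun p => opposite (p.1, p.2.1) && opposite (p.1, p.2.2))
             (zip (nth [::] L v) (zip (nth [::] L y) (nth [::] L z)))].

(** Every growth tested goes through [x], which in the uses below is a vertex added to the core
    graph, and through some [y] in [Y]. The three disjuncts put [x], [y] or [u] at the centre of the
    path. *)
Definition grows (x : nat) (Y : seq nat) : bool :=
  has (clash x) Y ||
  has (fun y => has (fun u =>
         [|| new_path x y u, new_path y x u | new_path u x y])
       (iota 0 (size H))) Y.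

End Growth.

Fixpoint bitseqs (n : nat) : seq bitseq :=
  if n is n'.+1 then
    let s := bitseqs n' in [seq true :: t | t <- s] ++ [seq false :: t | t <- s]
  else [:: [::]].

(* Only pairs [i < j] are tested, as adjacency is symmetric and irreflexive. *)
Definition embeds (D H : pattern) (f : seq nat) : bool :=
  [&& all (fun j => all (fun i => adj D i j == adj H (nth 0 f i) (nth 0 f j))
                        (iota 0 j)) (iota 0 (size D)),
      size f == size D & all (fun i => i < size H) f].

(* A graph, a conflicting family in it, and certificates [(i, f)]: [f] embeds the
   i-th later entry of the table into an extension of the graph. *)
Definition entry := (pattern * seq (seq nat) * seq (nat * seq nat))%type.

(** In contrast to [pairwise], each element is also paired with itself, because two vertices may a
    priori have the same type. *)
Fixpoint all_pairs (T : Type) (P : rel T) (s : seq T) : bool :=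
  if s is x :: s' then all (P x) s && all_pairs P s' else true.

(** A greedy heuristic. Its output is not trusted: [types_ok] tests afterwards that the groups cover
    the live types and are pairwise incoherent. *)
Definition insert_group (P : rel (bitseq * seq (option bool))) x :=
  fix ins gs := if gs is g :: gs' then
    if all (P x) g then (x :: g) :: gs' else g :: ins gs' else [:: [:: x]].

(** The bit [b] is the adjacency between the two added vertices, hence the last entry of the second
    row. *)
Definition extend2 (H : pattern) (r q : bitseq) (b : bool) : pattern :=
  rcons (rcons H r) (rcons q b).

Section Check.
Variables (H : pattern) (F : seq (seq nat)) (embedded : pattern -> bool).
Variable labs : seq (seq (option bool)).

(* An extension of a family of six sets has seven, which is enough. *)
Definition settled (H' : pattern) : bool := (6 <= size F) || embedded H'.

Definition grows1 (r : bitseq * seq (option bool)) : bool :=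
  grows (rcons H r.1) (rcons labs r.2) (size H) (iota 0 (size H).+1).

Definition grows2 (r q : bitseq * seq (option bool)) (b : bool) : bool :=
  grows (extend2 H r.1 q.1 b) (rcons (rcons labs r.2) q.2)
        (size H) [:: (size H).+1].

(** Whether or not the two vertices are adjacent, the family grows to an outcome already dealt with,
    so a counterexample cannot realize both types. *)
Definition incoherent (r q : bitseq * seq (option bool)) : bool :=
  all (fun b => grows2 r q b && settled (extend2 H r.1 q.1 b)) [:: false; true].

(* [types] pairs each adjacency to the vertices of [H] with its labels.  A group of
   pairwise incoherent types is realized by at most one vertex. *)
Definition types_ok (types : seq (bitseq * seq (option bool))) : bool :=
  let allowed := [seq r <- types | ~~ grows1 r] in
  let live := [seq r <- allowed | has isSome r.2] in
  let groups := if size live <= 12 then [seq [:: r] | r <- live]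
                else foldr (insert_group incoherent) [::] live in
  [&& (6 <= size F) || all (fun r => grows1 r ==> settled (rcons H r.1)) types,
      (6 <= size F) || all_pairs (fun r q =>
        all (fun b => grows2 r q b ==> settled (extend2 H r.1 q.1 b))
            [:: false; true]) allowed,
      size groups <= 12,
      all (fun r => has (fun g => r \in g) groups) live &
      all (pairwise incoherent) groups].

End Check.

Definition labels (H : pattern) (F : seq (seq nat)) (r : pred nat) :=
  [seq label (adj H) r s | s <- F].

Definition entry_ok (H : pattern) (F : seq (seq nat)) (embedded : pattern -> bool) :=
  [&& triangular H,
      all (fun s => all (fun i => i < size H) s) F,
      family (adj H) F &
      (7 <= size F) ||
      types_ok H F embedded [seq labels H F (adj H i) | i <- iota 0 (size H)]
        [seq (r, labels H F (nth false r)) | r <- bitseqs (size H)]].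

(** Certificates index into [rest] only, which is what allows an induction over the table. They are
    not attached to particular extensions: any one that embeds is accepted. *)
Fixpoint table_ok (tab : seq entry) : bool :=
  if tab is (H, F, certs) :: rest then
    entry_ok H F (fun H' => has (fun c =>
      if onth rest c.1 is Some D then embeds D.1.1 H' c.2 else false) certs)
    && table_ok rest
  else true.

(* In the raw table the i-th row lists the neighbours of i among 0, ..., i-1. *)
Definition decode (D : seq (seq nat) * seq (seq nat) * seq (nat * seq nat)) : entry :=
  (mkseq (fun i => mkseq (mem (nth [::] D.1.1 i)) i) (size D.1.1), D.1.2, D.2).

(** * Elementary properties of patterns, labels and families *)

Lemma adj_sym H : symmetric (adj H).
Proof. by move=> i j; rewrite /adj orbC. Qed.

Lemma triangular_size H i : triangular H -> size (nth [::] H i) <= i.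
Proof.
move=> /allP HH; have [lt|ge] := ltnP i (size H); last by rewrite nth_default.
by rewrite (eqP (HH i _)) // mem_iota.
Qed.

(** Row [i] has length [i], so its entry at position [i] is the default [false]. *)
Lemma adj_irr H : triangular H -> irreflexive (adj H).
Proof.
by move=> HH i; rewrite /adj orbb nth_default // triangular_size.
Qed.

Lemma triangular_rcons H r : size r = size H -> triangular H -> triangular (rcons H r).
Proof.
move=> sr /allP HH; apply/allP => i; rewrite mem_iota size_rcons ltnS nth_rcons /=.
case: (ltngtP i (size H)) => // [lt _|-> _]; last by rewrite sr.
by apply: HH; rewrite mem_iota.
Qed.

Lemma mem_bitseqs r : r \in bitseqs (size r).
Proof.
elim: r => [|b r IH] //=; rewrite mem_cat; apply/orP.
by case: b; [left | right]; apply: map_f.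
Qed.

Lemma all_pairsP (U : eqType) (P : rel U) s x y :
  all_pairs P s -> x \in s -> y \in s -> P x y || P y x.
Proof.
elim: s => [//|z s IH] /= /andP[/andP[Pzz /allP Pz] Hs].
rewrite !inE => /predU1P[->|xs] /predU1P[->|ys]; first by rewrite Pzz.
- by rewrite Pz.
- by rewrite Pz ?orbT.
- exact: IH.
Qed.

Lemma pairwise_mem (U : eqType) (P : rel U) s x y :
  pairwise P s -> x \in s -> y \in s -> [|| x == y, P x y | P y x].
Proof.
elim: s => [//|z s IH] /= /andP[/allP Pz Hs].
rewrite !inE => /predU1P[->|xs] /predU1P[->|ys]; first by rewrite eqxx.
- by rewrite Pz ?orbT.
- by rewrite Pz ?orbT.
- exact: IH.
Qed.

Lemma label_ext (V : eqType) (a a' : rel V) (r r' : pred V) s :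
    {in s &, a =2 a'} -> {in s, r =1 r'} -> label a r s = label a' r' s.
Proof.
case: s => [//|x s] Ha Hr; rewrite /label Hr ?mem_head //; congr (if _ then _ else _).
by apply: eq_in_all => u us; rewrite Hr // Ha ?mem_head.
Qed.

Lemma bip_map (V W : eqType) (a : rel V) (b : rel W) (f : V -> W) s :
    {in s &, forall u v, a u v = b (f u) (f v)} -> bip b (map f s) = bip a s.
Proof.
case: s => [//|x s] Hf.
suff /(_ (x :: s)) : forall t, {subset t <= x :: s} ->
    all (fun u => all (fun v => b u v == b u (f x) (+) b v (f x)) (map f t)) (map f t)
    = all (fun u => all (fun v => a u v == a u x (+) a v x) t) t by apply.
move=> t ts; rewrite all_map; apply: eq_in_all => u /ts us.
rewrite [LHS]/= all_map; apply: eq_in_all => v /ts vs.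
by rewrite /= !Hf ?mem_head.
Qed.

(** Complete bipartiteness and conflict are expressed by adjacency alone, so a family is transported
    even by a map that identifies vertices. *)
Lemma family_map (V W : eqType) (a : rel V) (b : rel W) (f : V -> W) (P : pred V) F :
    {in P &, forall u v, a u v = b (f u) (f v)} -> all (all P) F ->
  family a F -> family b (map (map f) F).
Proof.
move=> Hf /allP HP /andP[/allP Ha Hp].
have {}HP t : t \in F -> {subset t <= P} by move/HP/allP.
apply/andP; split; last first.
  rewrite pairwise_map; apply: (sub_in_pairwise (P := mem F)) Hp; last exact/allP.
  move=> s t sF tF; apply: contra => /=; rewrite -map_cat (bip_map (a := a)) //.
  by move=> u v; rewrite !mem_cat => /orP[/HP uP|/HP uP] /orP[/HP vP|/HP vP]; apply: Hf; auto.
apply/allP => _ /mapP[s sF ->]; have /andP[bs /hasP[u us /hasP[v vs uv]]] := Ha s sF.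
have sP := HP s sF; rewrite (bip_map (a := a)) ?bs; last first.
  by move=> w t /sP wP /sP tP; apply: Hf.
apply/hasP; exists (f u); first exact: map_f.
by apply/hasP; exists (f v); rewrite ?map_f // -Hf ?sP.
Qed.

(** * Realizations of patterns in a graph *)

Section Realization.
Variables (T : finType) (e : rel T) (x0 : T).
Hypotheses (e_sym : symmetric e) (e_irr : irreflexive e).

(** The list may repeat vertices. Hence any vertex may be appended, even one already listed, and any
    pair, even twice the same vertex; no case distinction is made when types of arbitrary vertices
    are considered. *)
Definition realizes (s : seq T) (H : pattern) : Prop :=
  [/\ triangular H, size s = size H &
      forall i j, i < size H -> j < size H ->
        adj H i j = e (nth x0 s i) (nth x0 s j)].

Lemma adj_rcons H r i j :
  i < size H -> j < size H -> adj (rcons H r) i j = adj H i j.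
Proof. by move=> iH jH; rewrite /adj !nth_rcons iH jH. Qed.

Lemma adj_rcons_last H r i :
  triangular H -> i < size H -> adj (rcons H r) (size H) i = nth false r i.
Proof.
move=> HH iH; rewrite /adj !nth_rcons iH ltnn eqxx nth_default //.
exact: leq_trans (triangular_size _ HH) (ltnW iH).
Qed.

Lemma realizes_rcons s H v :
  realizes s H -> realizes (rcons s v) (rcons H [seq e v u | u <- s]).
Proof.
move=> [HH sH Hs]; split; first by apply: triangular_rcons; rewrite ?size_map.
  by rewrite !size_rcons sH.
have last i : i < size H -> adj (rcons H [seq e v u | u <- s]) (size H) i = e v (nth x0 s i).
  by move=> iH; rewrite adj_rcons_last // (nth_map x0) ?sH.
have HH' : triangular (rcons H [seq e v u | u <- s]).
  by apply: triangular_rcons; rewrite ?size_map.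
move=> i j; rewrite size_rcons !ltnS !nth_rcons sH (leq_eqVlt i) (leq_eqVlt j).
case: (ltngtP i (size H)) => //= [iH|->] _; case: (ltngtP j (size H)) => //= [jH|->] _.
- by rewrite adj_rcons ?Hs.
- by rewrite adj_sym last.
- exact: last.
- by rewrite adj_irr ?e_irr.
Qed.

Lemma realizes_family s H F :
    realizes s H -> all (all (fun i => i < size H)) F -> family (adj H) F ->
  size F <= #|bicliques e|.
Proof.
move=> [HH sH Hs] HF fam; rewrite -(size_map (map (nth x0 s))).
apply: family_bicliques => //; apply: family_map HF fam => i j; exact: Hs.
Qed.

(** The gain is one member in either case: a path is added to the family, whereas a clash replaces
    one member by two. *)
Lemma grows_bicliques s H F L x Y :
    realizes s H -> all (all (fun i => i < size H)) F -> family (adj H) F ->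
    (forall i, i < size H -> nth [::] L i = [seq label (adj H) (adj H i) t | t <- F]) ->
    x < size H -> all (fun i => i < size H) Y -> grows H L x Y ->
  size F < #|bicliques e|.
Proof.
move=> Rs HF fam HL xH /allP YH.
have asym := @adj_sym H; have [HH _ _] := Rs; have airr := adj_irr HH.
have path v y z : v < size H -> y < size H -> z < size H -> new_path H L v y z ->
    size F < #|bicliques e|.
  move=> vH yH zH /and4P[vy vz yz nhas].
  apply: (realizes_family (F := [:: v; y; z] :: F)) Rs _ _; first by rewrite /= vH yH zH.
  apply: family_path => // t p q r tF Lv Ly Lz; apply: contra nhas => opp.
  rewrite !HL // !zip_map has_map; apply/hasP; exists t => //=.
  by rewrite Lv Ly Lz.
rewrite /grows => /orP[] /hasP[y yY]; last first.
  case/hasP=> u; rewrite mem_iota => uH.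
  by case/or3P; apply: path => //; apply: YH.
rewrite /clash (HL x xH) (HL y (YH y yY)) zip_map has_map => /hasP[t tF /= Hc].
have [p [q [Lx Ly pq]]] : exists p q, [/\ label (adj H) (adj H x) t = Some p,
    label (adj H) (adj H y) t = Some q & p (+) q != adj H x y].
  move: Hc; case: (adj H x y); case: label => [p|] //; case: label => [q|] //= pq;
  by exists p, q; split=> //; move: pq; case: p; case: q.
have [F1 [F2 [EF fam']]] := family_clash asym airr fam tF Lx Ly pq.
apply: leq_trans (realizes_family Rs _ fam').
  by rewrite EF !size_cat /= !addnS.
move: HF; rewrite EF !all_cat /= => /and3P[-> HFt ->].
by rewrite HFt xH YH.
Qed.

End Realization.

(** * Soundness of the check of an entry and of the table *)

Lemma has_opposite l l' :
  has (fun p => opposite (p.1, p.2.1) && opposite (p.1, p.2.2)) (zip l (zip l' l'))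
  = has opposite (zip l l').
Proof. by elim: l l' => [|p l IH] [|q l'] //=; rewrite IH andbb. Qed.

Lemma has_opposite_sym l l' : has opposite (zip l l') = has opposite (zip l' l).
Proof.
elim: l l' => [|p l IH] [|q l'] //=; rewrite IH; congr (_ || _).
by case: p q => [[]|] [[]|].
Qed.

Section Soundness.
Variables (T : finType) (e : rel T) (x0 : T).
Hypotheses (e_sym : symmetric e) (e_irr : irreflexive e).
Hypotheses (ftf : false_twin_free e) (nbr : forall v, exists w, e v w).

Let goal := (#|T| <= 12) || (7 <= #|bicliques e|).

Section Entry.
Variables (H : pattern) (F : seq (seq nat)) (embedded : pattern -> bool) (s : seq T).
Hypotheses (Rs : realizes e x0 s H) (HF : all (all (fun i => i < size H)) F).
Hypothesis fam : family (adj H) F.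
Hypothesis embP : forall H' s', embedded H' -> realizes e x0 s' H' -> goal.

Let m := size H.
Let labs := [seq labels H F (adj H i) | i <- iota 0 m].
Let row v : bitseq := [seq e v u | u <- s].
Let type v := (row v, labels H F (nth false (row v))).

Lemma nth_labs i : i < m -> nth [::] labs i = labels H F (adj H i).
Proof. by move=> im; rewrite (nth_map 0) ?size_iota // nth_iota. Qed.

Lemma size_row v : size (row v) = m.
Proof. by rewrite size_map; case: Rs. Qed.

(* Labels only depend on the adjacencies inside the core pattern [H]. *)
Lemma labels_ext H' r r' :
    {in gtn m &, adj H =2 adj H'} -> {in gtn m, r =1 r'} ->
  labels H F r = [seq label (adj H') r' t | t <- F].
Proof.
move=> HH Hr; apply/eq_in_map => t tF; have tm : {subset t <= gtn m}.
  by move/allP: HF => /(_ t tF) /allP.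
by apply: label_ext => [i j /tm im /tm jm|i /tm im]; [apply: HH | apply: Hr].
Qed.

Lemma family_extend H' : {in gtn m &, adj H =2 adj H'} -> family (adj H') F.
Proof.
(* [F] is written as its own image under the identity on vertices, so that a change of pattern
   outside the core becomes an instance of [family_map]. *)
move=> HH; rewrite -[F]map_id -(eq_map (@map_id _)).
by apply: family_map HF fam.
Qed.

Lemma grows1_sound v :
  grows1 H labs (type v) -> 6 <= size F -> 6 < #|bicliques e|.
Proof.
move=> G F6; apply: leq_ltn_trans F6 _.
have [HH sH _] := Rs; have RH := realizes_rcons e_sym e_irr v Rs.
set H' := rcons H (row v) in RH.
have EH : {in gtn m &, adj H =2 adj H'} by move=> i j im jm; rewrite adj_rcons.
have sH' : size H' = m.+1 by rewrite size_rcons.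
apply: (grows_bicliques e_sym RH _ (family_extend EH) _ _ _ G); rewrite ?sH' //.
- by apply: sub_all HF => t; apply: sub_all => i; apply: ltnW.
- move=> i; rewrite ltnS leq_eqVlt nth_rcons size_map size_iota.
  case: ltngtP => //= [im _|-> _]; last first.
    by apply: labels_ext => // j jm; rewrite adj_rcons_last.
  by rewrite nth_labs //; apply: labels_ext => // j jm; apply: EH.
- by apply/allP => i; rewrite mem_iota.
Qed.

Lemma extend2_row v w :
  extend2 H (row v) (row w) (e w v) = rcons (rcons H (row v)) [seq e w u | u <- rcons s v].
Proof. by rewrite /extend2 map_rcons. Qed.

Lemma realizes_extend2 v w :
  realizes e x0 (rcons (rcons s v) w) (extend2 H (row v) (row w) (e w v)).
Proof. by rewrite extend2_row; apply: realizes_rcons => //; apply: realizes_rcons. Qed.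

Lemma extend2_labels v w i : i < m.+2 ->
  nth [::] (rcons (rcons labs (type v).2) (type w).2) i =
    [seq label (adj (extend2 H (row v) (row w) (e w v)))
               (adj (extend2 H (row v) (row w) (e w v)) i) t | t <- F].
Proof.
have [HH sH _] := Rs; have [HH' _ _] := realizes_rcons e_sym e_irr v Rs.
set H' := extend2 _ _ _ _; have sH' : size (rcons H (row v)) = m.+1 by rewrite size_rcons.
have EH : {in gtn m &, adj H =2 adj H'}.
  move=> i' j im jm; rewrite /H' extend2_row adj_rcons ?sH' ?ltnS 1?ltnW //.
  by rewrite adj_rcons.
rewrite !nth_rcons size_rcons size_map size_iota !ltnS leq_eqVlt => /predU1P[->|].
  rewrite ltnn eqxx; apply: labels_ext => // j jm.
  rewrite /H' extend2_row -sH' adj_rcons_last ?sH' ?ltnS 1?ltnW //.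
  by rewrite map_rcons nth_rcons size_row ifT.
rewrite ltnS leq_eqVlt => /predU1P[->|im].
  rewrite eqxx ltnn; apply: labels_ext => // j jm.
  by rewrite /H' extend2_row adj_rcons ?sH' ?ltnS ?(ltnW jm) // adj_rcons_last.
rewrite im orbT nth_labs //; apply: labels_ext => // j jm.
exact: EH.
Qed.

Lemma extend2_family v w : family (adj (extend2 H (row v) (row w) (e w v))) F.
Proof.
have [HH sH _] := Rs; have [HH' _ _] := realizes_rcons e_sym e_irr v Rs.
apply: family_extend => i j im jm; rewrite extend2_row.
by rewrite !adj_rcons // size_rcons ltnS ltnW.
Qed.

Lemma grows2_sound v w :
  grows2 H labs (type v) (type w) (e w v) -> 6 <= size F -> 6 < #|bicliques e|.
Proof.
move=> G F6; apply: leq_ltn_trans F6 _.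
have s2 r q b : size (extend2 H r q b) = m.+2 by rewrite !size_rcons.
apply: (grows_bicliques e_sym (realizes_extend2 v w) _ (extend2_family v w) _ _ _ G).
- by rewrite s2; apply: sub_all HF => t; apply: sub_all => i im; apply: leqW; apply: leqW.
- by rewrite s2 => i im; rewrite extend2_labels.
- by rewrite s2 ltnS.
- by rewrite /= s2 ltnSn.
Qed.

Lemma settled1 v :
  grows1 H labs (type v) -> settled F embedded (rcons H (row v)) -> goal.
Proof.
move=> G /orP[/(grows1_sound G) k7|emb]; first by rewrite /goal k7 orbT.
exact: embP emb (realizes_rcons e_sym e_irr v Rs).
Qed.

Lemma settled2 v w :
    grows2 H labs (type v) (type w) (e w v) ->
    settled F embedded (extend2 H (row v) (row w) (e w v)) ->
  goal.
Proof.
move=> G /orP[/(grows2_sound G) k7|emb]; first by rewrite /goal k7 orbT.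
exact: embP emb (realizes_extend2 v w).
Qed.

(** Without a clash, nonadjacent vertices are never opposite in a member; without a new edge,
    adjacent vertices are opposite in at least one. *)
Lemma adj_of_labels v w :
    ~~ grows2 H labs (type v) (type w) (e w v) ->
  e v w = has opposite (zip (type v).2 (type w).2).
Proof.
have [HH sH _] := Rs; have [HH' sH' Hs'] := realizes_extend2 v w.
have s2 r q b : size (extend2 H r q b) = m.+2 by rewrite !size_rcons.
have Evw : adj (extend2 H (row v) (row w) (e w v)) m m.+1 = e v w.
  rewrite Hs' ?s2 ?ltnS //; first by rewrite !nth_rcons size_rcons sH ltnSn !ltnn !eqxx.
rewrite /grows2 /grows /= !orbF negb_or => /andP[ncl /hasPn npath].
have L1 : nth [::] (rcons (rcons labs (type v).2) (type w).2) m = (type v).2.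
  by rewrite !nth_rcons !size_rcons size_map size_iota ltnSn ltnn eqxx.
have L2 : nth [::] (rcons (rcons labs (type v).2) (type w).2) m.+1 = (type w).2.
  by rewrite !nth_rcons !size_rcons size_map size_iota ltnn eqxx.
case: (boolP (e v w)) => evw; last first.
  by move: ncl; rewrite /clash Evw (negbTE evw) L1 L2 => /negbTE.
(* Taking the third vertex equal to the second new one, [m.+1], reduces the path to the edge between
   the two new vertices. *)
have := npath m.+1; rewrite mem_iota s2 ltnSn => /(_ isT).
rewrite /new_path Evw evw /= adj_irr //= !negb_or negbK => /andP[+ _].
by rewrite L1 L2 has_opposite => ->.
Qed.

(** In a counterexample no settled growth can occur, so every realized type is allowed and no two
    realized types are incoherent. Sending a vertex to a group containing its type is then
    injective, which bounds the vertices by the number of groups. *)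
Lemma types_sound :
  types_ok H F embedded labs [seq (r, labels H F (nth false r)) | r <- bitseqs m] -> goal.
Proof.
rewrite /types_ok; set types := map _ _.
set allowed := filter _ types; set live := filter _ allowed; set groups := if _ then _ else _.
case/and5P=> single pairs sgroups /allP live_groups /allP groups_inc.
apply: contraT => ngoal.
have type_in v : type v \in types by apply: map_f; rewrite -(size_row v) mem_bitseqs.
have stuck1 v : ~~ grows1 H labs (type v).
  apply: contra ngoal => G; case/orP: single => [F6|/allP/(_ _ (type_in v))].
    by apply: settled1 G _; rewrite /settled F6.
  by move=> /implyP/(_ G) /(settled1 G).
have allowed_in v : type v \in allowed by rewrite mem_filter stuck1 type_in.
have stuck2 v w : settled F embedded (extend2 H (row v) (row w) (e w v)) ->
    ~~ grows2 H labs (type v) (type w) (e w v).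
  by move=> S; apply: contra ngoal => /settled2; apply.
have adjE v w : e v w = has opposite (zip (type v).2 (type w).2).
  (* With six members the test over pairs is skipped, but then every extension is settled. Otherwise
     that test covers each pair of types in one order only, and the other order follows from the
     symmetry of [e] and of [opposite]. *)
  have [F6|nF6] := boolP (6 <= size F).
    by apply: adj_of_labels; apply: stuck2; rewrite /settled F6.
  rewrite (negbTE nF6) /= in pairs.
  have pair_ok x y : all (fun b => grows2 H labs (type x) (type y) b
      ==> settled F embedded (extend2 H (type x).1 (type y).1 b)) [:: false; true] ->
    ~~ grows2 H labs (type x) (type y) (e y x).
    move/allP/(_ (e y x)); have -> : e y x \in [:: false; true] by case: (e y x).
    move=> /(_ isT) /implyP Hxy.
    by apply/negP => G; move/negP: (stuck2 _ _ (Hxy G)).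
  have /orP[/pair_ok|/pair_ok] := all_pairsP pairs (allowed_in v) (allowed_in w).
    exact: adj_of_labels.
  by move=> /adj_of_labels E; rewrite e_sym has_opposite_sym.
have type_inj v w : type v = type w -> v = w.
  move=> E; apply/eqP; apply: contraT => vw.
  have /negP[] := ftf v w; rewrite /false_twins vw; apply/eqP/setP => z.
  by rewrite !inE !adjE E.
(* Every vertex has a neighbour, and this adjacency shows as opposite labels in some member; so some
   label of the vertex is not [None]. *)
have live_in v : type v \in live.
  rewrite mem_filter allowed_in andbT; have [w] := nbr v; rewrite adjE.
  elim: (type v).2 (type w).2 => [|p l IH] [|q l'] //= /orP[|/IH ->]; last by rewrite orbT.
  by case: p.
pose f v := find (fun g => type v \in g) groups.
have f_lt v : f v < 12 by apply: leq_trans sgroups; rewrite -has_find live_groups.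
have f_mem v : type v \in nth [::] groups (f v).
  exact: (nth_find [::] (live_groups _ (live_in v))).
have f_inj v w : f v = f w -> v = w.
  move=> E; apply: type_inj; apply/eqP.
  have gin : nth [::] groups (f v) \in groups.
    by apply: mem_nth; rewrite -has_find live_groups.
  have vg := f_mem v; have wg := f_mem w; rewrite -E in wg.
  (* Both types occur in the graph, so the actual adjacency [e y x] is one of the two values tested,
     and its growth would be settled. *)
  have coherent x y : ~~ incoherent H F embedded labs (type x) (type y).
    apply/negP => /allP/(_ (e y x)); have -> : e y x \in [:: false; true] by case: (e y x).
    move=> /(_ isT) /andP[G S].
    by move/negP: (stuck2 _ _ S).
  have /or3P[//|inc|inc] := pairwise_mem (groups_inc _ gin) vg wg.
    by case/negP: (coherent v w).
  by case/negP: (coherent w v).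
have := leq_card (fun v => Ordinal (f_lt v)); rewrite card_ord => le12.
rewrite /goal le12 // in ngoal => v w [] /f_inj; exact.
Qed.

End Entry.

Lemma entry_sound H F embedded s :
    entry_ok H F embedded -> realizes e x0 s H ->
    (forall H' s', embedded H' -> realizes e x0 s' H' -> goal) ->
  goal.
Proof.
case/and4P=> _ HF fam /orP[F7|types] Rs emb.
  by rewrite /goal (leq_trans F7) ?orbT // (realizes_family e_sym Rs HF fam).
exact: types_sound Rs HF fam emb types.
Qed.

Lemma realizes_embeds D H f s :
    triangular D -> embeds D H f -> realizes e x0 s H ->
  realizes e x0 [seq nth x0 s i | i <- f] D.
Proof.
move=> HD /and3P[/allP Hf /eqP sf /allP fH] [HH sH Hs].
have fr i : i < size D -> nth 0 f i < size H by move=> iD; apply: fH; rewrite mem_nth ?sf.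
have adjE i j : i < j -> j < size D -> adj D i j = adj H (nth 0 f i) (nth 0 f j).
  move=> ij jD; have /Hf/allP Hj : j \in iota 0 (size D) by rewrite mem_iota.
  by apply/eqP; apply: Hj; rewrite mem_iota.
split=> //; first by rewrite size_map.
move=> i j iD jD; rewrite !(nth_map 0) ?sf // -Hs ?fr //.
case: (ltngtP i j) => [ij|ji|->]; first exact: adjE.
  by rewrite adj_sym adjE // adj_sym.
by rewrite !adj_irr.
Qed.

(** A certificate turns a growth into a realization, in the same graph, of an entry of the tail; the
    induction hypothesis for the tail finishes. *)
Lemma table_sound tab H F certs s :
  table_ok tab -> (H, F, certs) \in tab -> realizes e x0 s H -> goal.
Proof.
have triang D tab' : table_ok tab' -> D \in tab' -> triangular D.1.1.
  elim: tab' => [//|[[H' F'] certs'] rest IH] /= /andP[/and4P[HH' _ _ _] ok].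
  by rewrite inE => /predU1P[->//|]; apply: IH.
elim: tab H F certs s => [//|[[H0 F0] certs0] rest IH] H F certs s /= /andP[ok rest_ok].
rewrite inE => /predU1P[[-> _ _]|Hin]; last exact: IH rest_ok Hin.
move=> Rs; apply: entry_sound ok Rs _ => H' s' /hasP[[i f] _ /=].
case Ei: (onth rest i) => [[[D FD] cD]|] // emb RH'.
have Din : (D, FD, cD) \in rest by apply/onthP; exists i.
exact: IH rest_ok Din (realizes_embeds (triang _ _ rest_ok Din) emb RH').
Qed.

End Soundness.

(* Found by a computer search, starting from the triangle. *)
Definition table : seq entry := map decode [::
  ([:: [::]; [:: 0]; [:: 0; 1]],
   [:: [:: 0; 1]; [:: 0; 2]; [:: 1; 2]],
   [:: (19, [:: 0; 1; 3; 4]); (19, [:: 0; 2; 3; 4]); (19, [:: 1; 2; 3; 4]); (19, [:: 0; 1; 2; 3]);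
       (4, [:: 0; 1; 2; 3; 4]); (4, [:: 0; 1; 3; 2; 4]); (4, [:: 1; 0; 2; 3; 4]);
       (4, [:: 1; 0; 3; 2; 4]); (3, [:: 2; 0; 1; 3; 4]); (3, [:: 3; 0; 1; 2; 4]);
       (4, [:: 0; 2; 3; 1; 4]); (4, [:: 2; 0; 1; 3; 4]); (3, [:: 1; 0; 2; 3; 4]);
       (4, [:: 2; 0; 3; 1; 4]); (3, [:: 3; 0; 2; 1; 4]); (20, [:: 0; 1; 2; 3; 4]);
       (3, [:: 0; 1; 2; 4; 3]); (0, [:: 0; 1; 2; 3; 4]); (0, [:: 0; 2; 1; 3; 4]);
       (1, [:: 0; 3; 1; 2; 4]); (4, [:: 1; 2; 3; 0; 4]); (4, [:: 2; 1; 3; 0; 4]);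
       (3, [:: 3; 1; 2; 0; 4]); (20, [:: 1; 0; 2; 3; 4]); (0, [:: 1; 2; 0; 3; 4]);
       (1, [:: 1; 3; 0; 2; 4]); (20, [:: 2; 0; 1; 3; 4]); (1, [:: 2; 3; 0; 1; 4]);
       (2, [:: 0; 1; 2; 3; 4])]);
  ([:: [::]; [:: 0]; [:: 0; 1]; [:: 0]; [:: 1]],
   [:: [:: 0; 1; 3]; [:: 0; 2; 3]; [:: 0; 1; 4]; [:: 1; 2; 4]],
   [:: (18, [:: 0; 1; 2; 5]); (2, [:: 0; 5; 6; 4; 3]); (2, [:: 1; 5; 6; 3; 4]);
       (3, [:: 0; 1; 5; 2; 6]); (3, [:: 1; 0; 5; 2; 6]); (2, [:: 1; 0; 2; 5; 6]);
       (19, [:: 0; 1; 2; 5; 6]); (2, [:: 0; 1; 2; 6; 5]); (19, [:: 1; 0; 2; 5; 6]);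
       (3, [:: 0; 1; 5; 2; 3]); (3, [:: 0; 2; 5; 1; 3]); (19, [:: 0; 1; 2; 3; 5]);
       (3, [:: 1; 2; 5; 0; 4]); (19, [:: 1; 0; 2; 4; 5]); (18, [:: 0; 1; 5; 6]);
       (3, [:: 0; 1; 2; 5; 6]); (3, [:: 1; 0; 2; 5; 6]); (2, [:: 5; 0; 1; 2; 6]);
       (3, [:: 0; 2; 5; 1; 6]); (3, [:: 2; 0; 1; 5; 6]); (2, [:: 5; 0; 2; 1; 6]);
       (3, [:: 1; 2; 5; 0; 6]); (2, [:: 5; 1; 2; 0; 6]); (2, [:: 0; 1; 5; 4; 3]);
       (2, [:: 1; 0; 2; 5; 4]); (2, [:: 0; 1; 2; 5; 3]); (5, [:: 1; 0; 2; 5; 6; 4]);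
       (5, [:: 0; 1; 2; 5; 6; 3]); (8, [:: 5; 2; 0; 1; 3; 4]); (7, [:: 1; 0; 2; 3; 5; 4]);
       (7, [:: 0; 1; 2; 4; 5; 3]); (22, [:: 0; 1; 2; 3; 4; 5]); (97, [:: 0; 1; 2; 3; 5; 4]);
       (5, [:: 1; 0; 2; 3; 5; 4]); (5, [:: 0; 1; 2; 4; 5; 3]); (25, [:: 0; 1; 2; 3; 6; 5; 4]);
       (17, [:: 0; 1; 2; 5; 4; 3; 6]); (15, [:: 0; 5; 1; 4; 2; 6; 3]);
       (17, [:: 0; 1; 2; 3; 6; 5; 4]); (17, [:: 0; 1; 2; 5; 6; 3; 4]);
       (15, [:: 1; 5; 0; 3; 2; 6; 4]); (10, [:: 0; 1; 2; 3; 4; 5; 6])]);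
  ([:: [::]; [:: 0]; [:: 0]; [:: 0; 2]; [:: 1]],
   [:: [:: 0; 1; 2]; [:: 0; 1; 3]; [:: 0; 1; 4]; [:: 2; 3]],
   [:: (17, [:: 0; 2; 3; 5]); (18, [:: 0; 2; 3; 5; 6]); (1, [:: 1; 5; 6; 2; 4]);
       (2, [:: 0; 2; 5; 3; 6]); (1, [:: 5; 0; 2; 3; 6]); (2, [:: 0; 3; 5; 2; 6]);
       (1, [:: 5; 0; 3; 2; 6]); (1, [:: 0; 2; 3; 6; 5]); (1, [:: 1; 5; 6; 3; 4]);
       (1, [:: 5; 2; 3; 0; 6]); (1, [:: 0; 1; 5; 4; 3]); (1, [:: 5; 0; 3; 2; 4]);
       (1, [:: 5; 2; 3; 0; 4]); (17, [:: 0; 2; 5; 6]); (17, [:: 0; 3; 5; 6]);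
       (2, [:: 0; 2; 3; 5; 6]); (2, [:: 2; 0; 3; 5; 6]); (2, [:: 2; 0; 5; 3; 6]);
       (1, [:: 3; 0; 2; 5; 6]); (2, [:: 3; 0; 2; 5; 6]); (1, [:: 2; 0; 3; 5; 6]);
       (2, [:: 3; 0; 5; 2; 6]); (1, [:: 1; 0; 5; 2; 4]); (1, [:: 1; 0; 5; 3; 4]);
       (1, [:: 5; 0; 2; 3; 4]); (18, [:: 0; 1; 5; 2; 3]); (1, [:: 0; 2; 3; 5; 1]);
       (4, [:: 2; 0; 3; 5; 4; 6]); (4, [:: 3; 0; 2; 5; 4; 6]); (7, [:: 1; 0; 2; 3; 5; 6]);
       (6, [:: 1; 5; 6; 2; 3; 4]); (4, [:: 1; 5; 6; 2; 3; 4]); (4, [:: 1; 5; 6; 3; 2; 4]);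
       (19, [:: 0; 1; 2; 3; 5; 6]); (3, [:: 0; 1; 5; 2; 3; 6]); (5, [:: 0; 2; 3; 1; 5; 4]);
       (5, [:: 0; 3; 2; 1; 5; 4]); (19, [:: 0; 1; 2; 3; 4; 5]); (96, [:: 0; 2; 3; 1; 4; 5]);
       (4, [:: 2; 0; 3; 1; 4; 5]); (96, [:: 0; 3; 2; 1; 4; 5]); (4, [:: 3; 0; 2; 1; 4; 5]);
       (3, [:: 0; 1; 4; 2; 3; 5]); (13, [:: 0; 1; 4; 5; 2; 3; 6]); (13, [:: 0; 5; 4; 1; 2; 3; 6]);
       (14, [:: 0; 1; 2; 6; 3; 4; 5]); (14, [:: 0; 1; 3; 6; 2; 4; 5]);
       (13, [:: 0; 1; 6; 5; 2; 3; 4]); (15, [:: 0; 1; 5; 2; 3; 4; 6]);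
       (12, [:: 1; 5; 0; 2; 3; 4; 6]); (12, [:: 1; 5; 0; 3; 2; 4; 6]);
       (8, [:: 0; 1; 2; 3; 4; 5; 6])]);
  ([:: [::]; [:: 0]; [:: 0; 1]; [::]; [:: 3]],
   [:: [:: 0; 1]; [:: 0; 2]; [:: 1; 2]; [:: 3; 4]],
   [:: (16, [:: 0; 1; 2; 5]); (0, [:: 5; 0; 1; 2; 6]); (0, [:: 5; 0; 2; 1; 6]);
       (0, [:: 5; 1; 2; 0; 6]); (0, [:: 5; 0; 1; 2; 3]); (0, [:: 5; 0; 2; 1; 3]);
       (0, [:: 5; 1; 2; 0; 3]); (16, [:: 0; 1; 5; 6]); (16, [:: 0; 2; 5; 6]);
       (16, [:: 1; 2; 5; 6]); (1, [:: 0; 1; 2; 5; 6]); (1, [:: 0; 1; 5; 2; 6]);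
       (1, [:: 1; 0; 2; 5; 6]); (1, [:: 1; 0; 5; 2; 6]); (0, [:: 2; 0; 1; 5; 6]);
       (1, [:: 0; 2; 5; 1; 6]); (1, [:: 2; 0; 1; 5; 6]); (0, [:: 1; 0; 2; 5; 6]);
       (1, [:: 2; 0; 5; 1; 6]); (17, [:: 0; 1; 2; 5; 6]); (0, [:: 0; 1; 2; 6; 5]);
       (1, [:: 1; 2; 5; 0; 6]); (1, [:: 2; 1; 5; 0; 6]); (17, [:: 1; 0; 2; 5; 6]);
       (17, [:: 2; 0; 1; 5; 6]); (0, [:: 5; 0; 1; 2; 4]); (0, [:: 5; 0; 2; 1; 4]);
       (0, [:: 5; 1; 2; 0; 4]); (2, [:: 0; 5; 6; 1; 2; 3]); (2, [:: 0; 5; 6; 1; 2; 4]);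
       (2, [:: 1; 5; 6; 0; 2; 3]); (2, [:: 1; 5; 6; 0; 2; 4]); (2, [:: 2; 5; 6; 0; 1; 3]);
       (2, [:: 2; 5; 6; 0; 1; 4]); (19, [:: 0; 1; 2; 3; 5; 6]); (19, [:: 0; 1; 2; 4; 5; 6]);
       (18, [:: 0; 5; 1; 2; 3; 4]); (2, [:: 0; 5; 3; 1; 2; 4]); (2, [:: 0; 5; 4; 1; 2; 3]);
       (18, [:: 1; 5; 0; 2; 3; 4]); (2, [:: 1; 5; 3; 0; 2; 4]); (2, [:: 1; 5; 4; 0; 2; 3]);
       (18, [:: 2; 5; 0; 1; 3; 4]); (2, [:: 2; 5; 3; 0; 1; 4]); (2, [:: 2; 5; 4; 0; 1; 3]);
       (19, [:: 0; 1; 2; 3; 4; 5]); (8, [:: 0; 1; 2; 5; 6; 3; 4]); (8, [:: 0; 2; 1; 5; 6; 3; 4]);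
       (7, [:: 0; 5; 1; 2; 6; 3; 4]); (8, [:: 1; 2; 0; 5; 6; 3; 4]);
       (7, [:: 1; 5; 0; 2; 6; 3; 4]); (7, [:: 2; 5; 0; 1; 6; 3; 4]);
       (9, [:: 3; 4; 5; 6; 0; 1; 2]); (9, [:: 3; 5; 4; 6; 0; 1; 2]);
       (9, [:: 4; 5; 3; 6; 0; 1; 2]); (10, [:: 0; 1; 2; 3; 4; 5; 6])]);
  ([:: [::]; [:: 0]; [:: 0; 1]; [:: 1; 2]; [:: 0]],
   [:: [:: 0; 1; 4]; [:: 0; 2; 4]; [:: 1; 2]; [:: 0; 1; 3]; [:: 0; 2; 3]],
   [:: (15, [:: 0; 1; 2; 5]); (15, [:: 1; 2; 5; 6]); (16, [:: 0; 1; 2; 5; 6]);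
       (16, [:: 1; 0; 2; 5; 6]); (16, [:: 2; 0; 1; 5; 6]); (15, [:: 1; 2; 3; 5]);
       (16, [:: 0; 1; 2; 4; 5]); (15, [:: 0; 1; 5; 6]); (15, [:: 0; 2; 5; 6]);
       (20, [:: 0; 5; 1; 3; 6; 4]); (100, [:: 1; 6; 2; 3; 5; 4]); (20, [:: 0; 1; 2; 6; 5; 4]);
       (100, [:: 1; 6; 5; 3; 2; 4]); (20, [:: 0; 1; 5; 6; 2; 4]); (21, [:: 0; 1; 5; 3; 4; 6]);
       (20, [:: 0; 5; 2; 3; 6; 4]); (100, [:: 2; 6; 1; 3; 5; 4]); (20, [:: 0; 2; 1; 6; 5; 4]);
       (21, [:: 0; 2; 5; 3; 4; 6]); (100, [:: 2; 6; 5; 3; 1; 4]); (20, [:: 0; 2; 5; 6; 1; 4]);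
       (101, [:: 3; 1; 2; 6; 5; 4]); (21, [:: 0; 1; 2; 3; 5; 6]); (95, [:: 1; 5; 2; 6; 3; 4]);
       (20, [:: 5; 1; 2; 3; 6; 4]); (95, [:: 2; 5; 1; 6; 3; 4]); (20, [:: 5; 2; 1; 3; 6; 4]);
       (96, [:: 1; 0; 2; 5; 6; 4]); (100, [:: 1; 0; 2; 5; 6; 4]); (96, [:: 2; 0; 1; 5; 6; 4]);
       (100, [:: 2; 0; 1; 5; 6; 4]); (101, [:: 0; 1; 2; 5; 4; 6]); (94, [:: 1; 2; 3; 5; 4; 6]);
       (19, [:: 0; 1; 2; 4; 5; 6]); (98, [:: 0; 5; 1; 2; 3; 4]); (95, [:: 0; 1; 5; 2; 4; 3]);
       (20, [:: 0; 1; 2; 3; 5; 4]); (98, [:: 0; 5; 2; 1; 3; 4]); (95, [:: 0; 2; 5; 1; 4; 3]);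
       (20, [:: 0; 2; 1; 3; 5; 4]); (96, [:: 1; 0; 2; 3; 5; 4]); (100, [:: 1; 0; 2; 3; 5; 4]);
       (96, [:: 2; 0; 1; 3; 5; 4]); (100, [:: 2; 0; 1; 3; 5; 4]); (102, [:: 0; 1; 2; 3; 4; 5]);
       (101, [:: 0; 1; 2; 3; 4; 5]); (21, [:: 0; 1; 2; 3; 4; 5]); (108, [:: 0; 1; 2; 3; 5; 6; 4]);
       (108, [:: 0; 1; 5; 3; 2; 6; 4]); (112, [:: 0; 2; 1; 5; 3; 4; 6]);
       (112, [:: 0; 5; 1; 2; 3; 4; 6]); (108, [:: 0; 2; 5; 3; 1; 6; 4]);
       (112, [:: 0; 1; 2; 5; 3; 4; 6]); (112, [:: 0; 5; 2; 1; 3; 4; 6]);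
       (111, [:: 0; 1; 2; 3; 5; 6; 4]); (110, [:: 0; 1; 2; 3; 5; 4; 6]);
       (33, [:: 0; 1; 2; 3; 5; 4; 6]); (110, [:: 0; 2; 1; 3; 5; 4; 6]);
       (33, [:: 0; 2; 1; 3; 5; 4; 6]); (27, [:: 0; 5; 3; 1; 2; 6; 4]);
       (111, [:: 0; 1; 2; 6; 4; 3; 5]); (111, [:: 0; 1; 2; 6; 5; 3; 4]);
       (28, [:: 0; 1; 2; 3; 4; 6; 5]); (28, [:: 0; 1; 2; 3; 5; 6; 4]);
       (28, [:: 0; 2; 1; 3; 4; 6; 5]); (28, [:: 0; 2; 1; 3; 5; 6; 4]);
       (111, [:: 5; 1; 2; 0; 4; 3; 6]); (31, [:: 2; 1; 0; 3; 4; 5; 6]);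
       (32, [:: 2; 1; 0; 3; 5; 4; 6]); (30, [:: 1; 5; 0; 2; 4; 3; 6]);
       (31, [:: 1; 2; 0; 3; 4; 6; 5]); (32, [:: 1; 2; 0; 3; 6; 4; 5]);
       (29, [:: 1; 0; 2; 3; 5; 6; 4]); (30, [:: 2; 5; 0; 1; 4; 3; 6]);
       (29, [:: 2; 0; 1; 3; 5; 6; 4]); (34, [:: 0; 1; 2; 3; 4; 5; 6])]);
  ([:: [::]; [:: 0]; [:: 0; 1]; [:: 0; 1]; [:: 0; 2]],
   [:: [:: 0; 2; 3]; [:: 0; 1; 4]; [:: 0; 3; 4]; [:: 1; 2; 3]; [:: 1; 2; 4]],
   [:: (14, [:: 0; 1; 2; 5]); (14, [:: 0; 1; 5; 6]); (14, [:: 0; 2; 5; 6]); (14, [:: 1; 3; 5; 6]);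
       (15, [:: 2; 0; 1; 5; 6]); (14, [:: 0; 1; 3; 5]); (14, [:: 0; 2; 4; 5]);
       (15, [:: 0; 2; 4; 5; 6]); (15, [:: 1; 0; 2; 5; 6]); (14, [:: 2; 4; 5; 6]);
       (15, [:: 0; 3; 6; 4; 5]); (15, [:: 0; 1; 3; 5; 6]); (15, [:: 0; 2; 4; 3; 5]);
       (15, [:: 0; 1; 3; 4; 5]); (19, [:: 0; 4; 5; 6; 2; 3]); (95, [:: 0; 3; 1; 5; 4; 6]);
       (99, [:: 0; 3; 1; 5; 4; 6]); (19, [:: 5; 0; 1; 3; 4; 6]); (19, [:: 1; 6; 2; 4; 3; 5]);
       (94, [:: 0; 2; 1; 4; 5; 6]); (19, [:: 2; 0; 1; 5; 4; 6]); (99, [:: 0; 5; 1; 2; 4; 6]);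
       (95, [:: 0; 3; 5; 2; 4; 6]); (99, [:: 0; 4; 2; 5; 3; 6]); (19, [:: 0; 3; 5; 6; 1; 4]);
       (19, [:: 5; 0; 2; 4; 3; 6]); (19, [:: 2; 6; 1; 3; 4; 5]); (94, [:: 0; 1; 2; 3; 5; 6]);
       (19, [:: 1; 0; 2; 5; 3; 6]); (99, [:: 0; 5; 2; 1; 3; 6]); (19, [:: 0; 1; 3; 6; 2; 5]);
       (19, [:: 0; 2; 4; 6; 1; 5]); (99, [:: 1; 5; 3; 0; 2; 6]); (99, [:: 2; 5; 4; 0; 1; 6]);
       (98, [:: 0; 1; 2; 3; 4; 5]); (97, [:: 0; 2; 1; 3; 5; 4]); (97, [:: 0; 1; 2; 4; 5; 3]);
       (96, [:: 0; 1; 2; 3; 4; 5]); (94, [:: 0; 1; 2; 3; 4; 5]); (19, [:: 1; 0; 2; 4; 3; 5]);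
       (94, [:: 0; 2; 1; 4; 3; 5]); (19, [:: 2; 0; 1; 3; 4; 5]); (95, [:: 0; 3; 1; 2; 4; 5]);
       (99, [:: 0; 3; 1; 2; 4; 5]); (99, [:: 0; 4; 2; 1; 3; 5]); (104, [:: 0; 1; 2; 5; 4; 3; 6]);
       (104, [:: 0; 1; 5; 2; 4; 3; 6]); (102, [:: 0; 1; 2; 4; 6; 5; 3]);
       (102, [:: 0; 1; 5; 4; 6; 2; 3]); (104, [:: 0; 1; 2; 3; 6; 5; 4]);
       (104, [:: 0; 1; 2; 5; 6; 3; 4]); (106, [:: 0; 1; 2; 4; 6; 3; 5]);
       (106, [:: 0; 1; 2; 4; 6; 5; 3]); (104, [:: 0; 2; 5; 1; 3; 4; 6]);
       (102, [:: 0; 2; 1; 3; 6; 5; 4]); (102, [:: 0; 2; 5; 3; 6; 1; 4]);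
       (106, [:: 0; 2; 1; 3; 6; 4; 5]); (106, [:: 0; 2; 1; 3; 6; 5; 4]);
       (107, [:: 0; 1; 2; 6; 3; 4; 5]); (22, [:: 0; 1; 2; 4; 6; 3; 5]);
       (22, [:: 0; 2; 1; 3; 6; 4; 5]); (25, [:: 0; 1; 2; 3; 4; 5; 6]);
       (102, [:: 1; 5; 2; 0; 4; 3; 6]); (102, [:: 2; 5; 1; 0; 3; 4; 6]);
       (107, [:: 5; 1; 2; 0; 3; 4; 6]); (108, [:: 0; 1; 2; 3; 4; 5; 6]);
       (103, [:: 2; 0; 1; 3; 4; 5; 6]); (103, [:: 1; 0; 2; 4; 3; 6; 5]);
       (105, [:: 1; 2; 0; 4; 3; 5; 6]); (23, [:: 1; 0; 2; 4; 5; 3; 6]);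
       (23, [:: 2; 0; 1; 3; 5; 4; 6]); (24, [:: 0; 1; 2; 3; 4; 5; 6])]);
  ([:: [::]; [:: 0]; [:: 1]; [:: 0]; [:: 0; 3]; [:: 2]],
   [:: [:: 0; 1; 3]; [:: 0; 1; 4]; [:: 0; 1; 2]; [:: 1; 2; 5]; [:: 3; 4]],
   [:: (13, [:: 0; 3; 4; 6]); (14, [:: 0; 1; 6; 3; 4]); (14, [:: 0; 3; 4; 6; 7]);
       (19, [:: 1; 6; 7; 3; 2; 5]); (15, [:: 0; 1; 3; 4; 6; 7]); (14, [:: 6; 1; 7; 3; 4]);
       (14, [:: 6; 0; 3; 2; 5]); (14, [:: 6; 0; 4; 2; 5]); (14, [:: 6; 1; 2; 3; 4]);
       (19, [:: 1; 6; 7; 4; 2; 5]); (19, [:: 6; 0; 3; 4; 2; 5]); (19, [:: 6; 0; 4; 3; 2; 5]);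
       (19, [:: 6; 0; 3; 4; 5; 2]); (19, [:: 6; 0; 4; 3; 5; 2]); (15, [:: 3; 6; 0; 4; 2; 5]);
       (15, [:: 4; 6; 0; 3; 2; 5]); (15, [:: 0; 1; 3; 4; 2; 6]); (19, [:: 6; 3; 4; 0; 5; 2]);
       (100, [:: 0; 3; 4; 6; 1; 2]); (28, [:: 0; 1; 6; 3; 7; 4; 2]);
       (28, [:: 0; 1; 6; 4; 7; 3; 2]); (39, [:: 1; 0; 3; 6; 4; 7; 2]);
       (39, [:: 1; 0; 4; 6; 3; 7; 2]); (13, [:: 0; 3; 6; 7]); (13, [:: 0; 4; 6; 7]);
       (19, [:: 6; 0; 7; 3; 2; 5]); (19, [:: 6; 0; 7; 4; 2; 5]); (19, [:: 0; 3; 4; 7; 6; 2]);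
       (15, [:: 0; 6; 3; 4; 2; 7]); (19, [:: 6; 0; 3; 4; 7; 2]); (19, [:: 6; 0; 4; 3; 7; 2]);
       (19, [:: 6; 3; 4; 0; 7; 2]); (16, [:: 0; 3; 4; 2; 6; 7]); (15, [:: 0; 6; 3; 4; 2; 5]);
       (19, [:: 1; 0; 6; 3; 2; 5]); (19, [:: 1; 0; 6; 4; 2; 5]); (16, [:: 0; 3; 4; 2; 5; 6]);
       (92, [:: 0; 3; 4; 1; 2; 6]); (92, [:: 0; 4; 3; 1; 2; 6]); (19, [:: 0; 3; 4; 6; 1; 2]);
       (41, [:: 0; 1; 3; 7; 4; 2; 6]); (41, [:: 0; 1; 4; 7; 3; 2; 6]);
       (44, [:: 0; 6; 2; 5; 3; 4; 7]); (23, [:: 0; 3; 4; 6; 7; 2; 5]);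
       (23, [:: 0; 3; 6; 4; 7; 2; 5]); (22, [:: 0; 3; 4; 7; 1; 6; 2]);
       (22, [:: 0; 3; 6; 7; 1; 4; 2]); (28, [:: 0; 1; 4; 3; 7; 6; 2]);
       (32, [:: 6; 0; 3; 4; 7; 2; 5]); (23, [:: 0; 4; 6; 3; 7; 2; 5]);
       (22, [:: 0; 4; 3; 7; 1; 6; 2]); (28, [:: 0; 1; 3; 4; 7; 6; 2]);
       (22, [:: 0; 4; 6; 7; 1; 3; 2]); (32, [:: 6; 0; 4; 3; 7; 2; 5]);
       (25, [:: 0; 1; 7; 3; 4; 2; 6]); (44, [:: 0; 6; 7; 5; 3; 4; 2]);
       (44, [:: 0; 6; 7; 2; 3; 4; 5]); (32, [:: 6; 3; 4; 0; 7; 2; 5]);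
       (36, [:: 1; 6; 7; 2; 3; 4; 5]); (43, [:: 1; 6; 0; 3; 4; 2; 7]);
       (43, [:: 1; 6; 0; 4; 3; 2; 7]); (44, [:: 0; 1; 2; 6; 3; 4; 7]);
       (114, [:: 0; 1; 2; 5; 6; 3; 4]); (112, [:: 2; 1; 6; 0; 3; 4; 5]);
       (112, [:: 2; 1; 6; 0; 4; 3; 5]); (43, [:: 1; 6; 0; 3; 4; 2; 5]);
       (43, [:: 1; 6; 0; 4; 3; 2; 5]); (113, [:: 0; 3; 4; 1; 2; 5; 6]);
       (42, [:: 3; 0; 4; 1; 2; 5; 6]); (113, [:: 0; 4; 3; 1; 2; 5; 6]);
       (42, [:: 4; 0; 3; 1; 2; 5; 6]); (44, [:: 0; 1; 2; 5; 3; 4; 6]);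
       (59, [:: 0; 1; 2; 6; 3; 4; 5; 7]); (59, [:: 0; 6; 2; 1; 3; 4; 5; 7]);
       (61, [:: 0; 1; 3; 7; 4; 2; 5; 6]); (61, [:: 0; 1; 4; 7; 3; 2; 5; 6]);
       (66, [:: 0; 1; 2; 7; 6; 3; 4; 5]); (63, [:: 0; 6; 1; 2; 3; 4; 5; 7]);
       (47, [:: 1; 0; 3; 4; 6; 7; 2; 5]); (64, [:: 6; 1; 3; 0; 4; 2; 5; 7]);
       (64, [:: 6; 1; 4; 0; 3; 2; 5; 7]); (60, [:: 2; 1; 0; 5; 6; 3; 4; 7]);
       (60, [:: 6; 1; 0; 5; 2; 3; 4; 7]); (60, [:: 2; 1; 0; 7; 6; 3; 4; 5]);
       (62, [:: 1; 0; 2; 6; 3; 4; 5; 7]); (65, [:: 0; 1; 2; 3; 4; 5; 6; 7])]);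
  ([:: [::]; [:: 0]; [:: 0; 1]; [:: 1]; [:: 3]; [:: 0]],
   [:: [:: 0; 1; 5]; [:: 0; 2; 5]; [:: 0; 1; 3]; [:: 1; 2; 3]; [:: 1; 3; 4]],
   [:: (12, [:: 0; 1; 2; 6]); (13, [:: 1; 0; 2; 6; 7]); (13, [:: 0; 1; 2; 5; 6]);
       (13, [:: 1; 0; 2; 3; 6]); (13, [:: 0; 1; 2; 6; 7]); (13, [:: 6; 0; 2; 3; 4]);
       (17, [:: 0; 1; 6; 7; 2; 5]); (98, [:: 0; 6; 7; 3; 5; 4]); (18, [:: 1; 6; 7; 5; 3; 4]);
       (17, [:: 6; 0; 1; 2; 5; 4]); (17, [:: 0; 1; 6; 3; 2; 5]); (97, [:: 0; 1; 2; 6; 5; 3]);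
       (92, [:: 1; 6; 2; 3; 0; 4]); (97, [:: 1; 3; 6; 2; 0; 4]); (91, [:: 3; 6; 4; 1; 0; 5]);
       (91, [:: 1; 2; 0; 3; 4; 6]); (30, [:: 1; 0; 2; 6; 3; 7; 5]);
       (20, [:: 1; 6; 2; 0; 5; 7; 3]); (12, [:: 0; 1; 6; 7]); (13, [:: 6; 0; 2; 3; 7]);
       (17, [:: 1; 0; 6; 7; 2; 3]); (16, [:: 0; 1; 6; 5; 3; 7]); (91, [:: 0; 1; 2; 6; 7; 3]);
       (14, [:: 1; 3; 0; 2; 6; 7]); (97, [:: 6; 3; 1; 0; 5; 4]); (18, [:: 1; 0; 6; 5; 3; 4]);
       (99, [:: 1; 0; 2; 6; 3; 4]); (18, [:: 1; 0; 2; 6; 3; 4]); (91, [:: 0; 1; 2; 6; 4; 3]);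
       (98, [:: 0; 1; 2; 6; 5; 4]); (16, [:: 0; 1; 2; 5; 3; 6]); (14, [:: 1; 3; 0; 2; 4; 6]);
       (91, [:: 0; 1; 2; 5; 6; 3]); (20, [:: 0; 1; 2; 7; 3; 6; 5]);
       (20, [:: 0; 1; 6; 7; 3; 2; 5]); (20, [:: 1; 0; 2; 7; 5; 6; 3]);
       (20, [:: 1; 0; 6; 7; 5; 2; 3]); (27, [:: 1; 3; 6; 0; 7; 2; 4]);
       (20, [:: 0; 6; 2; 1; 3; 7; 5]); (21, [:: 1; 2; 0; 6; 3; 7; 4]);
       (24, [:: 1; 3; 6; 0; 2; 4; 7]); (24, [:: 6; 3; 1; 0; 2; 4; 7]);
       (27, [:: 1; 3; 0; 2; 6; 7; 4]); (40, [:: 1; 3; 0; 6; 2; 4; 7]);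
       (19, [:: 0; 1; 2; 5; 7; 6; 3]); (38, [:: 0; 6; 3; 1; 7; 2; 5]);
       (26, [:: 1; 0; 2; 7; 3; 4; 6]); (40, [:: 1; 7; 0; 6; 2; 4; 3]);
       (39, [:: 0; 1; 2; 6; 3; 7; 4]); (27, [:: 1; 3; 6; 2; 7; 0; 4]);
       (26, [:: 1; 6; 2; 0; 3; 4; 7]); (40, [:: 1; 6; 0; 5; 2; 7; 3]);
       (41, [:: 0; 1; 2; 3; 6; 7; 5]); (28, [:: 0; 1; 6; 2; 4; 3; 5]);
       (21, [:: 6; 0; 2; 1; 3; 5; 4]); (38, [:: 0; 6; 3; 1; 4; 2; 5]);
       (107, [:: 6; 1; 2; 0; 5; 4; 3]); (26, [:: 1; 0; 2; 6; 3; 4; 5]);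
       (40, [:: 1; 6; 0; 5; 2; 4; 3]); (111, [:: 0; 1; 2; 3; 6; 4; 5]);
       (34, [:: 3; 6; 1; 2; 0; 5; 4]); (37, [:: 3; 1; 0; 2; 6; 4; 5]);
       (35, [:: 1; 0; 2; 3; 5; 6; 4]); (112, [:: 0; 1; 2; 5; 6; 4; 3]);
       (41, [:: 0; 1; 2; 3; 4; 6; 5]); (39, [:: 0; 1; 2; 5; 3; 6; 4]);
       (56, [:: 0; 1; 2; 3; 6; 4; 5; 7]); (53, [:: 0; 6; 3; 1; 2; 4; 7; 5]);
       (52, [:: 0; 1; 2; 3; 5; 7; 4; 6]); (52, [:: 0; 1; 2; 3; 6; 7; 4; 5]);
       (57, [:: 1; 3; 0; 2; 4; 6; 7; 5]); (57, [:: 1; 6; 0; 2; 4; 3; 7; 5]);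
       (55, [:: 1; 6; 0; 5; 2; 3; 4; 7]); (57, [:: 1; 3; 0; 2; 7; 6; 4; 5]);
       (51, [:: 1; 0; 2; 3; 6; 4; 7; 5]); (54, [:: 0; 1; 2; 3; 4; 5; 6; 7])]);
  ([:: [::]; [:: 0]; [:: 0; 1]; [:: 0]; [:: 1; 3]; [:: 3; 4]],
   [:: [:: 0; 2; 3]; [:: 1; 2; 4]; [:: 0; 3; 5]; [:: 0; 1; 3; 4]; [:: 1; 4; 5]],
   [:: (11, [:: 0; 1; 2; 6]); (11, [:: 3; 4; 5; 6]); (11, [:: 0; 1; 6; 7]); (11, [:: 3; 4; 6; 7]);
       (12, [:: 4; 3; 5; 6; 7]); (12, [:: 3; 4; 5; 6; 7]); (12, [:: 3; 0; 6; 4; 5]);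
       (12, [:: 4; 1; 6; 3; 5]); (12, [:: 0; 1; 2; 6; 7]); (12, [:: 1; 0; 2; 6; 7]);
       (12, [:: 0; 1; 2; 3; 6]); (12, [:: 1; 0; 2; 4; 6]); (98, [:: 1; 0; 2; 6; 4; 5]);
       (98, [:: 0; 1; 2; 6; 3; 5]); (90, [:: 1; 2; 0; 4; 5; 6]); (12, [:: 7; 0; 6; 4; 5]);
       (12, [:: 7; 1; 6; 3; 5]); (12, [:: 6; 0; 2; 4; 7]); (12, [:: 6; 1; 2; 3; 7]);
       (12, [:: 6; 0; 2; 4; 5]); (12, [:: 6; 1; 2; 3; 5]); (90, [:: 0; 7; 2; 6; 5; 4]);
       (91, [:: 0; 6; 1; 7; 2; 5]); (16, [:: 6; 0; 1; 2; 7; 5]); (90, [:: 1; 7; 2; 6; 5; 3]);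
       (91, [:: 1; 6; 0; 7; 2; 5]); (16, [:: 6; 1; 0; 2; 7; 5]); (97, [:: 2; 0; 1; 6; 7; 5]);
       (91, [:: 6; 7; 0; 4; 2; 5]); (90, [:: 3; 4; 5; 7; 2; 6]); (13, [:: 0; 3; 2; 6; 5; 7]);
       (91, [:: 4; 7; 3; 6; 5; 2]); (13, [:: 1; 4; 2; 7; 5; 6]); (90, [:: 0; 1; 2; 6; 5; 7]);
       (90, [:: 4; 6; 5; 7; 2; 0]); (16, [:: 7; 4; 3; 5; 6; 2]); (91, [:: 6; 7; 1; 3; 2; 5]);
       (91, [:: 3; 7; 4; 6; 5; 2]); (90, [:: 3; 6; 5; 7; 2; 1]); (16, [:: 7; 3; 4; 5; 6; 2]);
       (91, [:: 3; 6; 4; 0; 5; 2]); (91, [:: 4; 6; 3; 1; 5; 2]); (94, [:: 3; 4; 6; 0; 1; 5]);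
       (13, [:: 0; 3; 2; 6; 4; 5]); (13, [:: 1; 4; 2; 6; 3; 5]); (91, [:: 0; 6; 1; 3; 2; 5]);
       (91, [:: 1; 6; 0; 4; 2; 5]); (90, [:: 3; 4; 5; 6; 2; 1]); (17, [:: 4; 3; 5; 6; 1; 2]);
       (90, [:: 0; 1; 2; 6; 5; 4]); (98, [:: 3; 4; 5; 6; 0; 2]); (90, [:: 3; 4; 5; 0; 2; 6]);
       (17, [:: 3; 4; 5; 6; 0; 2]); (90, [:: 0; 1; 2; 3; 5; 6]); (28, [:: 0; 1; 6; 2; 4; 5; 7]);
       (28, [:: 1; 0; 6; 2; 3; 5; 7]); (26, [:: 0; 3; 6; 1; 5; 2; 7]);
       (24, [:: 6; 0; 1; 2; 5; 3; 7]); (20, [:: 1; 0; 2; 7; 4; 6; 5]);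
       (20, [:: 1; 0; 6; 7; 4; 2; 5]); (20, [:: 0; 1; 2; 7; 3; 6; 5]);
       (20, [:: 0; 1; 6; 7; 3; 2; 5]); (26, [:: 0; 3; 2; 1; 7; 6; 5]);
       (26, [:: 0; 3; 6; 1; 7; 2; 5]); (25, [:: 0; 6; 1; 2; 3; 5; 7]);
       (23, [:: 1; 4; 6; 0; 2; 5; 7]); (23, [:: 6; 4; 1; 0; 2; 5; 7]);
       (23, [:: 3; 0; 6; 4; 5; 2; 7]); (20, [:: 3; 4; 5; 6; 0; 7; 2]);
       (23, [:: 6; 0; 3; 4; 5; 2; 7]); (23, [:: 0; 3; 7; 1; 2; 5; 6]);
       (23, [:: 4; 1; 7; 3; 5; 2; 6]); (28, [:: 4; 3; 7; 5; 0; 2; 6]);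
       (20, [:: 3; 4; 7; 6; 0; 5; 2]); (23, [:: 6; 3; 0; 1; 2; 5; 7]);
       (20, [:: 4; 3; 5; 6; 1; 7; 2]); (23, [:: 6; 1; 4; 3; 5; 2; 7]);
       (28, [:: 3; 4; 7; 5; 1; 2; 6]); (20, [:: 4; 3; 7; 6; 1; 5; 2]);
       (24, [:: 6; 3; 4; 5; 2; 0; 7]); (25, [:: 3; 6; 4; 5; 0; 2; 7]);
       (37, [:: 0; 3; 4; 1; 5; 2; 6]); (37, [:: 1; 4; 3; 0; 5; 2; 6]);
       (110, [:: 2; 0; 1; 3; 4; 5; 6]); (37, [:: 3; 0; 1; 4; 2; 5; 6]);
       (37, [:: 4; 1; 0; 3; 2; 5; 6]); (110, [:: 5; 3; 4; 0; 1; 2; 6]);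
       (49, [:: 0; 1; 2; 4; 3; 6; 7; 5]); (48, [:: 0; 6; 4; 1; 3; 2; 5; 7]);
       (48, [:: 1; 6; 3; 0; 4; 2; 5; 7]); (47, [:: 0; 1; 2; 3; 4; 5; 6; 7])]);
  ([:: [::]; [:: 0]; [:: 0; 1]; [:: 1]; [:: 2; 3]; [:: 0]],
   [:: [:: 0; 1; 5]; [:: 0; 2; 5]; [:: 0; 1; 3]; [:: 0; 2; 4]; [:: 1; 2; 3; 4]],
   [:: (10, [:: 0; 1; 2; 6]); (11, [:: 0; 1; 2; 5; 6]); (11, [:: 1; 0; 2; 3; 6]);
       (11, [:: 2; 0; 1; 4; 6]); (10, [:: 1; 2; 6; 7]); (11, [:: 0; 1; 2; 6; 7]);
       (11, [:: 6; 0; 5; 3; 4]); (15, [:: 0; 1; 6; 3; 2; 5]); (95, [:: 0; 2; 1; 6; 5; 4]);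
       (15, [:: 0; 2; 6; 4; 1; 5]); (15, [:: 2; 0; 6; 5; 1; 4]); (93, [:: 1; 2; 6; 3; 4; 0]);
       (89, [:: 0; 1; 2; 5; 6; 3]); (10, [:: 0; 1; 6; 7]); (10, [:: 0; 2; 6; 7]);
       (11, [:: 1; 0; 2; 6; 7]); (11, [:: 2; 0; 1; 6; 7]); (15, [:: 0; 6; 7; 4; 1; 5]);
       (15, [:: 1; 0; 6; 7; 2; 3]); (14, [:: 0; 1; 6; 5; 7; 4]); (15, [:: 0; 1; 6; 7; 2; 5]);
       (14, [:: 0; 1; 6; 5; 3; 7]); (15, [:: 0; 6; 7; 3; 2; 5]); (15, [:: 2; 0; 6; 7; 1; 4]);
       (14, [:: 0; 2; 6; 5; 7; 3]); (15, [:: 0; 2; 6; 7; 1; 5]); (14, [:: 0; 2; 6; 5; 4; 7]);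
       (95, [:: 1; 0; 2; 6; 7; 5]); (95, [:: 2; 0; 1; 6; 7; 5]); (96, [:: 0; 1; 2; 6; 5; 7]);
       (14, [:: 0; 1; 2; 5; 6; 7]); (95, [:: 6; 4; 2; 0; 5; 3]); (15, [:: 1; 0; 6; 5; 2; 3]);
       (95, [:: 1; 0; 2; 6; 3; 5]); (95, [:: 2; 0; 1; 6; 4; 5]); (14, [:: 0; 1; 2; 5; 6; 4]);
       (14, [:: 0; 1; 2; 5; 3; 6]); (89, [:: 0; 2; 1; 5; 6; 4]); (18, [:: 0; 1; 2; 7; 3; 6; 5]);
       (18, [:: 1; 0; 2; 7; 5; 6; 3]); (26, [:: 0; 1; 2; 6; 7; 3; 5]);
       (18, [:: 2; 0; 1; 7; 5; 6; 4]); (26, [:: 0; 2; 1; 6; 7; 4; 5]);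
       (40, [:: 0; 1; 6; 3; 4; 5; 7]); (23, [:: 0; 1; 2; 7; 6; 3; 5]);
       (30, [:: 0; 1; 2; 4; 7; 6; 5]); (30, [:: 0; 2; 1; 3; 7; 6; 5]);
       (28, [:: 0; 1; 2; 7; 5; 6; 3]); (28, [:: 0; 1; 2; 7; 6; 5; 3]);
       (30, [:: 0; 2; 1; 7; 4; 6; 5]); (30, [:: 0; 1; 2; 7; 3; 6; 5]);
       (33, [:: 0; 1; 2; 6; 3; 4; 7]); (18, [:: 1; 6; 2; 0; 5; 7; 3]);
       (18, [:: 2; 6; 1; 0; 5; 7; 4]); (28, [:: 6; 1; 2; 0; 5; 7; 3]);
       (35, [:: 6; 1; 0; 2; 4; 7; 5]); (35, [:: 6; 2; 0; 1; 3; 7; 5]);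
       (26, [:: 0; 1; 2; 6; 4; 3; 5]); (26, [:: 0; 2; 1; 6; 3; 4; 5]);
       (30, [:: 0; 2; 1; 3; 4; 6; 5]); (30, [:: 0; 1; 2; 4; 3; 6; 5]);
       (101, [:: 2; 6; 1; 3; 0; 4; 5]); (101, [:: 1; 6; 2; 4; 0; 3; 5]);
       (31, [:: 1; 6; 4; 2; 0; 5; 3]); (34, [:: 1; 0; 2; 5; 6; 4; 3]);
       (31, [:: 2; 6; 3; 1; 0; 5; 4]); (34, [:: 2; 0; 1; 5; 6; 3; 4]);
       (109, [:: 0; 1; 2; 3; 4; 6; 5]); (35, [:: 3; 1; 0; 2; 4; 6; 5]);
       (35, [:: 4; 2; 0; 1; 3; 6; 5]); (33, [:: 0; 1; 2; 5; 3; 4; 6]);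
       (112, [:: 0; 6; 1; 2; 3; 4; 5; 7]); (45, [:: 0; 1; 2; 3; 4; 5; 6; 7])]);
  ([:: [::]; [:: 0]; [:: 1]; [:: 1; 2]; [:: 0; 2]; [:: 0; 3]],
   [:: [:: 0; 1; 4; 5]; [:: 2; 3; 4]; [:: 0; 1; 2; 4]; [:: 2; 3; 5]; [:: 0; 1; 3; 5]],
   [:: (9, [:: 1; 2; 3; 6]); (10, [:: 1; 0; 6; 2; 3]); (10, [:: 2; 1; 3; 4; 6]);
       (10, [:: 3; 1; 2; 5; 6]); (9, [:: 1; 2; 6; 7]); (9, [:: 1; 3; 6; 7]);
       (10, [:: 2; 1; 3; 6; 7]); (10, [:: 3; 1; 2; 6; 7]); (13, [:: 2; 3; 6; 4; 5; 7]);
       (92, [:: 1; 2; 6; 0; 4; 3]); (92, [:: 1; 3; 6; 0; 5; 2]); (91, [:: 2; 3; 6; 1; 4; 5]);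
       (14, [:: 3; 2; 6; 4; 1; 5]); (14, [:: 2; 3; 6; 5; 1; 4]); (88, [:: 2; 3; 1; 4; 6; 5]);
       (9, [:: 2; 3; 6; 7]); (10, [:: 2; 3; 6; 4; 7]); (10, [:: 3; 2; 6; 5; 7]);
       (10, [:: 0; 4; 7; 5; 6]); (10, [:: 5; 0; 6; 3; 7]); (10, [:: 4; 0; 6; 2; 7]);
       (10, [:: 1; 2; 3; 6; 7]); (14, [:: 3; 2; 6; 7; 1; 5]); (14, [:: 2; 3; 6; 7; 1; 4]);
       (88, [:: 2; 3; 6; 4; 7; 5]); (14, [:: 2; 7; 6; 5; 1; 4]); (88, [:: 0; 5; 6; 4; 7; 3]);
       (13, [:: 0; 5; 6; 4; 3; 7]); (88, [:: 0; 6; 7; 5; 3; 2]); (88, [:: 3; 5; 7; 2; 6; 0]);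
       (88, [:: 0; 4; 6; 5; 7; 2]); (14, [:: 3; 7; 6; 4; 1; 5]); (13, [:: 0; 4; 6; 5; 2; 7]);
       (88, [:: 0; 6; 7; 4; 2; 3]); (88, [:: 2; 4; 7; 3; 6; 0]); (11, [:: 0; 1; 6; 7; 2; 3]);
       (14, [:: 7; 2; 1; 3; 4; 6]); (14, [:: 7; 3; 1; 2; 5; 6]); (90, [:: 6; 2; 4; 7; 5; 3]);
       (13, [:: 2; 4; 6; 3; 0; 7]); (90, [:: 6; 3; 5; 7; 4; 2]); (13, [:: 3; 5; 6; 2; 0; 7]);
       (90, [:: 1; 0; 6; 2; 3; 5]); (94, [:: 2; 3; 1; 6; 4; 5]); (90, [:: 1; 0; 6; 3; 2; 4]);
       (94, [:: 3; 2; 1; 6; 5; 4]); (88, [:: 0; 4; 6; 5; 3; 2]); (88, [:: 0; 5; 6; 4; 2; 3]);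
       (13, [:: 1; 2; 3; 6; 4; 5]); (88, [:: 2; 3; 6; 4; 0; 5]); (17, [:: 2; 3; 6; 7; 5; 1; 4]);
       (17, [:: 3; 2; 6; 7; 4; 1; 5]); (17, [:: 2; 3; 1; 7; 5; 6; 4]);
       (17, [:: 3; 2; 1; 7; 4; 6; 5]); (107, [:: 0; 5; 6; 3; 2; 7; 4]);
       (29, [:: 0; 5; 6; 2; 3; 4; 7]); (26, [:: 0; 6; 5; 7; 2; 3; 4]);
       (98, [:: 2; 7; 6; 5; 4; 0; 3]); (107, [:: 2; 1; 3; 7; 5; 4; 6]);
       (107, [:: 0; 4; 7; 2; 3; 6; 5]); (107, [:: 0; 6; 7; 2; 3; 4; 5]);
       (17, [:: 2; 7; 1; 3; 5; 4; 6]); (17, [:: 2; 7; 1; 3; 5; 6; 4]);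
       (26, [:: 3; 1; 2; 7; 0; 6; 5]); (29, [:: 2; 3; 1; 7; 5; 4; 6]);
       (31, [:: 6; 0; 2; 1; 3; 5; 7]); (29, [:: 0; 4; 6; 3; 2; 5; 7]);
       (26, [:: 0; 6; 4; 7; 3; 2; 5]); (98, [:: 3; 7; 6; 4; 5; 0; 2]);
       (107, [:: 3; 1; 2; 7; 4; 5; 6]); (26, [:: 2; 1; 3; 7; 0; 6; 4]);
       (17, [:: 3; 7; 1; 2; 4; 5; 6]); (17, [:: 3; 7; 1; 2; 4; 6; 5]);
       (29, [:: 3; 2; 1; 7; 4; 5; 6]); (31, [:: 6; 0; 3; 1; 2; 4; 7]);
       (18, [:: 1; 2; 7; 4; 0; 3; 6]); (26, [:: 2; 1; 7; 3; 0; 6; 4]);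
       (18, [:: 1; 3; 7; 5; 0; 2; 6]); (26, [:: 3; 1; 7; 2; 0; 6; 5]);
       (97, [:: 6; 7; 1; 2; 3; 4; 5]); (98, [:: 3; 1; 2; 6; 7; 4; 5]);
       (98, [:: 2; 1; 3; 7; 6; 5; 4]); (30, [:: 1; 0; 4; 2; 6; 5; 7]);
       (98, [:: 2; 1; 6; 7; 3; 5; 4]); (27, [:: 6; 2; 1; 3; 5; 7; 4]);
       (98, [:: 3; 1; 6; 7; 2; 4; 5]); (27, [:: 6; 3; 1; 2; 4; 7; 5]);
       (98, [:: 0; 6; 1; 2; 5; 3; 4]); (98, [:: 0; 6; 1; 3; 4; 2; 5]);
       (26, [:: 2; 1; 3; 6; 0; 5; 4]); (26, [:: 3; 1; 2; 6; 0; 4; 5]);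
       (30, [:: 1; 0; 4; 2; 3; 5; 6]); (30, [:: 1; 0; 5; 3; 2; 4; 6]);
       (107, [:: 2; 1; 3; 0; 5; 4; 6]); (29, [:: 2; 3; 1; 0; 5; 4; 6]);
       (107, [:: 3; 1; 2; 0; 4; 5; 6]); (29, [:: 3; 2; 1; 0; 4; 5; 6]);
       (31, [:: 4; 0; 2; 1; 3; 5; 6]); (31, [:: 5; 0; 3; 1; 2; 4; 6]);
       (41, [:: 0; 1; 4; 7; 5; 2; 3; 6]); (43, [:: 0; 1; 2; 3; 4; 5; 6; 7]);
       (41, [:: 6; 1; 4; 0; 5; 2; 3; 7]); (42, [:: 0; 1; 2; 3; 4; 5; 6; 7])]);
  ([:: [::]; [:: 0]; [:: 0]; [:: 0; 2]; [:: 1]; [::]; [:: 5]],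
   [:: [:: 0; 1; 2]; [:: 0; 1; 3]; [:: 0; 1; 4]; [:: 2; 3]; [:: 5; 6]],
   [:: (8, [:: 0; 2; 3; 7]); (9, [:: 0; 1; 7; 2; 3]); (9, [:: 7; 1; 4; 5; 6]);
       (14, [:: 7; 0; 2; 3; 5; 6]); (14, [:: 7; 0; 2; 3; 6; 5]); (14, [:: 7; 0; 3; 2; 5; 6]);
       (14, [:: 7; 0; 3; 2; 6; 5]); (14, [:: 7; 2; 3; 0; 5; 6]); (14, [:: 7; 2; 3; 0; 6; 5]);
       (87, [:: 0; 2; 3; 1; 4; 7]); (87, [:: 0; 3; 2; 1; 4; 7]); (9, [:: 0; 2; 3; 7; 8]);
       (9, [:: 7; 0; 2; 5; 6]); (9, [:: 7; 0; 3; 5; 6]); (9, [:: 7; 2; 3; 5; 6]);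
       (10, [:: 0; 1; 2; 3; 4; 7]); (11, [:: 0; 2; 3; 5; 6; 7]); (22, [:: 0; 7; 2; 3; 1; 4; 8]);
       (22, [:: 0; 7; 3; 2; 1; 4; 8]); (27, [:: 1; 7; 8; 2; 4; 5; 6]);
       (20, [:: 7; 1; 0; 2; 3; 4; 8]); (10, [:: 0; 7; 2; 3; 5; 6]); (10, [:: 2; 7; 0; 3; 5; 6]);
       (10, [:: 3; 7; 0; 2; 5; 6]); (18, [:: 0; 2; 7; 3; 8; 5; 6]);
       (18, [:: 0; 3; 7; 2; 8; 5; 6]); (27, [:: 0; 2; 3; 8; 7; 5; 6]);
       (39, [:: 0; 7; 8; 5; 2; 3; 6]); (39, [:: 0; 7; 8; 6; 2; 3; 5]);
       (27, [:: 1; 7; 8; 3; 4; 5; 6]); (18, [:: 0; 2; 7; 3; 1; 5; 6]);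
       (18, [:: 0; 3; 7; 2; 1; 5; 6]); (27, [:: 7; 2; 3; 0; 4; 5; 6]); (8, [:: 0; 2; 7; 8]);
       (8, [:: 0; 3; 7; 8]); (9, [:: 7; 1; 8; 2; 3]); (10, [:: 0; 1; 2; 3; 7; 8]);
       (11, [:: 0; 2; 3; 5; 7; 8]); (11, [:: 0; 2; 3; 6; 7; 8]); (14, [:: 0; 2; 3; 7; 1; 4]);
       (18, [:: 0; 2; 3; 7; 8; 5; 6]); (17, [:: 0; 2; 3; 8; 1; 7; 4]);
       (17, [:: 0; 2; 7; 8; 1; 3; 4]); (23, [:: 0; 1; 3; 2; 8; 7; 4]);
       (23, [:: 0; 1; 7; 2; 8; 3; 4]); (17, [:: 0; 3; 2; 8; 1; 7; 4]);
       (23, [:: 0; 1; 2; 3; 8; 7; 4]); (17, [:: 0; 3; 7; 8; 1; 2; 4]);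
       (23, [:: 0; 1; 7; 3; 8; 2; 4]); (36, [:: 0; 1; 2; 8; 3; 4; 7]);
       (36, [:: 0; 1; 3; 8; 2; 4; 7]); (34, [:: 1; 0; 2; 7; 3; 8; 4]);
       (39, [:: 2; 7; 8; 5; 0; 3; 6]); (39, [:: 2; 7; 8; 6; 0; 3; 5]);
       (34, [:: 1; 0; 3; 7; 2; 8; 4]); (39, [:: 3; 7; 8; 5; 0; 2; 6]);
       (39, [:: 3; 7; 8; 6; 0; 2; 5]); (39, [:: 0; 1; 7; 8; 2; 3; 5]);
       (39, [:: 0; 1; 7; 8; 2; 3; 6]); (27, [:: 7; 0; 2; 3; 4; 5; 6]);
       (27, [:: 7; 0; 3; 2; 4; 5; 6]); (34, [:: 7; 2; 0; 1; 3; 4; 5]);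
       (34, [:: 7; 2; 0; 1; 3; 4; 6]); (34, [:: 7; 3; 0; 1; 2; 4; 5]);
       (34, [:: 7; 3; 0; 1; 2; 4; 6]); (39, [:: 0; 1; 7; 5; 2; 3; 6]);
       (39, [:: 0; 1; 7; 6; 2; 3; 5]); (37, [:: 0; 2; 3; 7; 5; 6; 1]);
       (37, [:: 0; 2; 3; 7; 6; 5; 1]); (37, [:: 0; 3; 2; 7; 5; 6; 1]);
       (37, [:: 0; 3; 2; 7; 6; 5; 1]); (39, [:: 0; 1; 4; 7; 2; 3; 5]);
       (39, [:: 0; 1; 4; 7; 2; 3; 6]); (41, [:: 1; 0; 2; 3; 7; 8; 5; 6]);
       (43, [:: 1; 7; 8; 2; 3; 4; 5; 6]); (60, [:: 0; 1; 7; 2; 3; 8; 5; 6]);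
       (61, [:: 0; 7; 5; 4; 1; 2; 3; 6]); (61, [:: 0; 7; 6; 4; 1; 2; 3; 5]);
       (58, [:: 0; 1; 7; 5; 2; 3; 6; 4]); (58, [:: 0; 1; 7; 6; 2; 3; 5; 4]);
       (44, [:: 0; 2; 3; 1; 7; 4; 5; 6]); (59, [:: 1; 7; 0; 2; 3; 5; 6; 4]);
       (59, [:: 1; 7; 0; 2; 3; 6; 5; 4]); (44, [:: 0; 3; 2; 1; 7; 4; 5; 6]);
       (59, [:: 1; 7; 0; 3; 2; 5; 6; 4]); (59, [:: 1; 7; 0; 3; 2; 6; 5; 4]);
       (50, [:: 2; 0; 3; 1; 4; 7; 5; 6]); (50, [:: 3; 0; 2; 1; 4; 7; 5; 6]);
       (60, [:: 0; 1; 4; 2; 3; 7; 5; 6]); (78, [:: 0; 1; 4; 7; 2; 3; 8; 5; 6]);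
       (78, [:: 0; 7; 4; 1; 2; 3; 8; 5; 6]); (74, [:: 0; 1; 2; 8; 3; 4; 7; 5; 6]);
       (74, [:: 0; 1; 3; 8; 2; 4; 7; 5; 6]); (78, [:: 0; 1; 8; 7; 2; 3; 4; 5; 6]);
       (72, [:: 0; 1; 7; 2; 3; 4; 8; 5; 6]); (79, [:: 1; 7; 0; 2; 3; 4; 8; 5; 6]);
       (79, [:: 1; 7; 0; 3; 2; 4; 8; 5; 6]); (85, [:: 0; 1; 2; 3; 4; 5; 6; 7; 8]);
       (85, [:: 0; 1; 2; 3; 4; 5; 7; 6; 8]); (85, [:: 0; 1; 2; 3; 4; 6; 7; 5; 8]);
       (80, [:: 0; 1; 2; 3; 4; 5; 6; 7; 8])]);
  ([:: [::]; [:: 0]; [:: 0; 1]; [:: 0]; [:: 1]; [::]; [:: 5]],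
   [:: [:: 0; 1; 3]; [:: 0; 2; 3]; [:: 0; 1; 4]; [:: 1; 2; 4]; [:: 5; 6]],
   [:: (7, [:: 0; 1; 2; 7]); (8, [:: 0; 1; 2; 3; 7]); (8, [:: 1; 0; 2; 4; 7]);
       (8, [:: 7; 0; 1; 5; 6]); (8, [:: 7; 0; 2; 5; 6]); (8, [:: 7; 1; 2; 5; 6]);
       (13, [:: 7; 0; 1; 2; 5; 6]); (13, [:: 7; 0; 1; 2; 6; 5]); (13, [:: 7; 0; 2; 1; 5; 6]);
       (13, [:: 7; 0; 2; 1; 6; 5]); (13, [:: 7; 1; 2; 0; 5; 6]); (13, [:: 7; 1; 2; 0; 6; 5]);
       (9, [:: 2; 7; 0; 1; 5; 6]); (10, [:: 0; 1; 2; 5; 6; 7]); (8, [:: 0; 1; 2; 7; 8]);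
       (8, [:: 1; 0; 2; 7; 8]); (11, [:: 0; 1; 7; 3; 4; 8]); (11, [:: 0; 1; 2; 3; 4; 7]);
       (86, [:: 0; 1; 2; 3; 7; 4]); (25, [:: 7; 0; 2; 1; 4; 8; 3]);
       (25, [:: 7; 1; 2; 0; 3; 8; 4]); (9, [:: 0; 7; 1; 2; 5; 6]); (9, [:: 1; 7; 0; 2; 5; 6]);
       (17, [:: 0; 1; 7; 2; 8; 5; 6]); (17, [:: 1; 0; 7; 2; 8; 5; 6]);
       (26, [:: 0; 7; 8; 4; 3; 5; 6]); (26, [:: 1; 0; 2; 7; 8; 5; 6]);
       (26, [:: 0; 1; 2; 8; 7; 5; 6]); (38, [:: 0; 7; 8; 5; 1; 2; 6]);
       (38, [:: 0; 7; 8; 6; 1; 2; 5]); (26, [:: 1; 7; 8; 3; 4; 5; 6]);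
       (38, [:: 1; 7; 8; 5; 0; 2; 6]); (38, [:: 1; 7; 8; 6; 0; 2; 5]);
       (17, [:: 0; 1; 7; 2; 3; 5; 6]); (17, [:: 0; 2; 7; 1; 3; 5; 6]);
       (17, [:: 1; 2; 7; 0; 4; 5; 6]); (7, [:: 0; 1; 7; 8]); (10, [:: 0; 1; 2; 5; 7; 8]);
       (10, [:: 0; 1; 2; 6; 7; 8]); (12, [:: 0; 1; 7; 4; 2; 3]); (15, [:: 0; 1; 2; 8; 4; 7; 3]);
       (15, [:: 1; 0; 2; 8; 3; 7; 4]); (17, [:: 0; 2; 7; 1; 8; 5; 6]);
       (17, [:: 2; 0; 1; 7; 8; 5; 6]); (14, [:: 0; 1; 2; 3; 8; 7; 4]);
       (17, [:: 1; 2; 7; 0; 8; 5; 6]); (26, [:: 1; 0; 2; 7; 4; 5; 6]);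
       (36, [:: 1; 0; 2; 7; 5; 6; 4]); (36, [:: 1; 0; 2; 7; 6; 5; 4]);
       (26, [:: 0; 1; 2; 7; 3; 5; 6]); (36, [:: 0; 1; 2; 7; 5; 6; 3]);
       (36, [:: 0; 1; 2; 7; 6; 5; 3]); (32, [:: 7; 2; 1; 0; 3; 5; 4]);
       (32, [:: 7; 2; 1; 0; 3; 6; 4]); (32, [:: 7; 2; 0; 1; 4; 5; 3]);
       (32, [:: 7; 2; 0; 1; 4; 6; 3]); (38, [:: 0; 3; 7; 5; 1; 2; 6]);
       (38, [:: 1; 4; 7; 5; 0; 2; 6]); (38, [:: 0; 3; 7; 6; 1; 2; 5]);
       (38, [:: 1; 4; 7; 6; 0; 2; 5]); (49, [:: 1; 0; 2; 7; 8; 4; 5; 6]);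
       (49, [:: 0; 1; 2; 7; 8; 3; 5; 6]); (55, [:: 0; 7; 1; 4; 2; 5; 6; 3]);
       (55, [:: 0; 7; 1; 4; 2; 6; 5; 3]); (55, [:: 1; 7; 0; 3; 2; 5; 6; 4]);
       (55, [:: 1; 7; 0; 3; 2; 6; 5; 4]); (41, [:: 7; 2; 0; 1; 3; 4; 5; 6]);
       (41, [:: 7; 2; 0; 1; 3; 4; 6; 5]); (40, [:: 7; 2; 0; 1; 3; 4; 5; 6]);
       (42, [:: 1; 0; 2; 3; 7; 4; 5; 6]); (42, [:: 0; 1; 2; 4; 7; 3; 5; 6]);
       (49, [:: 1; 0; 2; 3; 7; 4; 5; 6]); (49, [:: 0; 1; 2; 4; 7; 3; 5; 6]);
       (64, [:: 0; 1; 2; 7; 4; 3; 8; 5; 6]); (73, [:: 0; 7; 1; 4; 2; 8; 3; 5; 6]);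
       (64, [:: 0; 1; 2; 3; 8; 7; 4; 5; 6]); (64, [:: 0; 1; 2; 7; 8; 3; 4; 5; 6]);
       (73, [:: 1; 7; 0; 3; 2; 8; 4; 5; 6]); (83, [:: 0; 1; 2; 3; 4; 5; 6; 7; 8]);
       (83, [:: 0; 1; 2; 3; 4; 5; 7; 6; 8]); (83, [:: 0; 1; 2; 3; 4; 6; 7; 5; 8]);
       (81, [:: 0; 1; 2; 3; 4; 5; 6; 7; 8])]);
  ([:: [::]; [:: 0]; [:: 0]; [:: 1]; [::]; [:: 4]; [:: 4; 5]],
   [:: [:: 0; 1; 2]; [:: 0; 1; 3]; [:: 4; 5]; [:: 4; 6]; [:: 5; 6]],
   [:: (6, [:: 4; 5; 6; 7]); (7, [:: 7; 0; 1; 4; 5]); (7, [:: 7; 0; 1; 4; 6]);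
       (7, [:: 7; 0; 1; 5; 6]); (8, [:: 4; 7; 5; 6; 0; 1]); (8, [:: 5; 7; 4; 6; 0; 1]);
       (8, [:: 6; 7; 4; 5; 0; 1]); (9, [:: 0; 1; 7; 4; 5; 6]); (12, [:: 7; 4; 5; 6; 0; 1]);
       (12, [:: 7; 4; 6; 5; 0; 1]); (12, [:: 7; 5; 6; 4; 0; 1]); (12, [:: 7; 4; 5; 6; 1; 0]);
       (12, [:: 7; 4; 6; 5; 1; 0]); (12, [:: 7; 5; 6; 4; 1; 0]); (9, [:: 0; 7; 8; 4; 5; 6]);
       (9, [:: 1; 7; 8; 4; 5; 6]); (12, [:: 8; 4; 5; 6; 7; 0]); (12, [:: 8; 4; 6; 5; 7; 0]);
       (12, [:: 8; 5; 6; 4; 7; 0]); (12, [:: 8; 4; 5; 6; 7; 1]); (12, [:: 8; 4; 6; 5; 7; 1]);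
       (12, [:: 8; 5; 6; 4; 7; 1]); (8, [:: 4; 7; 5; 6; 0; 2]); (8, [:: 4; 7; 5; 6; 1; 3]);
       (8, [:: 5; 7; 4; 6; 0; 2]); (8, [:: 5; 7; 4; 6; 1; 3]); (8, [:: 6; 7; 4; 5; 0; 2]);
       (8, [:: 6; 7; 4; 5; 1; 3]); (9, [:: 0; 2; 7; 4; 5; 6]); (9, [:: 1; 3; 7; 4; 5; 6]);
       (12, [:: 7; 4; 5; 6; 3; 1]); (12, [:: 7; 4; 6; 5; 3; 1]); (12, [:: 7; 5; 6; 4; 3; 1]);
       (37, [:: 4; 8; 7; 0; 5; 6; 1]); (37, [:: 5; 8; 7; 0; 4; 6; 1]);
       (37, [:: 6; 8; 7; 0; 4; 5; 1]); (37, [:: 4; 8; 7; 1; 5; 6; 0]);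
       (37, [:: 5; 8; 7; 1; 4; 6; 0]); (37, [:: 6; 8; 7; 1; 4; 5; 0]);
       (37, [:: 4; 7; 2; 0; 5; 6; 1]); (37, [:: 5; 7; 2; 0; 4; 6; 1]);
       (37, [:: 6; 7; 2; 0; 4; 5; 1]); (6, [:: 4; 5; 7; 8]); (6, [:: 4; 6; 7; 8]);
       (6, [:: 5; 6; 7; 8]); (7, [:: 4; 5; 6; 7; 8]); (7, [:: 5; 4; 6; 7; 8]);
       (7, [:: 6; 4; 5; 7; 8]); (12, [:: 7; 4; 5; 6; 2; 0]); (12, [:: 7; 4; 6; 5; 2; 0]);
       (12, [:: 7; 5; 6; 4; 2; 0]); (16, [:: 4; 5; 6; 7; 8; 0; 1]);
       (16, [:: 4; 5; 7; 6; 8; 0; 1]); (16, [:: 5; 4; 6; 7; 8; 0; 1]);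
       (16, [:: 5; 4; 7; 6; 8; 0; 1]); (25, [:: 6; 4; 5; 7; 8; 0; 1]);
       (25, [:: 7; 4; 5; 6; 8; 0; 1]); (16, [:: 4; 6; 7; 5; 8; 0; 1]);
       (16, [:: 6; 4; 5; 7; 8; 0; 1]); (25, [:: 5; 4; 6; 7; 8; 0; 1]);
       (16, [:: 6; 4; 7; 5; 8; 0; 1]); (25, [:: 7; 4; 6; 5; 8; 0; 1]);
       (25, [:: 4; 5; 6; 8; 7; 0; 1]); (16, [:: 5; 6; 7; 4; 8; 0; 1]);
       (16, [:: 6; 5; 7; 4; 8; 0; 1]); (25, [:: 7; 5; 6; 4; 8; 0; 1]);
       (37, [:: 4; 7; 0; 1; 5; 6; 3]); (37, [:: 5; 7; 0; 1; 4; 6; 3]);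
       (37, [:: 6; 7; 0; 1; 4; 5; 3]); (37, [:: 4; 7; 1; 0; 5; 6; 2]);
       (37, [:: 5; 7; 1; 0; 4; 6; 2]); (37, [:: 6; 7; 1; 0; 4; 5; 2]);
       (37, [:: 4; 7; 3; 1; 5; 6; 0]); (37, [:: 5; 7; 3; 1; 4; 6; 0]);
       (37, [:: 6; 7; 3; 1; 4; 5; 0]); (62, [:: 2; 0; 7; 8; 3; 4; 5; 6]);
       (62, [:: 1; 0; 7; 3; 8; 4; 5; 6]); (62, [:: 0; 1; 7; 2; 8; 4; 5; 6]);
       (53, [:: 0; 7; 4; 1; 3; 5; 6; 2]); (53, [:: 0; 7; 5; 1; 3; 4; 6; 2]);
       (53, [:: 0; 7; 6; 1; 3; 4; 5; 2]); (53, [:: 1; 7; 4; 0; 2; 5; 6; 3]);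
       (53, [:: 1; 7; 5; 0; 2; 4; 6; 3]); (53, [:: 1; 7; 6; 0; 2; 4; 5; 3]);
       (109, [:: 4; 5; 6; 0; 1; 2; 3; 7]); (62, [:: 1; 0; 2; 3; 7; 4; 5; 6]);
       (62, [:: 0; 1; 3; 2; 7; 4; 5; 6]); (84, [:: 0; 1; 7; 3; 2; 8; 4; 5; 6]);
       (84, [:: 0; 7; 1; 3; 2; 8; 4; 5; 6]); (84, [:: 0; 1; 2; 8; 7; 3; 4; 5; 6]);
       (84, [:: 0; 1; 7; 8; 2; 3; 4; 5; 6]); (84, [:: 1; 7; 0; 2; 3; 8; 4; 5; 6]);
       (82, [:: 4; 5; 6; 7; 8; 0; 1; 2; 3]); (82, [:: 4; 6; 5; 7; 8; 0; 1; 2; 3]);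
       (83, [:: 4; 7; 5; 6; 8; 0; 1; 2; 3]); (82, [:: 5; 6; 4; 7; 8; 0; 1; 2; 3]);
       (83, [:: 5; 7; 4; 6; 8; 0; 1; 2; 3]); (83, [:: 6; 7; 4; 5; 8; 0; 1; 2; 3]);
       (79, [:: 0; 1; 2; 3; 4; 5; 6; 7; 8])]);
  ([:: [::]; [:: 0]; [:: 0; 1]; [::]; [:: 3]; [::]; [:: 5]],
   [:: [:: 0; 1]; [:: 0; 2]; [:: 1; 2]; [:: 3; 4]; [:: 5; 6]],
   [:: (5, [:: 0; 1; 2; 7]); (6, [:: 7; 3; 4; 5; 6]); (11, [:: 7; 0; 1; 2; 5; 6]);
       (11, [:: 7; 0; 1; 2; 6; 5]); (11, [:: 7; 0; 2; 1; 5; 6]); (11, [:: 7; 0; 2; 1; 6; 5]);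
       (11, [:: 7; 1; 2; 0; 5; 6]); (11, [:: 7; 1; 2; 0; 6; 5]); (6, [:: 7; 0; 1; 5; 6]);
       (6, [:: 7; 0; 2; 5; 6]); (6, [:: 7; 1; 2; 5; 6]); (7, [:: 0; 7; 1; 2; 3; 4]);
       (7, [:: 0; 7; 1; 2; 5; 6]); (7, [:: 1; 7; 0; 2; 3; 4]); (7, [:: 1; 7; 0; 2; 5; 6]);
       (7, [:: 2; 7; 0; 1; 3; 4]); (7, [:: 2; 7; 0; 1; 5; 6]); (8, [:: 0; 1; 2; 3; 4; 7]);
       (8, [:: 0; 1; 2; 5; 6; 7]); (24, [:: 7; 0; 1; 2; 8; 5; 6]); (24, [:: 7; 0; 2; 1; 8; 5; 6]);
       (24, [:: 7; 1; 2; 0; 8; 5; 6]); (24, [:: 7; 0; 1; 2; 8; 3; 4]);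
       (24, [:: 7; 0; 2; 1; 8; 3; 4]); (24, [:: 7; 1; 2; 0; 8; 3; 4]);
       (24, [:: 7; 0; 1; 2; 3; 5; 6]); (24, [:: 7; 0; 2; 1; 3; 5; 6]);
       (24, [:: 7; 1; 2; 0; 3; 5; 6]); (5, [:: 0; 1; 7; 8]); (5, [:: 0; 2; 7; 8]);
       (5, [:: 1; 2; 7; 8]); (6, [:: 0; 1; 2; 7; 8]); (6, [:: 1; 0; 2; 7; 8]);
       (6, [:: 2; 0; 1; 7; 8]); (8, [:: 0; 1; 2; 3; 7; 8]); (8, [:: 0; 1; 2; 4; 7; 8]);
       (8, [:: 0; 1; 2; 5; 7; 8]); (8, [:: 0; 1; 2; 6; 7; 8]); (11, [:: 7; 0; 1; 2; 4; 3]);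
       (11, [:: 7; 0; 2; 1; 4; 3]); (11, [:: 7; 1; 2; 0; 4; 3]); (15, [:: 0; 1; 2; 7; 8; 3; 4]);
       (15, [:: 0; 1; 7; 2; 8; 3; 4]); (15, [:: 1; 0; 2; 7; 8; 3; 4]);
       (15, [:: 1; 0; 7; 2; 8; 3; 4]); (24, [:: 2; 0; 1; 7; 8; 3; 4]);
       (15, [:: 0; 2; 7; 1; 8; 3; 4]); (15, [:: 2; 0; 1; 7; 8; 3; 4]);
       (24, [:: 1; 0; 2; 7; 8; 3; 4]); (15, [:: 2; 0; 7; 1; 8; 3; 4]);
       (24, [:: 0; 1; 2; 8; 7; 3; 4]); (36, [:: 0; 7; 8; 3; 1; 2; 4]);
       (36, [:: 0; 7; 8; 4; 1; 2; 3]); (36, [:: 0; 7; 8; 5; 1; 2; 6]);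
       (36, [:: 0; 7; 8; 6; 1; 2; 5]); (15, [:: 1; 2; 7; 0; 8; 3; 4]);
       (15, [:: 2; 1; 7; 0; 8; 3; 4]); (36, [:: 1; 7; 8; 3; 0; 2; 4]);
       (36, [:: 1; 7; 8; 4; 0; 2; 3]); (36, [:: 1; 7; 8; 5; 0; 2; 6]);
       (36, [:: 1; 7; 8; 6; 0; 2; 5]); (36, [:: 2; 7; 8; 3; 0; 1; 4]);
       (36, [:: 2; 7; 8; 4; 0; 1; 3]); (36, [:: 2; 7; 8; 5; 0; 1; 6]);
       (36, [:: 2; 7; 8; 6; 0; 1; 5]); (61, [:: 3; 7; 8; 4; 5; 0; 1; 2]);
       (61, [:: 3; 7; 8; 4; 6; 0; 1; 2]); (61, [:: 4; 7; 8; 3; 5; 0; 1; 2]);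
       (61, [:: 4; 7; 8; 3; 6; 0; 1; 2]); (54, [:: 7; 0; 3; 5; 1; 2; 4; 6]);
       (54, [:: 7; 0; 3; 6; 1; 2; 4; 5]); (57, [:: 0; 7; 3; 1; 2; 4; 5; 6]);
       (54, [:: 7; 0; 4; 5; 1; 2; 3; 6]); (54, [:: 7; 0; 4; 6; 1; 2; 3; 5]);
       (57, [:: 0; 7; 4; 1; 2; 3; 5; 6]); (57, [:: 0; 7; 5; 1; 2; 6; 3; 4]);
       (57, [:: 0; 7; 6; 1; 2; 5; 3; 4]); (54, [:: 7; 1; 3; 5; 0; 2; 4; 6]);
       (54, [:: 7; 1; 3; 6; 0; 2; 4; 5]); (57, [:: 1; 7; 3; 0; 2; 4; 5; 6]);
       (54, [:: 7; 1; 4; 5; 0; 2; 3; 6]); (54, [:: 7; 1; 4; 6; 0; 2; 3; 5]);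
       (57, [:: 1; 7; 4; 0; 2; 3; 5; 6]); (57, [:: 1; 7; 5; 0; 2; 6; 3; 4]);
       (57, [:: 1; 7; 6; 0; 2; 5; 3; 4]); (54, [:: 7; 2; 3; 5; 0; 1; 4; 6]);
       (54, [:: 7; 2; 3; 6; 0; 1; 4; 5]); (57, [:: 2; 7; 3; 0; 1; 4; 5; 6]);
       (54, [:: 7; 2; 4; 5; 0; 1; 3; 6]); (54, [:: 7; 2; 4; 6; 0; 1; 3; 5]);
       (57, [:: 2; 7; 4; 0; 1; 3; 5; 6]); (57, [:: 2; 7; 5; 0; 1; 6; 3; 4]);
       (57, [:: 2; 7; 6; 0; 1; 5; 3; 4]); (61, [:: 3; 7; 5; 4; 6; 0; 1; 2]);
       (61, [:: 3; 7; 6; 4; 5; 0; 1; 2]); (61, [:: 4; 7; 5; 3; 6; 0; 1; 2]);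
       (61, [:: 4; 7; 6; 3; 5; 0; 1; 2]); (79, [:: 0; 1; 2; 7; 8; 3; 4; 5; 6]);
       (79, [:: 0; 2; 1; 7; 8; 3; 4; 5; 6]); (77, [:: 0; 7; 1; 2; 8; 3; 4; 5; 6]);
       (79, [:: 1; 2; 0; 7; 8; 3; 4; 5; 6]); (77, [:: 1; 7; 0; 2; 8; 3; 4; 5; 6]);
       (77, [:: 2; 7; 0; 1; 8; 3; 4; 5; 6]); (78, [:: 3; 4; 7; 8; 0; 1; 2; 5; 6]);
       (78, [:: 3; 7; 4; 8; 0; 1; 2; 5; 6]); (78, [:: 4; 7; 3; 8; 0; 1; 2; 5; 6]);
       (78, [:: 5; 6; 7; 8; 0; 1; 2; 3; 4]); (78, [:: 5; 7; 6; 8; 0; 1; 2; 3; 4]);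
       (78, [:: 6; 7; 5; 8; 0; 1; 2; 3; 4]); (80, [:: 0; 1; 2; 3; 4; 5; 6; 7; 8])]);
  ([:: [::]; [:: 0]; [:: 0]; [:: 1; 2]; [:: 2; 3]; [:: 0]; [:: 1]],
   [:: [:: 0; 1; 2; 5]; [:: 0; 1; 3; 6]; [:: 0; 2; 4]; [:: 0; 1; 2; 3]; [:: 1; 3; 4]],
   [:: (4, [:: 2; 3; 4; 7]); (5, [:: 2; 0; 7; 3; 4]); (5, [:: 3; 1; 7; 2; 4]);
       (5, [:: 7; 0; 5; 3; 4]); (5, [:: 7; 1; 6; 2; 4]); (9, [:: 7; 2; 3; 4; 0; 6]);
       (89, [:: 3; 1; 7; 2; 4; 6]); (6, [:: 0; 2; 5; 7; 3; 4]); (83, [:: 0; 7; 5; 1; 3; 4]);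
       (83, [:: 1; 7; 6; 0; 2; 4]); (5, [:: 3; 2; 4; 7; 8]); (5, [:: 2; 3; 4; 7; 8]);
       (8, [:: 0; 1; 7; 5; 6; 4]); (6, [:: 1; 3; 6; 7; 2; 4]); (91, [:: 3; 2; 4; 7; 1; 6]);
       (10, [:: 3; 2; 4; 7; 1; 6]); (83, [:: 3; 4; 2; 1; 6; 7]); (91, [:: 2; 3; 4; 7; 0; 5]);
       (10, [:: 2; 3; 4; 7; 0; 5]); (89, [:: 7; 0; 8; 3; 4; 5]); (89, [:: 7; 1; 8; 2; 4; 6]);
       (84, [:: 3; 7; 2; 1; 4; 6]); (83, [:: 2; 3; 4; 7; 6; 1]); (83, [:: 2; 3; 4; 0; 5; 7]);
       (83, [:: 2; 4; 3; 0; 5; 7]); (18, [:: 3; 7; 4; 2; 1; 6; 8]);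
       (19, [:: 3; 1; 2; 4; 8; 7; 6]); (30, [:: 0; 2; 3; 7; 4; 8; 5]);
       (19, [:: 2; 0; 3; 4; 7; 8; 5]); (32, [:: 2; 0; 3; 7; 4; 5; 8]);
       (13, [:: 2; 3; 8; 7; 0; 4; 5]); (18, [:: 2; 7; 4; 3; 0; 5; 8]);
       (30, [:: 1; 3; 2; 7; 4; 8; 6]); (13, [:: 3; 2; 8; 7; 1; 4; 6]);
       (16, [:: 7; 1; 3; 2; 4; 6; 5]); (16, [:: 7; 0; 2; 3; 4; 5; 6]);
       (13, [:: 3; 2; 7; 0; 1; 4; 6]); (21, [:: 2; 3; 7; 4; 1; 6; 0]); (4, [:: 3; 4; 7; 8]);
       (4, [:: 2; 4; 7; 8]); (4, [:: 2; 3; 7; 8]); (6, [:: 0; 2; 7; 8; 3; 4]);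
       (6, [:: 1; 3; 7; 8; 2; 4]); (9, [:: 1; 7; 0; 5; 6; 3]); (13, [:: 2; 4; 3; 7; 0; 8; 5]);
       (16, [:: 7; 0; 2; 3; 4; 5; 8]); (13, [:: 2; 3; 4; 7; 0; 8; 5]);
       (32, [:: 3; 1; 2; 8; 4; 6; 7]); (16, [:: 8; 1; 3; 2; 4; 6; 7]);
       (34, [:: 0; 1; 2; 3; 4; 7; 8]); (18, [:: 3; 8; 2; 4; 1; 6; 7]);
       (13, [:: 3; 2; 4; 7; 1; 8; 6]); (18, [:: 2; 8; 3; 4; 0; 5; 7]);
       (18, [:: 2; 7; 3; 4; 0; 5; 8]); (17, [:: 1; 7; 0; 5; 3; 4; 6]);
       (30, [:: 7; 2; 3; 1; 4; 6; 5]); (17, [:: 0; 7; 1; 6; 2; 4; 5]);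
       (30, [:: 7; 3; 2; 0; 4; 5; 6]); (30, [:: 1; 3; 2; 0; 4; 7; 6]);
       (18, [:: 3; 7; 2; 4; 1; 6; 5]); (31, [:: 2; 3; 4; 7; 1; 5; 6]);
       (26, [:: 1; 0; 3; 2; 4; 7; 6]); (34, [:: 0; 1; 2; 3; 4; 7; 6]);
       (35, [:: 3; 1; 6; 7; 2; 4; 5]); (31, [:: 2; 3; 4; 0; 7; 5; 6]);
       (26, [:: 0; 1; 2; 3; 4; 7; 5]); (34, [:: 0; 1; 2; 3; 4; 5; 7]);
       (29, [:: 1; 3; 4; 2; 0; 6; 7]); (55, [:: 1; 0; 3; 2; 4; 7; 8; 6]);
       (55, [:: 0; 1; 2; 3; 4; 7; 8; 5]); (41, [:: 0; 1; 3; 7; 2; 5; 4; 6]);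
       (41, [:: 1; 0; 2; 7; 3; 6; 4; 5]); (45, [:: 2; 0; 1; 3; 4; 6; 5; 7]);
       (45, [:: 3; 1; 0; 2; 4; 5; 6; 7]); (55, [:: 1; 0; 3; 2; 4; 5; 7; 6]);
       (55, [:: 0; 1; 2; 3; 4; 6; 7; 5]); (73, [:: 1; 0; 3; 7; 2; 6; 4; 8; 5]);
       (73, [:: 7; 0; 3; 1; 2; 6; 4; 8; 5]); (69, [:: 0; 1; 2; 3; 7; 8; 4; 5; 6]);
       (73, [:: 1; 0; 3; 7; 2; 8; 4; 6; 5]); (65, [:: 0; 1; 3; 7; 2; 4; 6; 8; 5]);
       (73, [:: 0; 1; 2; 8; 3; 5; 4; 7; 6]); (73, [:: 0; 1; 2; 8; 3; 7; 4; 5; 6]);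
       (73, [:: 7; 1; 2; 0; 3; 5; 4; 8; 6]); (65, [:: 1; 0; 2; 7; 3; 4; 5; 8; 6]);
       (75, [:: 0; 1; 2; 3; 4; 5; 6; 7; 8])]);
  ([:: [::]; [:: 0]; [:: 1]; [:: 0; 2]; [:: 0]; [:: 0; 4]; [:: 1]],
   [:: [:: 0; 1; 3; 4]; [:: 0; 1; 3; 5]; [:: 0; 1; 2; 6]; [:: 0; 1; 2; 3]; [:: 4; 5]],
   [:: (3, [:: 0; 4; 5; 7]); (4, [:: 0; 1; 7; 4; 5]); (4, [:: 0; 4; 5; 7; 8]);
       (4, [:: 7; 1; 2; 4; 5]); (4, [:: 0; 3; 7; 4; 5]); (8, [:: 7; 0; 4; 5; 3; 6]);
       (88, [:: 0; 1; 7; 4; 5; 6]); (8, [:: 7; 0; 5; 4; 3; 6]); (88, [:: 0; 1; 7; 5; 4; 6]);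
       (5, [:: 0; 1; 4; 5; 2; 7]); (82, [:: 0; 4; 5; 3; 2; 7]); (82, [:: 0; 5; 4; 3; 2; 7]);
       (9, [:: 0; 4; 5; 7; 3; 2]); (90, [:: 0; 4; 5; 7; 1; 2]); (21, [:: 1; 7; 8; 3; 2; 6; 4]);
       (5, [:: 0; 1; 4; 5; 7; 8]); (82, [:: 0; 4; 5; 1; 6; 7]); (82, [:: 0; 5; 4; 1; 6; 7]);
       (99, [:: 1; 7; 8; 3; 2; 4; 6]); (88, [:: 0; 7; 8; 4; 5; 2]); (88, [:: 0; 7; 8; 5; 4; 2]);
       (9, [:: 0; 4; 5; 8; 7; 2]); (83, [:: 0; 7; 4; 1; 5; 6]); (83, [:: 0; 7; 5; 1; 4; 6]);
       (5, [:: 0; 1; 4; 5; 6; 7]); (5, [:: 0; 3; 4; 5; 2; 7]); (9, [:: 0; 4; 5; 7; 1; 2]);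
       (31, [:: 0; 1; 4; 8; 5; 2; 7]); (31, [:: 0; 1; 5; 8; 4; 2; 7]);
       (18, [:: 0; 1; 7; 4; 8; 5; 2]); (18, [:: 0; 1; 7; 5; 8; 4; 2]);
       (15, [:: 7; 3; 0; 4; 5; 2; 8]); (15, [:: 1; 0; 3; 7; 8; 4; 6]);
       (14, [:: 0; 4; 7; 5; 3; 1; 6]); (14, [:: 0; 5; 7; 4; 3; 1; 6]);
       (29, [:: 1; 0; 4; 7; 5; 6; 2]); (29, [:: 1; 0; 5; 7; 4; 6; 2]); (3, [:: 0; 4; 7; 8]);
       (3, [:: 0; 5; 7; 8]); (4, [:: 7; 1; 6; 4; 5]); (82, [:: 0; 4; 5; 1; 2; 7]);
       (82, [:: 0; 5; 4; 1; 2; 7]); (15, [:: 0; 1; 8; 4; 5; 6; 7]);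
       (14, [:: 0; 4; 5; 7; 8; 1; 2]); (14, [:: 0; 4; 7; 5; 8; 1; 2]);
       (12, [:: 0; 4; 5; 8; 1; 7; 2]); (12, [:: 0; 4; 7; 8; 1; 5; 2]);
       (18, [:: 0; 1; 5; 4; 8; 7; 2]); (17, [:: 0; 7; 4; 5; 3; 2; 8]);
       (14, [:: 0; 5; 7; 4; 8; 1; 2]); (12, [:: 0; 5; 4; 8; 1; 7; 2]);
       (18, [:: 0; 1; 4; 5; 8; 7; 2]); (12, [:: 0; 5; 7; 8; 1; 4; 2]);
       (17, [:: 0; 7; 5; 4; 3; 2; 8]); (29, [:: 1; 0; 4; 7; 5; 8; 2]);
       (29, [:: 1; 0; 5; 7; 4; 8; 2]); (14, [:: 7; 1; 2; 6; 3; 4; 5]);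
       (17, [:: 7; 1; 2; 3; 4; 5; 6]); (14, [:: 7; 1; 2; 6; 3; 5; 4]);
       (17, [:: 7; 1; 2; 3; 5; 4; 6]); (16, [:: 7; 0; 4; 5; 2; 3; 6]);
       (16, [:: 7; 0; 5; 4; 2; 3; 6]); (17, [:: 0; 7; 4; 5; 3; 2; 6]);
       (17, [:: 0; 7; 5; 4; 3; 2; 6]); (18, [:: 0; 1; 7; 4; 2; 5; 6]);
       (18, [:: 0; 1; 7; 5; 2; 4; 6]); (34, [:: 0; 3; 2; 7; 4; 5; 6]);
       (31, [:: 0; 1; 4; 7; 5; 2; 3]); (31, [:: 0; 1; 5; 7; 4; 2; 3]);
       (104, [:: 0; 1; 6; 7; 3; 4; 5]); (31, [:: 0; 3; 4; 7; 5; 2; 1]);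
       (31, [:: 0; 3; 5; 7; 4; 2; 1]); (57, [:: 0; 3; 7; 2; 4; 5; 8; 6]);
       (57, [:: 0; 1; 7; 2; 4; 5; 6; 8]); (58, [:: 0; 1; 2; 3; 8; 7; 4; 5]);
       (35, [:: 1; 0; 7; 3; 8; 4; 5; 6]); (49, [:: 0; 1; 7; 3; 4; 5; 8; 6]);
       (56, [:: 0; 1; 7; 2; 3; 4; 5; 8]); (58, [:: 0; 1; 2; 3; 6; 7; 4; 5]);
       (49, [:: 0; 1; 2; 3; 4; 5; 7; 6]); (57, [:: 0; 1; 3; 2; 4; 5; 6; 7]);
       (48, [:: 0; 1; 4; 5; 2; 3; 6; 7]); (48, [:: 0; 1; 5; 4; 2; 3; 6; 7]);
       (56, [:: 0; 1; 6; 2; 3; 4; 5; 7]); (71, [:: 0; 1; 2; 7; 6; 3; 4; 5; 8]);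
       (71, [:: 0; 7; 2; 1; 6; 3; 4; 5; 8]); (71, [:: 0; 1; 2; 3; 8; 7; 4; 5; 6]);
       (71, [:: 0; 1; 2; 7; 8; 3; 4; 5; 6]); (70, [:: 0; 1; 3; 8; 4; 2; 5; 6; 7]);
       (70, [:: 0; 1; 3; 8; 5; 2; 4; 6; 7]); (71, [:: 0; 1; 8; 3; 2; 7; 4; 5; 6]);
       (63, [:: 0; 1; 7; 2; 3; 4; 5; 8; 6]); (72, [:: 1; 7; 0; 3; 4; 2; 5; 6; 8]);
       (72, [:: 1; 7; 0; 3; 5; 2; 4; 6; 8]); (73, [:: 0; 1; 2; 3; 4; 5; 6; 7; 8])]);
  ([:: [::]; [:: 0]; [:: 0]; [:: 1; 2]; [:: 0; 2]; [:: 1]; [:: 0]],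
   [:: [:: 0; 1; 2; 6]; [:: 0; 1; 4; 6]; [:: 0; 1; 3; 5]; [:: 2; 3; 4]; [:: 0; 1; 2; 3]],
   [:: (2, [:: 0; 2; 4; 7]); (3, [:: 0; 1; 7; 2; 4]); (3, [:: 2; 0; 4; 3; 7]);
       (3, [:: 0; 2; 4; 7; 8]); (3, [:: 7; 1; 5; 2; 4]); (3, [:: 0; 2; 4; 6; 7]);
       (7, [:: 7; 0; 2; 4; 6; 5]); (7, [:: 0; 2; 7; 3; 4; 6]); (7, [:: 7; 0; 4; 2; 6; 5]);
       (87, [:: 0; 1; 7; 4; 2; 5]); (4, [:: 0; 1; 2; 4; 5; 7]); (6, [:: 0; 2; 4; 6; 3; 7]);
       (83, [:: 2; 0; 4; 7; 3; 1]); (3, [:: 2; 0; 4; 7; 8]); (87, [:: 0; 1; 7; 2; 4; 5]);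
       (81, [:: 0; 2; 4; 6; 7; 3]); (81, [:: 0; 4; 2; 1; 5; 7]); (6, [:: 0; 2; 7; 6; 3; 8]);
       (7, [:: 0; 7; 8; 3; 4; 6]); (87, [:: 7; 1; 8; 2; 4; 5]); (7, [:: 0; 7; 1; 5; 4; 6]);
       (87, [:: 7; 1; 3; 2; 4; 5]); (6, [:: 0; 2; 7; 6; 3; 5]); (81, [:: 2; 7; 4; 3; 1; 5]);
       (8, [:: 0; 2; 4; 7; 1; 5]); (81, [:: 0; 2; 4; 1; 5; 7]); (10, [:: 0; 2; 7; 8; 3; 4; 6]);
       (11, [:: 0; 2; 7; 8; 1; 4; 5]); (17, [:: 0; 1; 2; 4; 8; 7; 5]);
       (20, [:: 7; 0; 4; 2; 3; 8; 6]); (97, [:: 0; 2; 4; 8; 6; 7; 3]);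
       (9, [:: 0; 2; 4; 6; 8; 7; 3]); (20, [:: 7; 2; 4; 0; 6; 8; 3]);
       (28, [:: 1; 0; 2; 7; 4; 8; 5]); (13, [:: 0; 2; 7; 4; 6; 1; 5]);
       (13, [:: 0; 4; 7; 2; 6; 1; 5]); (23, [:: 0; 1; 7; 4; 2; 3; 6]);
       (24, [:: 1; 3; 0; 2; 4; 7; 5]); (2, [:: 0; 2; 7; 8]); (2, [:: 0; 4; 7; 8]);
       (2, [:: 2; 4; 7; 8]); (7, [:: 2; 0; 7; 8; 4; 3]); (4, [:: 0; 1; 2; 4; 7; 8]);
       (6, [:: 1; 3; 7; 5; 2; 6]); (88, [:: 2; 0; 4; 7; 3; 5]); (10, [:: 0; 2; 4; 8; 3; 7; 6]);
       (10, [:: 2; 0; 4; 8; 6; 7; 3]); (13, [:: 0; 4; 7; 2; 8; 1; 5]);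
       (11, [:: 0; 4; 2; 8; 1; 7; 5]); (30, [:: 0; 1; 2; 8; 4; 5; 7]);
       (14, [:: 0; 1; 8; 2; 4; 5; 7]); (30, [:: 0; 1; 2; 3; 4; 8; 7]);
       (20, [:: 7; 0; 4; 2; 3; 5; 6]); (17, [:: 0; 1; 2; 4; 3; 7; 5]);
       (30, [:: 0; 1; 2; 3; 4; 5; 7]); (14, [:: 0; 1; 7; 2; 4; 5; 6]);
       (28, [:: 0; 1; 7; 2; 5; 4; 6]); (19, [:: 7; 1; 3; 5; 0; 2; 6]);
       (17, [:: 1; 0; 3; 7; 2; 5; 6]); (28, [:: 0; 1; 3; 2; 7; 4; 6]);
       (31, [:: 0; 2; 4; 3; 7; 5; 6]); (30, [:: 0; 1; 2; 3; 4; 7; 6]);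
       (31, [:: 2; 0; 4; 6; 7; 5; 3]); (9, [:: 0; 2; 4; 1; 3; 6; 7]);
       (26, [:: 0; 2; 4; 3; 1; 7; 6]); (45, [:: 0; 1; 2; 3; 4; 7; 8; 5]);
       (43, [:: 0; 1; 7; 2; 4; 8; 5; 6]); (50, [:: 0; 1; 2; 3; 4; 7; 8; 6]);
       (40, [:: 0; 2; 4; 7; 1; 6; 3; 5]); (104, [:: 0; 1; 2; 4; 3; 7; 6; 5]);
       (46, [:: 2; 0; 4; 1; 3; 5; 7; 6]); (43, [:: 0; 1; 3; 2; 4; 7; 5; 6]);
       (50, [:: 0; 1; 2; 3; 4; 5; 7; 6]); (45, [:: 0; 1; 2; 3; 4; 6; 7; 5]);
       (69, [:: 0; 1; 7; 3; 2; 5; 4; 8; 6]); (69, [:: 0; 7; 1; 3; 2; 5; 4; 8; 6]);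
       (61, [:: 0; 1; 2; 3; 7; 8; 4; 5; 6]); (69, [:: 0; 1; 7; 3; 2; 8; 4; 5; 6]);
       (65, [:: 0; 1; 7; 3; 2; 4; 5; 8; 6]); (61, [:: 0; 1; 2; 8; 6; 3; 4; 5; 7]);
       (61, [:: 0; 1; 2; 8; 7; 3; 4; 5; 6]); (67, [:: 1; 7; 0; 2; 3; 6; 4; 5; 8]);
       (68, [:: 0; 1; 2; 3; 4; 5; 6; 7; 8])]);
  ([:: [::]; [:: 0]; [:: 0]; [:: 0]; [:: 0; 3]; [:: 1]; [:: 2]],
   [:: [:: 0; 1; 2; 3]; [:: 0; 1; 2; 4]; [:: 0; 1; 5]; [:: 0; 2; 6]; [:: 3; 4]],
   [:: (1, [:: 0; 3; 4; 7]); (2, [:: 0; 1; 7; 3; 4]); (2, [:: 0; 3; 4; 7; 8]);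
       (2, [:: 7; 1; 5; 2; 6]); (87, [:: 1; 7; 8; 2; 5; 6]); (2, [:: 0; 2; 7; 3; 4]);
       (86, [:: 0; 2; 7; 3; 4; 6]); (86, [:: 0; 2; 7; 4; 3; 6]); (80, [:: 1; 7; 5; 0; 2; 6]);
       (7, [:: 0; 3; 4; 7; 2; 6]); (80, [:: 2; 7; 6; 0; 1; 5]); (6, [:: 7; 0; 3; 4; 1; 6]);
       (6, [:: 7; 0; 4; 3; 1; 6]); (88, [:: 0; 3; 4; 7; 2; 6]); (80, [:: 0; 3; 4; 2; 6; 7]);
       (80, [:: 0; 4; 3; 2; 6; 7]); (2, [:: 7; 2; 6; 3; 4]); (81, [:: 0; 7; 3; 2; 4; 6]);
       (81, [:: 0; 7; 4; 2; 3; 6]); (7, [:: 0; 1; 7; 5; 2; 6]); (3, [:: 0; 1; 3; 4; 5; 7]);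
       (3, [:: 0; 2; 3; 4; 6; 7]); (80, [:: 0; 3; 4; 1; 5; 7]); (80, [:: 0; 4; 3; 1; 5; 7]);
       (12, [:: 0; 3; 7; 4; 8; 2; 6]); (15, [:: 0; 7; 3; 4; 2; 6; 8]);
       (12, [:: 0; 4; 7; 3; 8; 2; 6]); (15, [:: 0; 7; 4; 3; 2; 6; 8]);
       (13, [:: 0; 2; 8; 3; 4; 6; 7]); (13, [:: 7; 2; 0; 3; 4; 6; 8]);
       (13, [:: 7; 2; 0; 3; 4; 6; 5]); (1, [:: 0; 3; 7; 8]); (1, [:: 0; 4; 7; 8]);
       (2, [:: 7; 2; 8; 3; 4]); (86, [:: 0; 8; 7; 3; 4; 6]); (86, [:: 0; 8; 7; 4; 3; 6]);
       (7, [:: 0; 3; 4; 8; 7; 6]); (3, [:: 0; 1; 3; 4; 7; 8]); (3, [:: 0; 2; 3; 4; 7; 8]);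
       (86, [:: 0; 1; 7; 3; 4; 5]); (86, [:: 0; 1; 7; 4; 3; 5]); (7, [:: 0; 3; 4; 7; 1; 5]);
       (12, [:: 0; 3; 4; 7; 8; 1; 5]); (10, [:: 0; 3; 4; 8; 1; 7; 5]);
       (10, [:: 0; 3; 7; 8; 1; 4; 5]); (16, [:: 0; 1; 4; 3; 8; 7; 5]);
       (15, [:: 0; 7; 3; 4; 1; 5; 8]); (10, [:: 0; 4; 3; 8; 1; 7; 5]);
       (16, [:: 0; 1; 3; 4; 8; 7; 5]); (10, [:: 0; 4; 7; 8; 1; 3; 5]);
       (15, [:: 0; 7; 4; 3; 1; 5; 8]); (29, [:: 0; 1; 3; 8; 4; 5; 7]);
       (29, [:: 0; 1; 4; 8; 3; 5; 7]); (29, [:: 0; 2; 3; 8; 4; 6; 7]);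
       (29, [:: 0; 2; 4; 8; 3; 6; 7]); (27, [:: 1; 0; 3; 7; 4; 8; 5]);
       (27, [:: 2; 0; 3; 7; 4; 8; 6]); (27, [:: 1; 0; 4; 7; 3; 8; 5]);
       (27, [:: 2; 0; 4; 7; 3; 8; 6]); (102, [:: 0; 1; 7; 8; 2; 3; 4]);
       (14, [:: 7; 0; 3; 4; 6; 2; 5]); (15, [:: 0; 7; 3; 4; 2; 6; 5]);
       (14, [:: 7; 0; 4; 3; 6; 2; 5]); (15, [:: 0; 7; 4; 3; 2; 6; 5]);
       (15, [:: 0; 7; 3; 4; 1; 5; 6]); (15, [:: 0; 7; 4; 3; 1; 5; 6]);
       (27, [:: 0; 1; 7; 3; 5; 4; 2]); (27, [:: 0; 1; 7; 4; 5; 3; 2]);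
       (32, [:: 0; 2; 6; 7; 3; 4; 5]); (102, [:: 0; 1; 7; 6; 2; 3; 4]);
       (27, [:: 0; 2; 7; 3; 6; 4; 1]); (27, [:: 0; 2; 7; 4; 6; 3; 1]);
       (102, [:: 0; 1; 5; 7; 2; 3; 4]); (55, [:: 0; 2; 7; 8; 3; 4; 6; 5]);
       (55, [:: 0; 1; 7; 8; 3; 4; 5; 6]); (33, [:: 1; 0; 7; 2; 8; 3; 4; 5]);
       (51, [:: 0; 2; 1; 7; 3; 4; 8; 6]); (51, [:: 0; 1; 2; 7; 3; 4; 8; 5]);
       (56, [:: 0; 7; 5; 1; 6; 2; 3; 4]); (38, [:: 0; 2; 7; 3; 1; 4; 5; 6]);
       (38, [:: 0; 1; 7; 3; 2; 4; 6; 5]); (38, [:: 0; 2; 7; 4; 1; 3; 5; 6]);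
       (38, [:: 0; 1; 7; 4; 2; 3; 6; 5]); (55, [:: 0; 1; 2; 7; 3; 4; 5; 6]);
       (44, [:: 0; 1; 3; 7; 4; 2; 6; 5]); (44, [:: 0; 1; 4; 7; 3; 2; 6; 5]);
       (44, [:: 0; 2; 3; 7; 4; 1; 5; 6]); (44, [:: 0; 2; 4; 7; 3; 1; 5; 6]);
       (40, [:: 0; 3; 4; 1; 2; 5; 6; 7]); (40, [:: 0; 4; 3; 1; 2; 5; 6; 7]);
       (51, [:: 0; 2; 1; 5; 3; 4; 7; 6]); (51, [:: 0; 1; 2; 6; 3; 4; 7; 5]);
       (61, [:: 0; 1; 2; 5; 7; 3; 4; 6; 8]); (61, [:: 0; 7; 2; 5; 1; 3; 4; 6; 8]);
       (61, [:: 0; 2; 1; 6; 7; 3; 4; 5; 8]); (61, [:: 0; 7; 1; 6; 2; 3; 4; 5; 8]);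
       (64, [:: 0; 1; 2; 8; 3; 4; 5; 6; 7]); (64, [:: 0; 1; 2; 8; 4; 3; 5; 6; 7]);
       (61, [:: 0; 1; 2; 8; 7; 3; 4; 6; 5]); (61, [:: 0; 2; 1; 8; 7; 3; 4; 5; 6]);
       (63, [:: 0; 1; 2; 7; 3; 4; 5; 6; 8]); (62, [:: 7; 1; 0; 2; 3; 4; 5; 6; 8]);
       (62, [:: 7; 1; 0; 2; 4; 3; 5; 6; 8]); (65, [:: 0; 1; 2; 3; 4; 5; 6; 7; 8])]);
  ([:: [::]; [:: 0]; [:: 0; 1]; [:: 0]; [:: 1; 3]; [:: 0]; [:: 1]],
   [:: [:: 0; 1; 3; 5]; [:: 0; 2; 3; 5]; [:: 0; 1; 4; 6]; [:: 1; 2; 4; 6]; [:: 0; 1; 3; 4]],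
   [:: (0, [:: 0; 1; 2; 7]); (1, [:: 0; 1; 2; 3; 7]); (1, [:: 1; 0; 2; 4; 7]);
       (1, [:: 0; 1; 2; 7; 8]); (1, [:: 1; 0; 2; 7; 8]); (1, [:: 0; 1; 2; 5; 7]);
       (1, [:: 1; 0; 2; 6; 7]); (82, [:: 0; 1; 7; 2; 3; 6]); (5, [:: 1; 0; 7; 3; 2; 6]);
       (5, [:: 0; 1; 7; 6; 2; 3]); (85, [:: 0; 1; 2; 7; 3; 6]); (85, [:: 1; 0; 2; 7; 4; 5]);
       (4, [:: 0; 1; 2; 5; 6; 7]); (79, [:: 0; 1; 2; 3; 7; 6]); (85, [:: 0; 1; 2; 7; 5; 4]);
       (85, [:: 1; 0; 2; 7; 6; 3]); (79, [:: 0; 1; 2; 5; 7; 4]); (5, [:: 1; 0; 7; 8; 2; 6]);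
       (5, [:: 0; 1; 7; 8; 2; 5]); (5, [:: 0; 7; 8; 4; 2; 5]); (5, [:: 1; 7; 8; 3; 2; 6]);
       (4, [:: 1; 4; 7; 6; 3; 5]); (4, [:: 0; 1; 2; 5; 4; 7]); (4, [:: 0; 1; 2; 3; 6; 7]);
       (95, [:: 1; 0; 2; 7; 6; 8; 3]); (95, [:: 0; 1; 2; 8; 5; 7; 4]);
       (7, [:: 0; 1; 2; 3; 8; 7; 6]); (8, [:: 0; 7; 2; 1; 6; 3; 5]);
       (20, [:: 1; 0; 2; 7; 5; 6; 4]); (21, [:: 1; 4; 7; 2; 0; 3; 6]); (0, [:: 0; 1; 7; 8]);
       (0, [:: 0; 2; 7; 8]); (0, [:: 1; 2; 7; 8]); (4, [:: 0; 1; 7; 3; 6; 8]);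
       (5, [:: 1; 7; 4; 3; 2; 6]); (5, [:: 1; 0; 7; 5; 2; 6]); (5, [:: 0; 1; 7; 4; 2; 5]);
       (85, [:: 0; 1; 2; 7; 5; 6]); (85, [:: 1; 0; 2; 7; 6; 5]); (79, [:: 0; 1; 2; 5; 7; 6]);
       (8, [:: 0; 1; 2; 8; 4; 7; 5]); (8, [:: 0; 1; 7; 8; 4; 2; 5]);
       (8, [:: 1; 0; 2; 8; 3; 7; 6]); (8, [:: 1; 0; 7; 8; 3; 2; 6]);
       (8, [:: 0; 7; 2; 1; 6; 8; 3]); (20, [:: 7; 2; 0; 3; 8; 4; 6]);
       (18, [:: 1; 0; 2; 7; 4; 8; 5]); (18, [:: 7; 0; 2; 1; 4; 8; 5]);
       (7, [:: 0; 1; 2; 5; 8; 7; 4]); (18, [:: 0; 1; 2; 8; 3; 7; 6]);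
       (7, [:: 0; 1; 2; 3; 4; 7; 8]); (8, [:: 1; 7; 2; 0; 5; 8; 4]);
       (18, [:: 7; 1; 2; 0; 3; 8; 6]); (92, [:: 0; 7; 2; 1; 4; 3; 5]);
       (18, [:: 1; 0; 2; 7; 4; 6; 5]); (18, [:: 1; 0; 2; 7; 6; 4; 5]);
       (8, [:: 0; 7; 2; 1; 6; 5; 3]); (13, [:: 1; 0; 2; 7; 4; 3; 6]);
       (7, [:: 0; 1; 2; 3; 4; 7; 6]); (92, [:: 1; 7; 2; 0; 3; 4; 6]);
       (18, [:: 0; 1; 2; 7; 3; 5; 6]); (8, [:: 1; 7; 2; 0; 5; 6; 4]);
       (18, [:: 0; 1; 2; 7; 5; 3; 6]); (13, [:: 0; 1; 2; 7; 3; 4; 5]);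
       (7, [:: 0; 1; 2; 3; 4; 5; 7]); (98, [:: 7; 3; 4; 0; 1; 5; 6]);
       (20, [:: 1; 0; 2; 7; 5; 4; 6]); (20, [:: 0; 1; 2; 7; 6; 3; 5]);
       (21, [:: 0; 3; 7; 2; 1; 4; 5]); (26, [:: 1; 4; 3; 0; 7; 2; 6]);
       (28, [:: 0; 3; 1; 4; 2; 7; 5]); (28, [:: 1; 4; 0; 3; 2; 7; 6]);
       (44, [:: 1; 0; 2; 7; 4; 8; 6; 5]); (40, [:: 1; 0; 2; 7; 4; 3; 8; 6]);
       (44, [:: 0; 1; 2; 7; 3; 8; 5; 6]); (40, [:: 0; 1; 2; 7; 3; 4; 8; 5]);
       (44, [:: 1; 0; 2; 3; 4; 7; 6; 5]); (44, [:: 0; 1; 2; 4; 3; 7; 5; 6]);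
       (40, [:: 1; 0; 2; 5; 4; 3; 7; 6]); (40, [:: 0; 1; 2; 6; 3; 4; 7; 5]);
       (58, [:: 0; 1; 2; 7; 4; 3; 6; 5; 8]); (59, [:: 0; 7; 1; 4; 3; 6; 2; 8; 5]);
       (58, [:: 0; 1; 2; 3; 4; 7; 8; 5; 6]); (58, [:: 0; 1; 2; 7; 4; 3; 8; 5; 6]);
       (58, [:: 0; 1; 2; 3; 8; 5; 4; 7; 6]); (58, [:: 0; 1; 2; 3; 8; 7; 4; 5; 6]);
       (59, [:: 1; 7; 0; 3; 4; 5; 2; 8; 6]); (57, [:: 0; 1; 2; 3; 4; 5; 6; 7; 8])]);
  ([:: [::]; [:: 0]; [:: 0; 1]; [:: 0; 1; 2]],
   [:: [:: 0; 1]; [:: 0; 2]; [:: 0; 3]; [:: 1; 2]; [:: 1; 3]; [:: 2; 3]],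
   [::]);
  ([:: [::]; [:: 0]; [:: 0; 1]; [:: 0]; [:: 0; 3]],
   [:: [:: 0; 1; 3]; [:: 0; 2; 3]; [:: 0; 1; 4]; [:: 0; 2; 4]; [:: 1; 2]; [:: 3; 4]],
   [::]);
  ([:: [::]; [:: 0]; [:: 0]; [:: 0; 2]; [:: 1]; [:: 1; 4]],
   [:: [:: 0; 1; 2]; [:: 0; 1; 3]; [:: 0; 1; 4]; [:: 0; 1; 5]; [:: 2; 3]; [:: 4; 5]],
   [::]);
  ([:: [::]; [:: 0]; [:: 0; 1]; [::]; [:: 3]; [:: 3; 4]],
   [:: [:: 0; 1]; [:: 0; 2]; [:: 1; 2]; [:: 3; 4]; [:: 3; 5]; [:: 4; 5]],
   [::]);
  ([:: [::]; [:: 0]; [:: 0; 1]; [:: 0]; [:: 1]; [:: 2]],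
   [:: [:: 0; 1; 3]; [:: 0; 2; 3]; [:: 0; 1; 4]; [:: 1; 2; 4]; [:: 0; 2; 5]; [:: 1; 2; 5]],
   [::]);
  ([:: [::]; [:: 0]; [:: 0; 1]; [:: 1; 2]; [:: 0; 1]; [:: 0]],
   [:: [:: 0; 1; 5]; [:: 0; 2; 4; 5]; [:: 0; 1; 3]; [:: 1; 2; 4]; [:: 1; 3; 4]; [:: 0; 2; 3]],
   [::]);
  ([:: [::]; [:: 0]; [:: 0; 1]; [:: 1; 2]; [:: 0]; [:: 4]],
   [:: [:: 0; 1; 4]; [:: 0; 2; 4]; [:: 1; 2]; [:: 0; 1; 3]; [:: 0; 2; 3]; [:: 0; 4; 5]],
   [::]);
  ([:: [::]; [:: 0]; [:: 0; 1]; [:: 0]; [:: 1; 3]; [:: 0]; [:: 1; 5]],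
   [:: [:: 0; 1; 3; 5]; [:: 0; 2; 3; 5]; [:: 0; 1; 4; 6]; [:: 1; 2; 4; 6]; [:: 0; 1; 3; 4]; [:: 0; 1; 5; 6]],
   [::]);
  ([:: [::]; [:: 0]; [:: 0; 1]; [:: 0; 2]; [:: 1; 3]; [:: 0; 1]; [:: 0]],
   [:: [:: 0; 1; 3; 6]; [:: 0; 2; 5; 6]; [:: 0; 3; 5; 6]; [:: 1; 2; 4; 5]; [:: 0; 1; 3; 4]; [:: 1; 2; 3; 4]],
   [::]);
  ([:: [::]; [:: 0]; [:: 0; 1]; [:: 1; 2]; [:: 0; 3]; [:: 0; 1]; [:: 4]],
   [:: [:: 0; 2; 4; 5]; [:: 1; 2; 5]; [:: 1; 3; 5]; [:: 0; 1; 3; 4]; [:: 0; 2; 3; 4]; [:: 0; 3; 4; 6]],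
   [::]);
  ([:: [::]; [:: 0]; [:: 0; 1]; [:: 0; 1]; [:: 0; 2]; [::]; [:: 5]],
   [:: [:: 0; 2; 3]; [:: 0; 1; 4]; [:: 0; 3; 4]; [:: 1; 2; 3]; [:: 1; 2; 4]; [:: 5; 6]],
   [::]);
  ([:: [::]; [:: 0]; [:: 0; 1]; [:: 0; 1]; [:: 0; 2]; [:: 0]; [:: 5]],
   [:: [:: 0; 2; 3; 5]; [:: 0; 1; 4; 5]; [:: 0; 3; 4; 5]; [:: 1; 2; 3]; [:: 1; 2; 4]; [:: 0; 5; 6]],
   [::]);
  ([:: [::]; [:: 0]; [:: 1]; [:: 0; 2]; [:: 0; 2; 3]; [:: 1]; [:: 0]],
   [:: [:: 0; 1; 3; 6]; [:: 0; 1; 4; 6]; [:: 0; 1; 2; 5]; [:: 0; 1; 2; 3]; [:: 0; 1; 2; 4]; [:: 3; 4]],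
   [::]);
  ([:: [::]; [:: 0]; [:: 0; 1]; [:: 1; 2]; [:: 0]; [:: 1; 4]; [:: 0]],
   [:: [:: 0; 1; 4; 6]; [:: 0; 2; 4; 6]; [:: 1; 2; 5]; [:: 0; 1; 3; 5]; [:: 0; 2; 3]; [:: 0; 1; 4; 5]],
   [::]);
  ([:: [::]; [:: 0]; [:: 0; 1]; [:: 0; 2]; [:: 0]; [:: 4]; [:: 1]],
   [:: [:: 0; 2; 4]; [:: 0; 1; 3; 4]; [:: 0; 1; 6]; [:: 1; 2; 6]; [:: 1; 2; 3]; [:: 0; 4; 5]],
   [::]);
  ([:: [::]; [:: 0]; [:: 0]; [:: 0; 2]; [:: 1; 2]; [:: 0; 3]; [:: 1]],
   [:: [:: 0; 1; 3]; [:: 0; 1; 2; 5]; [:: 0; 1; 4; 6]; [:: 2; 3; 4]; [:: 0; 1; 2; 4]; [:: 2; 3; 5]],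
   [::]);
  ([:: [::]; [:: 0]; [:: 0; 1]; [:: 0; 1]; [:: 2]; [:: 1; 4]; [:: 0]],
   [:: [:: 0; 1; 6]; [:: 0; 2; 3; 6]; [:: 0; 1; 5]; [:: 1; 2; 3; 5]; [:: 0; 2; 4]; [:: 1; 2; 4; 5]],
   [::]);
  ([:: [::]; [:: 0]; [:: 0; 1]; [:: 0; 1]; [:: 1]; [:: 2; 4]; [:: 0; 4]],
   [:: [:: 0; 2; 3; 6]; [:: 1; 2; 3; 4]; [:: 0; 2; 5]; [:: 1; 4; 5; 6]; [:: 0; 1; 4; 6]; [:: 1; 2; 4; 5]],
   [::]);
  ([:: [::]; [:: 0]; [:: 0; 1]; [:: 1; 2]; [:: 0; 3]; [:: 0]; [:: 1]],
   [:: [:: 0; 1; 4; 5]; [:: 0; 2; 4; 5]; [:: 1; 2; 6]; [:: 0; 1; 3; 6]; [:: 0; 1; 3; 4]; [:: 0; 2; 3; 4]],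
   [::]);
  ([:: [::]; [:: 0]; [:: 0; 1]; [:: 1; 2]; [:: 0]; [::]; [:: 5]],
   [:: [:: 0; 1; 4]; [:: 0; 2; 4]; [:: 1; 2]; [:: 0; 1; 3]; [:: 0; 2; 3]; [:: 5; 6]],
   [::]);
  ([:: [::]; [:: 0]; [:: 0; 1]; [:: 2]; [:: 1; 3]; [:: 0; 3]; [:: 0]],
   [:: [:: 0; 1; 5; 6]; [:: 0; 2; 5; 6]; [:: 0; 1; 4]; [:: 2; 3; 4; 5]; [:: 0; 2; 3; 5]; [:: 1; 2; 3; 4]],
   [::]);
  ([:: [::]; [:: 0]; [:: 1]; [:: 0; 2]; [:: 0; 3]; [:: 1; 4]; [:: 0; 2]],
   [:: [:: 0; 1; 4; 6]; [:: 0; 1; 2; 5]; [:: 0; 1; 2; 3; 6]; [:: 2; 3; 4]; [:: 3; 4; 5]; [:: 0; 1; 4; 5]],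
   [::]);
  ([:: [::]; [:: 0]; [:: 0]; [:: 1; 2]; [:: 2; 3]; [:: 1; 4]; [:: 0]],
   [:: [:: 0; 1; 2; 6]; [:: 0; 1; 3; 5]; [:: 0; 2; 4]; [:: 0; 1; 2; 3]; [:: 2; 4; 5]; [:: 1; 3; 4; 5]],
   [::]);
  ([:: [::]; [:: 0]; [:: 0; 1]; [:: 0]; [:: 1]; [:: 2; 4]; [:: 3]],
   [:: [:: 0; 1; 3]; [:: 0; 2; 3]; [:: 0; 1; 4]; [:: 0; 2; 5]; [:: 0; 3; 6]; [:: 1; 2; 4; 5]],
   [::]);
  ([:: [::]; [:: 0]; [:: 0; 1]; [:: 1]; [:: 0; 3]; [:: 2]; [:: 0; 5]],
   [:: [:: 0; 1; 4; 6]; [:: 0; 2; 4; 6]; [:: 1; 2; 3]; [:: 1; 2; 5]; [:: 0; 1; 3; 4]; [:: 0; 2; 5; 6]],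
   [::]);
  ([:: [::]; [:: 0]; [:: 1]; [:: 1; 2]; [:: 0; 3]; [:: 0]; [:: 2]],
   [:: [:: 0; 1; 4; 5]; [:: 0; 1; 2]; [:: 1; 2; 6]; [:: 2; 3; 6]; [:: 2; 3; 4]; [:: 0; 1; 3; 4]],
   [::]);
  ([:: [::]; [:: 0]; [:: 1]; [:: 0; 2]; [:: 1; 2]; [:: 0; 3]; [:: 0]],
   [:: [:: 0; 1; 3; 6]; [:: 0; 1; 5; 6]; [:: 0; 1; 4]; [:: 2; 3; 4]; [:: 0; 1; 2; 3]; [:: 2; 3; 5]],
   [::]);
  ([:: [::]; [:: 0]; [:: 0; 1]; [:: 0]; [:: 1]; [:: 3]; [:: 4]],
   [:: [:: 0; 1; 3]; [:: 0; 2; 3]; [:: 0; 1; 4]; [:: 1; 2; 4]; [:: 0; 3; 5]; [:: 1; 4; 6]],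
   [::]);
  ([:: [::]; [:: 0]; [:: 0]; [:: 1; 2]; [:: 0; 2]; [:: 1]; [:: 0; 5]],
   [:: [:: 0; 1; 2; 6]; [:: 0; 1; 4; 6]; [:: 0; 1; 3; 5]; [:: 2; 3; 4]; [:: 0; 1; 2; 3]; [:: 0; 1; 5; 6]],
   [::]);
  ([:: [::]; [:: 0]; [:: 0; 1]; [:: 1]; [:: 3]; [:: 4]; [:: 0]],
   [:: [:: 0; 1; 6]; [:: 0; 2; 6]; [:: 0; 1; 3]; [:: 1; 2; 3]; [:: 1; 3; 4]; [:: 3; 4; 5]],
   [::]);
  ([:: [::]; [:: 0]; [:: 0]; [:: 1; 2]; [:: 2; 3]; [:: 0]; [:: 1; 5]],
   [:: [:: 0; 1; 2; 5]; [:: 0; 1; 3; 6]; [:: 0; 2; 4]; [:: 0; 1; 2; 3]; [:: 1; 3; 4]; [:: 0; 1; 5; 6]],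
   [::]);
  ([:: [::]; [:: 0]; [:: 1]; [:: 2]; [:: 0]; [:: 0; 4]; [:: 3]],
   [:: [:: 0; 1; 4]; [:: 0; 1; 5]; [:: 0; 1; 2]; [:: 1; 2; 3]; [:: 2; 3; 6]; [:: 4; 5]],
   [::]);
  ([:: [::]; [:: 0]; [:: 0]; [:: 1; 2]; [:: 0; 3]; [:: 1; 2]; [:: 1; 4; 5]; [:: 0]],
   [:: [:: 0; 1; 2; 4; 7]; [:: 0; 1; 2; 3; 5]; [:: 0; 1; 2; 3; 4]; [:: 0; 1; 3; 4; 6]; [:: 2; 5; 6]; [:: 4; 5; 6]],
   [::]);
  ([:: [::]; [:: 0]; [:: 1]; [:: 1; 2]; [:: 0; 2]; [:: 0; 3]; [::]; [:: 6]],
   [:: [:: 0; 1; 4; 5]; [:: 2; 3; 4]; [:: 0; 1; 2; 4]; [:: 2; 3; 5]; [:: 0; 1; 3; 5]; [:: 6; 7]],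
   [::]);
  ([:: [::]; [:: 0]; [:: 1]; [:: 1; 2]; [:: 0; 2]; [:: 0; 3]; [:: 0]; [:: 6]],
   [:: [:: 0; 1; 4; 5; 6]; [:: 2; 3; 4]; [:: 0; 1; 2; 4]; [:: 2; 3; 5]; [:: 0; 1; 3; 5]; [:: 0; 6; 7]],
   [::]);
  ([:: [::]; [:: 0]; [:: 0; 1]; [:: 1]; [:: 2; 3]; [:: 0]; [::]; [:: 6]],
   [:: [:: 0; 1; 5]; [:: 0; 2; 5]; [:: 0; 1; 3]; [:: 0; 2; 4]; [:: 1; 2; 3; 4]; [:: 6; 7]],
   [::]);
  ([:: [::]; [:: 0]; [:: 0; 1]; [:: 0]; [:: 1; 3]; [:: 3; 4]; [::]; [:: 6]],
   [:: [:: 0; 2; 3]; [:: 1; 2; 4]; [:: 0; 3; 5]; [:: 0; 1; 3; 4]; [:: 1; 4; 5]; [:: 6; 7]],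
   [::]);
  ([:: [::]; [:: 0]; [:: 1]; [:: 0; 2]; [:: 0; 2]; [:: 0; 3]; [:: 2; 4]; [:: 1]],
   [:: [:: 0; 1; 4; 5]; [:: 0; 1; 2; 7]; [:: 1; 2; 3; 6]; [:: 0; 1; 2; 3; 4]; [:: 2; 3; 5]; [:: 0; 4; 6]],
   [::]);
  ([:: [::]; [:: 0]; [:: 0; 1]; [:: 1]; [:: 0; 3]; [:: 0; 3]; [:: 1; 4]; [:: 3; 4]],
   [:: [:: 0; 2; 4; 5]; [:: 1; 2; 3; 6]; [:: 1; 3; 5; 7]; [:: 0; 1; 3; 4; 5]; [:: 0; 4; 6; 7]; [:: 0; 1; 3; 4; 6]],
   [::]);
  ([:: [::]; [:: 0]; [:: 0; 1]; [:: 0]; [:: 0]; [:: 3]; [:: 4]; [:: 1]],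
   [:: [:: 0; 1; 3; 4]; [:: 0; 2; 3; 4]; [:: 0; 1; 7]; [:: 1; 2; 7]; [:: 0; 3; 5]; [:: 0; 4; 6]],
   [::]);
  ([:: [::]; [:: 0]; [:: 0; 1]; [:: 1]; [:: 0]; [:: 1; 4]; [:: 3]; [:: 0]],
   [:: [:: 0; 1; 4; 7]; [:: 0; 2; 4; 7]; [:: 0; 1; 3; 5]; [:: 1; 2; 3; 5]; [:: 1; 3; 6]; [:: 0; 1; 4; 5]],
   [::]);
  ([:: [::]; [:: 0]; [:: 1]; [:: 0; 2]; [:: 0; 3]; [:: 2]; [:: 1]; [:: 0]],
   [:: [:: 0; 1; 3; 7]; [:: 0; 1; 4; 7]; [:: 0; 1; 2; 6]; [:: 1; 2; 3; 5]; [:: 0; 1; 2; 3]; [:: 2; 3; 4]],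
   [::]);
  ([:: [::]; [:: 0]; [:: 0; 1]; [:: 1]; [:: 3]; [:: 0]; [::]; [:: 6]],
   [:: [:: 0; 1; 5]; [:: 0; 2; 5]; [:: 0; 1; 3]; [:: 1; 2; 3]; [:: 1; 3; 4]; [:: 6; 7]],
   [::]);
  ([:: [::]; [:: 0]; [:: 0]; [:: 1; 2]; [:: 0; 2]; [:: 0]; [:: 5]; [:: 1]],
   [:: [:: 0; 1; 2; 5]; [:: 0; 1; 4; 5]; [:: 0; 1; 3; 7]; [:: 2; 3; 4]; [:: 0; 1; 2; 3]; [:: 0; 5; 6]],
   [::]);
  ([:: [::]; [:: 0]; [:: 0; 1]; [:: 1]; [:: 0; 3]; [:: 3]; [:: 0]; [:: 1]],
   [:: [:: 0; 1; 4; 6]; [:: 0; 2; 4; 6]; [:: 0; 1; 3; 7]; [:: 1; 2; 3; 7]; [:: 1; 3; 4; 5]; [:: 0; 1; 3; 4]],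
   [::]);
  ([:: [::]; [:: 0]; [:: 0]; [:: 0; 2]; [:: 1]; [:: 0; 4]; [:: 1]; [:: 2]],
   [:: [:: 0; 1; 2; 5]; [:: 0; 1; 3; 5]; [:: 0; 1; 4; 6]; [:: 0; 2; 7]; [:: 2; 3; 7]; [:: 0; 1; 4; 5]],
   [::]);
  ([:: [::]; [:: 0]; [:: 1]; [:: 0; 2]; [:: 0]; [:: 0; 4]; [:: 2]; [:: 1]],
   [:: [:: 0; 1; 3; 4]; [:: 0; 1; 3; 5]; [:: 0; 1; 2; 7]; [:: 1; 2; 3; 6]; [:: 0; 1; 2; 3]; [:: 4; 5]],
   [::]);
  ([:: [::]; [:: 0]; [:: 1]; [:: 0]; [:: 1; 3]; [:: 2]; [:: 2; 5]; [:: 0]],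
   [:: [:: 0; 1; 3; 7]; [:: 0; 1; 2; 4]; [:: 1; 2; 5]; [:: 1; 2; 6]; [:: 0; 1; 3; 4]; [:: 5; 6]],
   [::]);
  ([:: [::]; [:: 0]; [:: 0]; [:: 1; 2]; [:: 0; 2]; [:: 1]; [:: 5]; [:: 0]],
   [:: [:: 0; 1; 2; 7]; [:: 0; 1; 4; 7]; [:: 0; 1; 3; 5]; [:: 2; 3; 4]; [:: 0; 1; 2; 3]; [:: 1; 5; 6]],
   [::]);
  ([:: [::]; [:: 0]; [:: 0]; [:: 0]; [:: 1]; [:: 1; 4]; [:: 2]; [:: 3]],
   [:: [:: 0; 1; 2; 3]; [:: 0; 1; 4]; [:: 0; 1; 5]; [:: 0; 2; 6]; [:: 0; 3; 7]; [:: 4; 5]],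
   [::]);
  ([:: [::]; [:: 0]; [:: 0]; [:: 2]; [:: 0]; [:: 0; 4]; [:: 3]; [:: 1]],
   [:: [:: 0; 1; 2; 4]; [:: 0; 1; 2; 5]; [:: 0; 1; 7]; [:: 0; 2; 3]; [:: 2; 3; 6]; [:: 4; 5]],
   [::]);
  ([:: [::]; [:: 0]; [:: 0]; [:: 1; 2]; [:: 2; 3]; [:: 1]; [:: 5]; [:: 0]],
   [:: [:: 0; 1; 2; 7]; [:: 0; 1; 3; 5]; [:: 0; 2; 4]; [:: 0; 1; 2; 3]; [:: 1; 3; 4]; [:: 1; 5; 6]],
   [::]);
  ([:: [::]; [:: 0]; [:: 1]; [:: 0]; [:: 0; 3]; [:: 2]; [::]; [:: 6]],
   [:: [:: 0; 1; 3]; [:: 0; 1; 4]; [:: 0; 1; 2]; [:: 1; 2; 5]; [:: 3; 4]; [:: 6; 7]],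
   [::]);
  ([:: [::]; [:: 0]; [:: 1]; [:: 1]; [:: 0; 3]; [:: 0]; [:: 0; 5]; [:: 2]],
   [:: [:: 0; 1; 4; 5]; [:: 0; 1; 4; 6]; [:: 0; 1; 2; 3]; [:: 1; 2; 7]; [:: 0; 1; 3; 4]; [:: 5; 6]],
   [::]);
  ([:: [::]; [:: 0]; [:: 0]; [:: 1; 2]; [:: 0]; [:: 0; 4]; [:: 1]; [:: 2]],
   [:: [:: 0; 1; 2; 4]; [:: 0; 1; 2; 5]; [:: 0; 1; 3; 6]; [:: 0; 2; 3; 7]; [:: 0; 1; 2; 3]; [:: 4; 5]],
   [::]);
  ([:: [::]; [:: 0]; [:: 1]; [:: 0; 2]; [:: 1]; [:: 0; 4]; [:: 0]; [:: 0; 6]],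
   [:: [:: 0; 1; 3; 5; 6]; [:: 0; 1; 3; 5; 7]; [:: 0; 1; 2; 4]; [:: 0; 1; 2; 3]; [:: 0; 1; 4; 5]; [:: 6; 7]],
   [::]);
  ([:: [::]; [:: 0]; [:: 1]; [:: 0]; [:: 2]; [::]; [:: 5]; [:: 5; 6]],
   [:: [:: 0; 1; 3]; [:: 0; 1; 2]; [:: 1; 2; 4]; [:: 5; 6]; [:: 5; 7]; [:: 6; 7]],
   [::]);
  ([:: [::]; [:: 0]; [:: 0; 1]; [:: 0]; [:: 1; 3]; [:: 0]; [:: 1]; [::]; [:: 7]],
   [:: [:: 0; 1; 3; 5]; [:: 0; 2; 3; 5]; [:: 0; 1; 4; 6]; [:: 1; 2; 4; 6]; [:: 0; 1; 3; 4]; [:: 7; 8]],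
   [::]);
  ([:: [::]; [:: 0]; [:: 0; 1]; [:: 0]; [:: 1; 3]; [:: 0; 4]; [:: 1; 3]; [:: 0]; [:: 1]],
   [:: [:: 0; 1; 3; 5; 7]; [:: 0; 2; 3; 5; 7]; [:: 0; 1; 4; 6; 8]; [:: 1; 2; 4; 6; 8]; [:: 0; 1; 3; 4; 6]; [:: 0; 1; 3; 4; 5]],
   [::]);
  ([:: [::]; [:: 0]; [:: 0]; [:: 1; 2]; [:: 0; 3]; [:: 1; 2]; [:: 0; 2]; [:: 1]; [:: 0]],
   [:: [:: 0; 1; 2; 4; 8]; [:: 0; 1; 4; 6; 8]; [:: 0; 1; 3; 5; 7]; [:: 2; 3; 5; 6]; [:: 0; 1; 2; 3; 5]; [:: 0; 1; 2; 3; 4]],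
   [::]);
  ([:: [::]; [:: 0]; [:: 0]; [:: 1]; [:: 0; 3]; [:: 0]; [:: 0; 5]; [:: 2]; [:: 1]],
   [:: [:: 0; 1; 2; 4; 5]; [:: 0; 1; 2; 4; 6]; [:: 0; 1; 3; 8]; [:: 0; 2; 7]; [:: 0; 1; 3; 4]; [:: 5; 6]],
   [::]);
  ([:: [::]; [:: 0]; [:: 1]; [:: 0; 2]; [:: 0; 2]; [:: 2; 4]; [:: 1]; [:: 3]; [:: 0]],
   [:: [:: 0; 1; 3; 4; 8]; [:: 0; 1; 2; 6]; [:: 1; 2; 3; 5]; [:: 0; 1; 2; 3; 4]; [:: 0; 2; 3; 7]; [:: 0; 4; 5]],
   [::]);
  ([:: [::]; [:: 0]; [:: 0]; [:: 0]; [:: 0]; [:: 0; 4]; [:: 1]; [:: 2]; [:: 3]],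
   [:: [:: 0; 1; 2; 3; 4]; [:: 0; 1; 2; 3; 5]; [:: 0; 1; 6]; [:: 0; 2; 7]; [:: 0; 3; 8]; [:: 4; 5]],
   [::]);
  ([:: [::]; [:: 0]; [:: 0]; [:: 1; 2]; [:: 0; 3]; [:: 0; 4]; [:: 1]; [:: 2]; [:: 0]],
   [:: [:: 0; 1; 2; 4; 8]; [:: 0; 1; 2; 5; 8]; [:: 0; 1; 3; 6]; [:: 0; 2; 3; 7]; [:: 0; 1; 2; 3; 4]; [:: 3; 4; 5]],
   [::]);
  ([:: [::]; [:: 0]; [:: 0]; [:: 0]; [:: 0; 3]; [:: 1]; [:: 2]; [::]; [:: 7]],
   [:: [:: 0; 1; 2; 3]; [:: 0; 1; 2; 4]; [:: 0; 1; 5]; [:: 0; 2; 6]; [:: 3; 4]; [:: 7; 8]],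
   [::]);
  ([:: [::]; [:: 0]; [:: 0]; [:: 1; 2]; [:: 0; 3]; [:: 1; 2]; [:: 2; 3]; [:: 0]; [:: 1]],
   [:: [:: 0; 1; 2; 4; 7]; [:: 0; 1; 3; 5; 8]; [:: 0; 2; 5; 6]; [:: 0; 1; 2; 3; 5]; [:: 1; 3; 4; 6]; [:: 0; 1; 2; 3; 4]],
   [::]);
  ([:: [::]; [:: 0]; [:: 0]; [:: 1; 2]; [:: 0; 2]; [:: 1]; [:: 0]; [::]; [:: 7]],
   [:: [:: 0; 1; 2; 6]; [:: 0; 1; 4; 6]; [:: 0; 1; 3; 5]; [:: 2; 3; 4]; [:: 0; 1; 2; 3]; [:: 7; 8]],
   [::]);
  ([:: [::]; [:: 0]; [:: 0]; [:: 1; 2]; [:: 0; 3]; [:: 1; 2]; [:: 0; 4]; [:: 1]; [:: 0]],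
   [:: [:: 0; 1; 2; 4; 8]; [:: 0; 1; 2; 6; 8]; [:: 0; 1; 3; 5; 7]; [:: 0; 1; 2; 3; 5]; [:: 0; 1; 2; 3; 4]; [:: 3; 4; 6]],
   [::]);
  ([:: [::]; [:: 0]; [:: 1]; [:: 0; 2]; [:: 1; 3]; [:: 0; 2]; [:: 0]; [:: 0; 6]; [:: 1]],
   [:: [:: 0; 1; 3; 5; 6]; [:: 0; 1; 3; 5; 7]; [:: 0; 1; 2; 4; 8]; [:: 0; 1; 2; 3; 5]; [:: 0; 1; 2; 3; 4]; [:: 6; 7]],
   [::]);
  ([:: [::]; [:: 0]; [:: 0]; [:: 1; 2]; [:: 1; 2]; [:: 0; 3]; [:: 2; 4]; [:: 0]; [:: 1]],
   [:: [:: 0; 1; 2; 5; 7]; [:: 0; 1; 3; 4; 8]; [:: 0; 2; 3; 6]; [:: 0; 1; 2; 3; 4]; [:: 0; 1; 2; 3; 5]; [:: 1; 4; 6]],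
   [::]);
  ([:: [::]; [:: 0]; [:: 1]; [:: 0; 2]; [:: 0]; [:: 0; 4]; [:: 1]; [::]; [:: 7]],
   [:: [:: 0; 1; 3; 4]; [:: 0; 1; 3; 5]; [:: 0; 1; 2; 6]; [:: 0; 1; 2; 3]; [:: 4; 5]; [:: 7; 8]],
   [::]);
  ([:: [::]; [:: 0]; [:: 0]; [:: 1; 2]; [:: 2; 3]; [:: 0]; [:: 1]; [::]; [:: 7]],
   [:: [:: 0; 1; 2; 5]; [:: 0; 1; 3; 6]; [:: 0; 2; 4]; [:: 0; 1; 2; 3]; [:: 1; 3; 4]; [:: 7; 8]],
   [::]);
  ([:: [::]; [:: 0]; [:: 0]; [:: 0; 2]; [:: 1]; [::]; [:: 5]; [::]; [:: 7]],
   [:: [:: 0; 1; 2]; [:: 0; 1; 3]; [:: 0; 1; 4]; [:: 2; 3]; [:: 5; 6]; [:: 7; 8]],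
   [::]);
  ([:: [::]; [:: 0]; [:: 0]; [:: 1]; [::]; [:: 4]; [:: 4; 5]; [::]; [:: 7]],
   [:: [:: 0; 1; 2]; [:: 0; 1; 3]; [:: 4; 5]; [:: 4; 6]; [:: 5; 6]; [:: 7; 8]],
   [::]);
  ([:: [::]; [:: 0]; [:: 0; 1]; [:: 0]; [:: 1]; [::]; [:: 5]; [::]; [:: 7]],
   [:: [:: 0; 1; 3]; [:: 0; 2; 3]; [:: 0; 1; 4]; [:: 1; 2; 4]; [:: 5; 6]; [:: 7; 8]],
   [::]);
  ([:: [::]; [:: 0]; [:: 0; 1]; [::]; [:: 3]; [::]; [:: 5]; [::]; [:: 7]],
   [:: [:: 0; 1]; [:: 0; 2]; [:: 1; 2]; [:: 3; 4]; [:: 5; 6]; [:: 7; 8]],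
   [::]);
  ([:: [::]; [:: 0]; [:: 0; 1]; [:: 0]; [:: 1]; [::]; [:: 5]; [:: 5]; [:: 6]],
   [:: [:: 0; 1; 3]; [:: 0; 2; 3]; [:: 0; 1; 4]; [:: 1; 2; 4]; [:: 5; 6; 7]; [:: 5; 6; 8]],
   [::]);
  ([:: [::]; [:: 0]; [:: 0]; [:: 0; 2]; [:: 1]; [::]; [:: 5]; [:: 5]; [:: 6]],
   [:: [:: 0; 1; 2]; [:: 0; 1; 3]; [:: 0; 1; 4]; [:: 2; 3]; [:: 5; 6; 7]; [:: 5; 6; 8]],
   [::]);
  ([:: [::]; [:: 0]; [:: 0]; [:: 1; 2]; [:: 0]; [:: 1]; [::]; [:: 6]; [:: 6; 7]],
   [:: [:: 0; 1; 2; 4]; [:: 0; 1; 3; 5]; [:: 0; 1; 2; 3]; [:: 6; 7]; [:: 6; 8]; [:: 7; 8]],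
   [::]);
  ([:: [::]; [:: 0]; [:: 0; 1]; [:: 0]; [:: 3]; [:: 1; 4]],
   [:: [:: 0; 1; 3]; [:: 0; 2; 3]; [:: 0; 1; 5]; [:: 1; 2; 5]; [:: 0; 3; 4]; [:: 3; 4; 5]; [:: 1; 4; 5]],
   [::]);
  ([:: [::]; [:: 0]; [:: 0; 1]; [:: 0; 1]; [:: 0; 2]; [:: 1; 3]],
   [:: [:: 0; 2; 3]; [:: 0; 1; 4]; [:: 0; 3; 4]; [:: 1; 2; 3]; [:: 0; 1; 5]; [:: 1; 2; 5]; [:: 1; 2; 4]],
   [::]);
  ([:: [::]; [:: 0]; [:: 0; 1]; [:: 0; 2]; [:: 0; 3]; [:: 1; 4]],
   [:: [:: 0; 1; 3]; [:: 0; 2; 4]; [:: 1; 2; 5]; [:: 1; 2; 3]; [:: 2; 3; 4]; [:: 3; 4; 5]; [:: 0; 1; 4; 5]],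
   [::]);
  ([:: [::]; [:: 0]; [:: 0; 1]; [:: 0; 1]; [:: 0; 2]; [:: 1; 2]],
   [:: [:: 0; 2; 3]; [:: 0; 1; 4]; [:: 0; 3; 4]; [:: 1; 2; 3]; [:: 0; 1; 5]; [:: 1; 3; 5]; [:: 1; 2; 4]],
   [::]);
  ([:: [::]; [:: 0]; [:: 0; 1]; [:: 0; 2]; [:: 1; 2; 3]; [:: 0; 1]],
   [:: [:: 0; 2; 5]; [:: 0; 3; 5]; [:: 1; 2; 5]; [:: 1; 4; 5]; [:: 1; 2; 3]; [:: 0; 2; 4]; [:: 0; 1; 3; 4]],
   [::]);
  ([:: [::]; [:: 0]; [:: 0; 1]; [:: 0; 1]; [:: 0; 2]; [:: 0; 3; 4]],
   [:: [:: 0; 2; 3]; [:: 0; 1; 4]; [:: 0; 3; 4]; [:: 0; 1; 5]; [:: 0; 2; 5]; [:: 1; 2; 3]; [:: 1; 2; 4]],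
   [::]);
  ([:: [::]; [:: 0]; [:: 0; 1]; [:: 0; 2]; [:: 0; 3]; [:: 1]],
   [:: [:: 0; 1; 3]; [:: 0; 1; 4]; [:: 0; 2; 4]; [:: 0; 1; 5]; [:: 1; 2; 5]; [:: 1; 2; 3]; [:: 2; 3; 4]],
   [::]);
  ([:: [::]; [:: 0]; [:: 0; 1]; [:: 1; 2]; [:: 0]; [:: 3]],
   [:: [:: 0; 1; 4]; [:: 0; 2; 4]; [:: 1; 2]; [:: 0; 1; 3]; [:: 0; 2; 3]; [:: 1; 3; 5]; [:: 2; 3; 5]],
   [::]);
  ([:: [::]; [:: 0]; [:: 0; 1]; [:: 1; 2]; [:: 0]; [:: 3; 4]],
   [:: [:: 0; 1; 4]; [:: 0; 2; 4]; [:: 1; 2]; [:: 0; 1; 3]; [:: 0; 2; 3]; [:: 1; 3; 5]; [:: 2; 3; 5]],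
   [::]);
  ([:: [::]; [:: 0]; [:: 0; 1]; [:: 0; 2]; [:: 1; 2; 3]; [:: 0; 1; 3]; [:: 0; 1; 4]],
   [:: [:: 0; 2; 5; 6]; [:: 1; 2; 5; 6]; [:: 0; 1; 3; 4]; [:: 1; 2; 3; 5]; [:: 1; 3; 4; 5]; [:: 0; 2; 4; 6]; [:: 0; 3; 4; 6]],
   [::]);
  ([:: [::]; [:: 0]; [:: 0; 1]; [:: 1; 2]; [:: 0; 1]; [:: 2; 3; 4]; [:: 0; 3]],
   [:: [:: 0; 2; 4; 6]; [:: 1; 3; 5; 6]; [:: 0; 1; 3; 6]; [:: 0; 2; 3; 6]; [:: 0; 2; 4; 5]; [:: 1; 2; 4; 5]; [:: 1; 3; 4; 5]],
   [::]);
  ([:: [::]; [:: 0]; [:: 0; 1]; [:: 0; 1]; [:: 0; 2; 3]; [:: 0; 1]; [:: 0; 2]],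
   [:: [:: 0; 2; 3; 5]; [:: 0; 1; 4; 6]; [:: 0; 3; 5; 6]; [:: 0; 4; 5; 6]; [:: 1; 2; 3; 5]; [:: 1; 2; 4; 6]; [:: 1; 2; 3; 4]],
   [::]);
  ([:: [::]; [:: 0]; [:: 0; 1]; [:: 1; 2]; [:: 0; 2]; [:: 0; 3]; [:: 1; 4]],
   [:: [:: 0; 1; 4; 5]; [:: 0; 1; 3; 6]; [:: 2; 3; 4]; [:: 0; 1; 3; 5]; [:: 0; 2; 3; 5]; [:: 0; 1; 4; 6]; [:: 1; 2; 4; 6]],
   [::]);
  ([:: [::]; [:: 0]; [:: 0; 1]; [:: 0; 2]; [:: 1; 3]; [:: 0; 1; 4]; [:: 0; 1]],
   [:: [:: 0; 2; 5; 6]; [:: 0; 3; 5; 6]; [:: 1; 2; 4; 6]; [:: 1; 2; 5; 6]; [:: 0; 1; 3; 4]; [:: 1; 2; 3; 4]; [:: 0; 3; 4; 5]],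
   [::]);
  ([:: [::]; [:: 0]; [:: 0; 1]; [:: 1; 2]; [:: 0; 1; 3]; [:: 0; 2; 3]; [:: 0]],
   [:: [:: 0; 2; 4; 6]; [:: 0; 1; 5; 6]; [:: 0; 4; 5; 6]; [:: 1; 2; 4]; [:: 1; 2; 5]; [:: 0; 2; 3; 4]; [:: 0; 1; 3; 5]],
   [::]);
  ([:: [::]; [:: 0]; [:: 0; 1]; [:: 0; 1]; [:: 0; 2]; [:: 1; 3; 4]; [:: 2; 3; 4; 5]],
   [:: [:: 0; 2; 3; 6]; [:: 1; 2; 3; 6]; [:: 0; 1; 4; 5]; [:: 1; 2; 4; 5]; [:: 0; 3; 4; 5]; [:: 0; 3; 4; 6]; [:: 1; 2; 5; 6]],
   [::]);
  ([:: [::]; [:: 0]; [:: 0; 1]; [:: 1; 2]; [:: 0; 3]; [:: 0]; [:: 1; 5]],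
   [:: [:: 0; 1; 4; 5]; [:: 0; 2; 4; 5]; [:: 1; 2; 6]; [:: 0; 1; 3; 6]; [:: 0; 1; 3; 4]; [:: 0; 2; 3; 4]; [:: 0; 1; 5; 6]],
   [::]);
  ([:: [::]; [:: 0]; [:: 0; 1]; [:: 1; 2]; [:: 0; 3]; [:: 1; 2]; [:: 0]],
   [:: [:: 0; 1; 4; 6]; [:: 0; 2; 4; 6]; [:: 1; 2]; [:: 0; 1; 3; 5]; [:: 0; 2; 3; 5]; [:: 0; 1; 3; 4]; [:: 0; 2; 3; 4]],
   [::]);
  ([:: [::]; [:: 0]; [:: 0; 1]; [:: 0; 2]; [:: 1; 2; 3]; [:: 0]; [:: 1]],
   [:: [:: 0; 2; 5]; [:: 0; 1; 3; 5]; [:: 1; 2; 6]; [:: 0; 1; 4; 6]; [:: 1; 2; 3]; [:: 0; 2; 4]; [:: 0; 1; 3; 4]],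
   [::]);
  ([:: [::]; [:: 0]; [:: 0; 1]; [:: 1]; [:: 2; 3]; [:: 0; 3]; [:: 0; 4]],
   [:: [:: 0; 1; 5; 6]; [:: 0; 2; 5; 6]; [:: 1; 3; 4; 5]; [:: 0; 1; 3; 5]; [:: 1; 2; 3; 4]; [:: 2; 3; 4; 6]; [:: 0; 2; 4; 6]],
   [::]);
  ([:: [::]; [:: 0]; [:: 0; 1]; [:: 1]; [:: 2; 3]; [:: 3; 4]; [:: 0]],
   [:: [:: 0; 1; 6]; [:: 0; 2; 6]; [:: 0; 1; 3]; [:: 0; 2; 4]; [:: 1; 3; 5]; [:: 1; 2; 3; 4]; [:: 2; 4; 5]],
   [::]);
  ([:: [::]; [:: 0]; [:: 0; 1]; [:: 0]; [:: 3]; [:: 4]; [:: 1; 5]],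
   [:: [:: 0; 1; 3]; [:: 0; 2; 3]; [:: 0; 1; 6]; [:: 1; 2; 6]; [:: 0; 3; 4]; [:: 3; 4; 5]; [:: 4; 5; 6]],
   [::]);
  ([:: [::]; [:: 0]; [:: 1]; [:: 2]; [:: 0; 3]; [:: 0]; [:: 0; 5]],
   [:: [:: 0; 1; 4; 5]; [:: 0; 1; 4; 6]; [:: 0; 1; 2]; [:: 1; 2; 3]; [:: 2; 3; 4]; [:: 0; 3; 4]; [:: 5; 6]],
   [::]);
  ([:: [::]; [:: 0]; [:: 0]; [:: 0; 2]; [:: 1; 2]; [:: 1; 3; 4]; [:: 0]; [:: 1]],
   [:: [:: 0; 1; 2; 6]; [:: 0; 1; 3; 6]; [:: 0; 1; 4; 7]; [:: 0; 1; 5; 7]; [:: 0; 1; 2; 4]; [:: 0; 1; 3; 5]; [:: 2; 3; 4; 5]],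
   [::]);
  ([:: [::]; [:: 0]; [:: 0; 1]; [::]; [:: 3]; [:: 3]; [:: 4]; [:: 5; 6]],
   [:: [:: 0; 1]; [:: 0; 2]; [:: 1; 2]; [:: 3; 4; 5]; [:: 3; 4; 6]; [:: 3; 5; 7]; [:: 4; 6; 7]],
   [::])].

(** * Evaluation of the table and the theorem *)

Lemma table_valid : table_ok table.
(* The proof is the evaluation of [table_ok table] to [true]; with [exact_no_check] this conversion
   is left to the kernel and is carried out only once, at [Qed]. *)
Proof. exact_no_check (erefl true). Qed.

Lemma triangle_in_table :
  exists F certs, ([:: [::]; [:: true]; [:: true; true]], F, certs) \in table.
Proof. by do 2!eexists; apply: mem_head. Qed.

Lemma realizes_triangle (T : finType) (e : rel T) x y z :
    symmetric e -> irreflexive e -> e x y -> e x z -> e y z ->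
  realizes e x [:: x; y; z] [:: [::]; [:: true]; [:: true; true]].
Proof.
move=> e_sym e_irr xy xz yz; split=> // i j.
by case: i => [|[|[|]]] //; case: j => [|[|[|]]] //= _ _;
  rewrite ?e_irr ?xy ?xz ?yz // e_sym ?xy ?xz ?yz.
Qed.

(** The neighbour is the first step of a path to some other vertex. *)
Lemma connected_neighbor (T : finType) (e : rel T) :
  connected_graph e -> 1 < #|T| -> forall x, exists y, e x y.
Proof.
move=> con; rewrite -cardsT => /card_gt1P[y [z [_ _ yz]]] x.
have [w wx] : exists w, w != x.
  by case: (eqVneq y x) yz => [-> xz|yx _]; [exists z; rewrite eq_sym | exists y].
have /connectP[[|v p] /=] := con x w; first by move=> _ E; rewrite E eqxx in wx.
by case/andP=> xv _ _; exists v.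
Qed.

Theorem theorem3 (T : finType) (e : rel T) :
  simple_graph e -> connected_graph e -> false_twin_free e ->
  13 <= #|T| -> 7 <= #|bicliques e|.
Proof.
move=> [e_sym e_irr] con ftf n13.
have nbr := connected_neighbor con (leq_trans (isT : 1 < 13) n13).
(* The case distinction is whether the graph contains a triangle, the graph of the first table
   entry. *)
have [/existsP[[[x y] z] /= /and3P[xy xz yz]]|tfree] :=
  boolP [exists t : T * T * T, [&& e t.1.1 t.1.2, e t.1.1 t.2 & e t.1.2 t.2]].
  have [F [certs Hin]] := triangle_in_table.
  have := table_sound e_sym e_irr ftf nbr table_valid Hin (realizes_triangle e_sym e_irr xy xz yz).
  by rewrite leqNgt n13.
have : #|T| <= #|bicliques e|.*2.
  apply: triangle_free_bicliques => // x y z xy xz; apply: contra tfree => yz.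
  by apply/existsP; exists (x, y, z); rewrite /= xy xz yz.
(* Six bicliques would allow only 12 vertices, one fewer than assumed. *)
move=> /(leq_trans n13) n2k; rewrite leqNgt; apply/negP; rewrite ltnS -leq_double => k6.
by have := leq_trans n2k k6.
Qed.
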